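(* Fix non-collinear $z_1,z_2,z_3\in\mathbb C$ and let $z_4,\dots,z_{N+3}$ be points in the open triangle $z_1z_2z_3$ with all $N+3$ points pairwise distinct and with a unique Delaunay triangulation $T$ (whose convex hull is the triangle $z_1z_2z_3$). Regard $T$ as a triangulation of the sphere by adding the exterior face $f_0$ with vertices $v_1,v_2,v_3$, oriented so that interior faces are counterclockwise and $f_0$ is listed clockwise. Let $\mathcal E_0$ be a set of $2N$ edges whose complement in $\mathcal E(T)$ is a cycle-rooted spanning tree with odd cycle, let $J'$ be the $2N\times2N$ matrix with rows indexed by $z_v$ and $\bar z_v$, $v\in\{4,\dots,N+3\}$, columns indexed by $\mathcal E_0$, entries $\partial\theta_e/\partial z_v$ and $\partial\theta_e/\partial\bar z_v$, and $\mathcal D_T(z)_{\setminus\{1,2,3\}}=|(2/\mathrm i)^N\det J'|$. Let $\mathcal A_T=-\sum_{f\neq f_0}\mathrm{Vol}(f)+\mathrm{Vol}(z_1,z_2,z_3)$ (interior faces listed counterclockwise, the last term with the counterclockwise listing) and $D_{u\bar v}=\partial^2\mathcal A_T/\partial z_u\partial\bar z_v$. Then $$\mathcal D_T(z)_{\setminus\{1,2,3\}}=2^N\det\big(D_{u\bar v}\big)_{u,v\in\{4,\dots,N+3\}}.$$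
   Context: For each edge $e=\{a,b\}$ with adjacent faces $(a,b,c)$ and $(b,a,d)$ listed in positive cyclic order for the sphere orientation, $\theta_e=\pi-\mathrm{Arg}\frac{z_b-z_c}{z_a-z_c}-\mathrm{Arg}\frac{z_a-z_d}{z_b-z_d}$ (any local continuous branch; for interior edges this is $\pi$ minus the two angles opposite $e$, i.e. the Delaunay edge angle). For a triangle listed $(z_a,z_b,z_c)$, $\mathrm{Vol}=\mathrm{Im}\,\mathrm{Li}_2(w)+\ln|w|\,\mathrm{Arg}(1-w)$, $w=\frac{z_c-z_a}{z_b-z_a}$ (Bloch–Wigner function; the hyperbolic volume of the ideal tetrahedron $(z_a,z_b,z_c,\infty)$ when counterclockwise). A cycle-rooted spanning tree is a connected spanning subgraph with as many edges as vertices. Derivatives are Wirtinger derivatives. *)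

(* Defs.v *)
From HB Require Import structures.
From mathcomp Require Import all_boot all_order all_algebra.
From mathcomp Require Import all_classical all_reals all_analysis.
From mathcomp Require Import complex.
Set Implicit Arguments. Unset Strict Implicit. Unset Printing Implicit Defensive.
Import Order.TTheory GRing.Theory Num.Theory.
Local Open Scope ring_scope.

Section DelaunayDefs.
Variable R : realType.
Local Notation C := R[i].

Definition cR (x : R) : C := Complex x 0.
Definition cI : C := Complex 0 1.

Definition Arg (w : C) : R :=
  let x := complex.Re w in let y := complex.Im w in
  if 0 < x then atan (y / x)
  else if x < 0 then (if 0 <= y then atan (y / x) + pi else atan (y / x) - pi)
  else if 0 < y then pi / 2 else if y < 0 then - (pi / 2) else 0.

Definition modC (w : C) : R := Num.sqrt (complex.Re w ^+ 2 + complex.Im w ^+ 2).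

(* Im Li_2(w), principal branch, via Li_2(w) = - int_0^1 Log(1 - t w) / t dt,
   whose imaginary part is - int_0^1 Arg(1 - t w) / t dt *)
Definition ImLi2 (w : C) : R :=
  - Rintegral (@lebesgue_measure R) `[0%R, 1%R]%classic
      (fun t => Arg (1 - cR t * w) / t).

Definition BlochWigner (w : C) : R := ImLi2 w + ln (modC w) * Arg (1 - w).

Definition Vol (za zb zc : C) : R := BlochWigner ((zc - za) / (zb - za)).

Variable n : nat.
Local Notation config := ('I_n -> C).

(* twice the signed area: > 0 iff (a,b,c) is counterclockwise *)
Definition cross (z : config) (a b c : 'I_n) : R :=
  complex.Re (z b - z a) * complex.Im (z c - z a)
  - complex.Im (z b - z a) * complex.Re (z c - z a).

Definition conv (z : config) (A : {set 'I_n}) : set C :=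
  [set p | exists l : 'I_n -> R, (forall i, 0 <= l i) /\
     (forall i, i \notin A -> l i = 0) /\ \sum_i l i = 1 /\
     p = \sum_i cR (l i) * z i].

Definition is_triangulation (z : config) (T : {set {set 'I_n}}) : Prop :=
  [/\ (forall t, t \in T -> exists a b c, t = [set a; b; c] /\ cross z a b c != 0),
      (forall t t', t \in T -> t' \in T -> (conv z t `&` conv z t')%classic = conv z (t :&: t')),
      (forall p, conv z [set: 'I_n]%SET p <-> exists2 t, t \in T & conv z t p) &
      (forall i, exists2 t, t \in T & i \in t)].

Definition is_Delaunay_triangulation (z : config) (T : {set {set 'I_n}}) : Prop :=
  is_triangulation z T /\
  forall t, t \in T -> exists (c0 : C) (r : R),
    (forall a, a \in t -> modC (z a - c0) = r) /\ (forall j, r <= modC (z j - c0)).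

Variables (v1 v2 v3 : 'I_n).

Definition f0 : {set 'I_n} := [set v1; v2; v3].

Definition pos_face (z : config) (T : {set {set 'I_n}}) (a b c : 'I_n) : bool :=
  (([set a; b; c] \in T) && (0 < cross z a b c)) ||
  (([set a; b; c] == f0) && (cross z a b c < 0)).

Definition edgesT (T : {set {set 'I_n}}) : {set {set 'I_n}} :=
  [set e : {set 'I_n} | (#|e| == 2) && ([exists t in T, e \subset t] || (e \subset f0))].

Definition thirdv (z : config) (T : {set {set 'I_n}}) (a b : 'I_n) : 'I_n :=
  odflt a [pick c | pos_face z T a b c].

(* theta_e as a function of the configuration w, for e = {a,b}; the
   combinatorics (c, d) is that of T at the base configuration z *)
Definition theta (z : config) (T : {set {set 'I_n}}) (a b : 'I_n) (w : config) : R :=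
  let c := thirdv z T a b in let d := thirdv z T b a in
  pi - Arg ((w b - w c) / (w a - w c)) - Arg ((w a - w d) / (w b - w d)).

Definition ccw_list (z : config) (t : {set 'I_n}) : 'I_n * 'I_n * 'I_n :=
  odflt (v1, v1, v1) [pick p : 'I_n * 'I_n * 'I_n |
    ([set p.1.1; p.1.2; p.2] == t) && (0 < cross z p.1.1 p.1.2 p.2)].

Definition VolFace (z : config) (t : {set 'I_n}) (w : config) : R :=
  let p := ccw_list z t in Vol (w p.1.1) (w p.1.2) (w p.2).

Definition A_T (z : config) (T : {set {set 'I_n}}) (w : config) : R :=
  - (\sum_(t in T) VolFace z t w) + VolFace z f0 w.

Definition bump (w : config) (v : 'I_n) (h : C) : config :=
  fun i => if i == v then w i + h else w i.

Definition pdx (F : config -> R) (v : 'I_n) (w : config) : R :=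
  derive1 (fun t : R => F (bump w v (cR t))) 0.
Definition pdy (F : config -> R) (v : 'I_n) (w : config) : R :=
  derive1 (fun t : R => F (bump w v (cR t * cI))) 0.

Definition pdxC (G : config -> C) v w : C :=
  cR (pdx (fun w' => complex.Re (G w')) v w) + cI * cR (pdx (fun w' => complex.Im (G w')) v w).
Definition pdyC (G : config -> C) v w : C :=
  cR (pdy (fun w' => complex.Re (G w')) v w) + cI * cR (pdy (fun w' => complex.Im (G w')) v w).

Definition dz (G : config -> C) v w : C := (pdxC G v w - cI * pdyC G v w) / 2%:R.
Definition dzb (G : config -> C) v w : C := (pdxC G v w + cI * pdyC G v w) / 2%:R.

Definition liftR (F : config -> R) : config -> C := fun w => cR (F w).

Definition adjE (H : {set {set 'I_n}}) : rel 'I_n :=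
  fun x y => (x != y) && ([set x; y] \in H).

Definition is_CRST (H : {set {set 'I_n}}) : Prop :=
  (forall e, e \in H -> #|e| = 2) /\
  (forall x y, connect (adjE H) x y) /\ #|H| = n.

Definition has_odd_cycle (H : {set {set 'I_n}}) : Prop :=
  exists p : seq 'I_n, [/\ uniq p, (3 <= size p)%N, odd (size p) & cycle (adjE H) p].

End DelaunayDefs.

(* Main.v *)
(* Let g_u(p, q) be the logarithmic derivative of z_p - z_q in z_u, and for
   functions x, y on the edges let
     beta(x, y) = sum over the oriented edges (a, b) of x_ab (y_bc - y_ca),
   where (a, b, c) is the face to the left of (a, b).  Both sides of the theorem
   are built from beta: d theta_e / d z_u = beta(1_e, (i/2) g_u), and Schlaefli's
   formula dVol = - sum ln|edge| d(opposite angle) gives D_uv = (i/4) beta(g_u, conj g_v).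
   Moreover beta(g_u, g_v) = 0 by Arnold's relation between the forms dlog(z_p - z_q).

   The form beta is antisymmetric and vanishes on the functions u_a + u_b.  Since
   the complement H of E0 is unicyclic with an odd cycle, every function on the
   edges is, modulo those, supported on E0.  Hence if W is the Gram matrix of beta
   on the indicators of E0, there is a matrix C with J' = C W^T and
   C W C^T = ((0, M), (-M^T, 0)), where D = i M; so |det J'|^2 = |det W| |det D|^2.

   The integer matrix W has determinant 1 or -1, because it is injective modulo
   every prime.  For an odd prime the kernel of beta is exactly {u_a + u_b}, which
   meets the functions supported on E0 only in 0.  For p = 2 this is linear algebra
   over F_2 resting on the equality of the cuts of the triangulation with the cycles
   of the dual graph, a rank count which uses Euler's formula and the connectedness
   of H and of the dual graph.

   Finally det D >= 0: a tangent vector makes each face contribute a positive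
   multiple of the area of a triangle similar to that face. *)
Require Import Defs.
From HB Require Import structures.
From mathcomp Require Import all_boot all_order all_algebra.
From mathcomp Require Import all_classical all_reals all_analysis.
From mathcomp Require Import complex spectral.
From mathcomp Require Import ring lra zify.
Set Implicit Arguments. Unset Strict Implicit. Unset Printing Implicit Defensive.
Import Order.TTheory GRing.Theory Num.Theory.
Import numFieldNormedType.Exports.
(* [fintype.bump] would otherwise hide [Defs.bump]. *)
Import Defs.
Local Open Scope ring_scope.

(** * Linear algebra over finite index types *)

(** The form [beta] only yields an identity between squares of absolute values, and the phase in
    [D = i M] is lost there; since the right-hand side of the theorem carries no absolute value, the
    positivity of [det D] is a separate input. Reduction of [W] modulo primes replaces an evaluation
    of its determinant. The prime 2 stands apart because the unsigned vertex-edge incidence matrix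
    of [H] has determinant 2 up to sign: it is invertible in odd characteristic, but modulo 2 the
    functions [u_a + u_b] no longer complement those supported on [E0]. For the unimodularity, plane
    geometry enters only through [closed_surface] and [dual_connected]. Euler's formula is obtained
    by counting: 2N edges in [E0] and N + 3 in its complement make 3n - 6 edges with n = N + 3, and
    two triangular sides per edge then make 2n - 4 faces. That the faces around a vertex hang
    together is deduced from this count as well, not from the embedding. *)

Section FinLin.
Variable K : fieldType.

Lemma sum_enum_val (A : finType) (F : A -> K) :
  \sum_(i < #|A|) F (enum_val i) = \sum_a F a.
Proof. by rewrite -(big_enum_val (A := A) F); apply: eq_bigl. Qed.

Definition mxf (A B : finType) (m : A -> B -> K) : 'M[K]_(#|A|, #|B|) :=
  \matrix_(i, j) m (enum_val i) (enum_val j).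

Definition rvf (A : finType) (u : A -> K) : 'rV[K]_#|A| := \row_i u (enum_val i).

Lemma mul_rvf (A B : finType) (u : A -> K) (m : A -> B -> K) :
  rvf u *m mxf m = rvf (fun b => \sum_a u a * m a b).
Proof.
apply/rowP => j; rewrite !mxE -(sum_enum_val (fun a => u a * m a (enum_val j))).
by apply: eq_bigr => i _; rewrite !mxE.
Qed.

Lemma rvfK (A : finType) (v : 'rV[K]_#|A|) : rvf (fun a => v 0 (enum_rank a)) = v.
Proof. by apply/rowP => i; rewrite mxE enum_valK. Qed.

Lemma rvf_inj (A : finType) (u v : A -> K) : rvf u = rvf v -> u =1 v.
Proof. by move=> /rowP E a; have := E (enum_rank a); rewrite !mxE enum_rankK. Qed.

Lemma rvf_eq0 (A : finType) (u : A -> K) : u =1 (fun=> 0) -> rvf u = 0.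
Proof. by move=> u0; apply/rowP => i; rewrite !mxE u0. Qed.

Lemma mxf_free (A B : finType) (m : A -> B -> K) :
  (forall u : A -> K, (forall b, \sum_a u a * m a b = 0) -> u =1 (fun=> 0)) ->
  row_free (mxf m).
Proof.
move=> ker; rewrite -kermx_eq0; apply/eqP/row_matrixP => i; rewrite row0.
rewrite -[LHS]rvfK; apply: rvf_eq0; apply: ker; apply: rvf_inj.
rewrite -mul_rvf rvfK rvf_eq0 //; apply/eqP; rewrite -sub_kermx; exact: row_sub.
Qed.

Lemma fin_surj (A B : finType) (m : A -> B -> K) : #|A| = #|B| ->
  (forall u : A -> K, (forall b, \sum_a u a * m a b = 0) -> u =1 (fun=> 0)) ->
  forall y : B -> K, exists u : A -> K, forall b, y b = \sum_a u a * m a b.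
Proof.
move=> AB ker y; have fm := mxf_free ker.
have full : row_full (mxf m) by rewrite /row_full (eqP fm) AB.
have /submxP[D yD] := submx_full (rvf y) full.
exists (fun a => D 0 (enum_rank a)); apply: rvf_inj.
by rewrite yD -mul_rvf rvfK.
Qed.

(** The vectors orthogonal to |A| independent rows in a space of dimension |A| + 1 form a line. *)
Lemma fin_line (A C : finType) (m : A -> C -> K) (s s' : C -> K) : #|C| = #|A|.+1 ->
  (forall u : A -> K, (forall c, \sum_a u a * m a c = 0) -> u =1 (fun=> 0)) ->
  (forall a, \sum_c s c * m a c = 0) -> (forall a, \sum_c s' c * m a c = 0) ->
  (exists c, s' c != 0) -> exists l : K, s =1 (fun c => l * s' c).
Proof.
move=> CA ker ks ks' [c s'c]; have fm := mxf_free ker.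
have sub t : (forall a, \sum_c t c * m a c = 0) -> (rvf t <= kermx (mxf m)^T)%MS.
  move=> kt; apply/sub_kermxP.
  have -> : (mxf m)^T = mxf (fun c a => m a c) by apply/matrixP => i j; rewrite !mxE.
  by rewrite mul_rvf rvf_eq0.
have rk : \rank (kermx (mxf m)^T) = 1%N.
  by rewrite mxrank_ker mxrank_tr (eqP fm) CA subSnn.
have nz : rvf s' != 0.
  apply/eqP => s0; move/eqP: s'c; apply.
  by have /rowP/(_ (enum_rank c)) := s0; rewrite !mxE enum_rankK.
have : (rvf s' == kermx (mxf m)^T)%MS.
  by rewrite -(mxrank_leqif_eq (sub _ ks')) rank_rV nz rk.
move=> /eqmxP e; have /sub_rVP[l sl] : (rvf s <= rvf s')%MS by rewrite e; exact: sub.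
by exists l; apply: rvf_inj; rewrite sl; apply/rowP => i; rewrite !mxE.
Qed.

(** The hypothesis places the left kernel inside the line of constant functions. *)
Lemma mxf_rank (A B : finType) (m : A -> B -> K) :
  (forall u : A -> K, (forall b, \sum_a u a * m a b = 0) -> forall a a', u a = u a') ->
  (#|A| <= (\rank (mxf m)).+1)%N.
Proof.
move=> ker; rewrite -addn1 -leq_subLR -mxrank_ker.
case: (posnP #|A|) => [A0|/card_gt0P[a0 _]].
  by apply: leq_trans (rank_leq_row _) _; rewrite A0.
apply: leq_trans (rank_leq_row (rvf (fun=> 1 : K) : 'rV_#|A|)).
apply: mxrankS; apply/row_subP => i; apply/sub_rVP.
exists (row i (kermx (mxf m)) 0 (enum_rank a0)).
rewrite -[LHS]rvfK; apply/rowP => j; rewrite !mxE mulr1.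
have := ker (fun a => row i (kermx (mxf m)) 0 (enum_rank a)).
move=> /(_ _ (enum_val j) a0); rewrite !mxE; apply.
apply: rvf_inj; rewrite -mul_rvf rvfK rvf_eq0 //; apply/eqP.
by rewrite -sub_kermx; exact: row_sub.
Qed.

(** Exactness in the middle of a complex, by counting: by [mxf_rank] the ranks of [m] and [b] are at
    least |A| - 1 and |C| - 1, so the Euler inequality bounds the dimension of the kernel of [b] by
    the rank of [m]. *)
Lemma fin_exact (A B C : finType) (m : A -> B -> K) (b : B -> C -> K) :
  (forall a c, \sum_e m a e * b e c = 0) ->
  (forall u : A -> K, (forall e, \sum_a u a * m a e = 0) -> forall a a', u a = u a') ->
  (forall s : C -> K, (forall e, \sum_c s c * b e c = 0) -> forall c c', s c = s c') ->
  (#|B|.+2 <= #|A| + #|C|)%N ->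
  forall y : B -> K, (forall c, \sum_e y e * b e c = 0) ->
  exists u : A -> K, forall e, y e = \sum_a u a * m a e.
Proof.
move=> mb km kb BAC y yb.
have rm := mxf_rank km; have := mxf_rank (m := fun c e => b e c) kb.
have <- : (mxf b)^T = mxf (fun c e => b e c) by apply/matrixP => i j; rewrite !mxE.
rewrite mxrank_tr => rb.
have mb0 : mxf m *m mxf b = 0.
  apply/matrixP => i j; rewrite !mxE -[RHS](mb (enum_val i) (enum_val j)).
  rewrite -(sum_enum_val (fun e => m (enum_val i) e * b e (enum_val j))).
  by apply: eq_bigr => k _; rewrite !mxE.
have sub : (mxf m <= kermx (mxf b))%MS by apply/sub_kermxP.
have eqk : (mxf m == kermx (mxf b))%MS.
  rewrite -(mxrank_leqif_eq sub) eqn_leq (mxrankS sub) mxrank_ker /=.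
  rewrite leq_subLR -ltnS -ltnS; apply: leq_trans BAC _.
  by rewrite (leq_trans (leq_add rm rb)) // addSn addnS addnC.
have : (rvf y <= mxf m)%MS.
  by rewrite (eqmxP eqk) sub_kermx mul_rvf rvf_eq0.
move=> /submxP[D yD]; exists (fun a => D 0 (enum_rank a)); apply: rvf_inj.
by rewrite yD -mul_rvf rvfK.
Qed.

End FinLin.

(** Multiplication by the block swap [S] makes the matrix block diagonal. As [S] squares to 1, its
    determinant is a sign, which the norm removes. *)
Lemma norm_det_antiblock (K : numDomainType) N (M L : 'M[K]_N) :
  `|\det (block_mx 0 M L 0)| = `|\det M| * `|\det L|.
Proof.
pose S : 'M[K]_(N + N) := block_mx 0 1%:M 1%:M 0.
have S2 : `|\det S| = 1.
  apply/eqP; rewrite -[_ == 1](@eqrXn2 _ 2%N) // expr1n -normrX expr2 -det_mulmx.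
  by rewrite mulmx_block !mulmx0 !mul0mx !mulmx1 !addr0 !add0r -scalar_mx_block det1 normr1.
rewrite -[LHS]mulr1 -S2 -normrM -det_mulmx mulmx_block !mulmx0 !mul0mx !mulmx1.
by rewrite !addr0 !add0r det_ublock normrM.
Qed.

(** Schur's unitary triangularization keeps the determinant, and the diagonal entries of the
    triangular matrix are the values of the form at the rows of [Q]. *)
Lemma det_ge0_form (C : numClosedFieldType) N (A : 'M[C]_N) :
  (forall v : 'rV[C]_N, 0 <= \sum_i \sum_j v 0 i * A i j * (v 0 j)^*) -> 0 <= \det A.
Proof.
case: N A => [|N] A psd; first by rewrite det_mx00 ler01.
have [Q Qu tr] := Schur A (ltn0Sn N).
have Qunit := unitarymx_unit Qu.
have -> : \det A = \det (conjmx Q A).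
  rewrite conjumx // !det_mulmx mulrAC -det_mulmx mulmxV // ?det1 ?mul1r //.
rewrite det_trig //; apply: prodr_ge0 => k _.
rewrite conjymx // !mxE.
have := psd (row k Q); congr (_ <= _).
rewrite exchange_big; apply: eq_bigr => j _ /=.
rewrite !mxE mulr_suml; apply: eq_bigr => i _; rewrite !mxE //.
Qed.

(** * Closed surfaces and the form beta *)

Lemma pair_set_eq (V : finType) (x y a b : V) :
  ([set x; y] == [set a; b]) = ((x == a) && (y == b)) || ((x == b) && (y == a)).
Proof.
apply/eqP/orP => [e | [] /andP[/eqP-> /eqP->] //]; last by rewrite finset.setUC.
have := finset.set21 x y; have := finset.set22 x y; rewrite {1 2}e.
have := finset.set21 a b; have := finset.set22 a b; rewrite -{1 2}e !inE.
by do 4![case/orP => /eqP ?]; subst; rewrite ?eqxx; auto.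
Qed.

(** An oriented surface glued from triangles, [P] listing each face in positive cyclic order. These
    axioms admit several cycles of faces around one vertex; [corner_const] rules out the effect of
    this by means of Euler's formula. *)
Record closed_surface n (P : 'I_n -> 'I_n -> 'I_n -> bool) : Prop := ClosedSurface {
  face_cyc : forall a b c, P a b c -> P b c a;
  face_neq : forall a b c, P a b c -> a != b;
  face_uniq : forall a b c c', P a b c -> P a b c' -> c = c';
  face_rev : forall a b c, P a b c -> exists d, P b a d }.

(** Connectivity as an induction principle over face labels: it is applied to a label and proved by
    a sum over a labelled set of faces, so that paths of faces never appear. *)
Definition dual_connected n (P : 'I_n -> 'I_n -> 'I_n -> bool) : Prop :=
  forall s : 'I_n -> 'I_n -> 'I_n -> bool,
    (forall a b c, P a b c -> s a b c = s b c a) ->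
    (forall a b c d, P a b c -> P b a d -> s a b c = s b a d) ->
    forall a b c a' b' c', P a b c -> P a' b' c' -> s a b c = s a' b' c'.

Section Surface.
Variables (n : nat) (P : 'I_n -> 'I_n -> 'I_n -> bool).
Local Notation V := 'I_n.
Hypothesis surfP : closed_surface P.

Definition third a b : V := odflt a [pick c | P a b c].
(** If no face lies to the left of the pair, [third] returns its default and the test fails; hence
    this expresses the existence of such a face. *)
Definition dart (p : V * V) : bool := P p.1 p.2 (third p.1 p.2).

Lemma thirdE a b c : P a b c -> third a b = c.
Proof.
move=> Pc; rewrite /third; case: pickP => [d Pd | /(_ c)]; last by rewrite Pc.
exact: (face_uniq surfP) Pd Pc.
Qed.

Lemma face_dart a b c : P a b c -> dart (a, b).
Proof. by move=> Pc; rewrite /dart /= (thirdE Pc). Qed.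

Lemma dart_rev a b : dart (a, b) -> dart (b, a).
Proof. by move=> /(face_rev surfP)[d /face_dart]. Qed.

Lemma dart_revE a b : dart (a, b) = dart (b, a).
Proof. by apply/idP/idP; exact: dart_rev. Qed.

Lemma dart_neq a b : dart (a, b) -> a != b.
Proof. exact: (face_neq surfP). Qed.

Lemma dart_next a b : dart (a, b) -> dart (b, third a b).
Proof. by move=> /(face_cyc surfP)/face_dart. Qed.

Lemma dart_prev a b : dart (a, b) -> dart (third a b, a).
Proof. by move=> /(face_cyc surfP)/(face_cyc surfP)/face_dart. Qed.

Lemma third_next a b : dart (a, b) -> third b (third a b) = a.
Proof. by move=> /(face_cyc surfP)/thirdE. Qed.

Lemma third_prev a b : dart (a, b) -> third (third a b) a = b.
Proof. by move=> /(face_cyc surfP)/(face_cyc surfP)/thirdE. Qed.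

Section DartSums.
Variable M : nmodType.
Implicit Type F : V -> V -> M.

Lemma sum_dart_rev F :
  \sum_(p | dart p) F p.1 p.2 = \sum_(p | dart p) F p.2 p.1.
Proof.
rewrite (reindex_inj (h := fun p : V * V => (p.2, p.1))) /=; last first.
  by move=> [a b] [c d] [-> ->].
by apply: eq_bigl => -[a b]; exact: dart_revE.
Qed.

Lemma sum_dart_next F :
  \sum_(p | dart p) F p.1 p.2 = \sum_(p | dart p) F p.2 (third p.1 p.2).
Proof.
rewrite (reindex_onto (fun p : V * V => (p.2, third p.1 p.2))
  (fun p => (third p.1 p.2, p.1))) /=; last first.
  by move=> [a b] /= d; rewrite third_prev.
apply: eq_bigl => -[a b] /=; apply/andP/idP => [[d /eqP[e]] | d].
  by have := dart_prev d; rewrite e.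
by split; [exact: dart_next | rewrite third_next].
Qed.

Lemma sum_dart_edge F a b : dart (a, b) ->
  \sum_(p | dart p && ([set p.1; p.2] == [set a; b])) F p.1 p.2 = F a b + F b a.
Proof.
move=> d; rewrite (bigD1 (a, b)) /=; last by rewrite d eqxx.
rewrite (bigD1 (b, a)) /=; last first.
  by rewrite -dart_revE d finset.setUC eqxx xpair_eqE eq_sym (negbTE (dart_neq d)).
rewrite big_pred0 ?addr0 // => -[p q] /=; rewrite !xpair_eqE pair_set_eq.
by case: (p == a); case: (q == b); case: (p == b); case: (q == a); rewrite ?andbF.
Qed.

Definition first_dart (p : V * V) : bool :=
  (p.1 < p.2)%N && (p.1 < third p.1 p.2)%N.

Definition faces : {set V * V} := [set p | dart p && first_dart p].

Lemma third_neq a b : dart (a, b) -> (a != third a b) /\ (b != third a b).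
Proof.
move=> d; split; last exact: dart_neq (dart_next d).
by rewrite eq_sym; exact: dart_neq (dart_prev d).
Qed.

Lemma first_dart_next a b : dart (a, b) -> first_dart (a, b) ->
  first_dart (b, third a b) = false /\ first_dart (third a b, a) = false.
Proof.
move=> d; rewrite /first_dart /= third_next ?third_prev //; lia.
Qed.

Lemma first_dart_exists a b : dart (a, b) -> first_dart (a, b) = false ->
  first_dart (b, third a b) != first_dart (third a b, a).
Proof.
move=> d; have [/eqP ac /eqP bc] := third_neq d; have /eqP ab := dart_neq d.
rewrite /first_dart /= third_next ?third_prev //.
move: (third a b) ac bc => c ac bc.
have neq (x y : V) : x <> y -> (x : nat) <> y by move=> xy /val_inj.
by move: (neq _ _ ab) (neq _ _ ac) (neq _ _ bc); lia.
Qed.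

(* Each face is counted through its dart leaving the smallest vertex. *)
Lemma sum_faces F : \sum_(p | dart p) F p.1 p.2 =
  \sum_(p in faces) (F p.1 p.2 + F p.2 (third p.1 p.2) + F (third p.1 p.2) p.1).
Proof.
(* Exactly one of the three rotations of a dart is first. [F] is split accordingly into three parts,
   and rotating the darts moves each part onto the first dart of its face. *)
pose G1 a b := if first_dart (a, b) then F a b else 0.
pose G2 a b := if first_dart (a, b) then F b (third a b) else 0.
pose G3 a b := if first_dart (a, b) then F (third a b) a else 0.
transitivity (\sum_(p | dart p) (G1 p.1 p.2 + G2 (third p.1 p.2) p.1 +
    G3 p.2 (third p.1 p.2))).
  apply: eq_bigr => -[a b] d; rewrite /G1 /G2 /G3 /= third_next ?third_prev //.
  case Fab: (first_dart (a, b)).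
    by have [-> ->] := first_dart_next d Fab; rewrite !addr0.
  have := first_dart_exists d Fab.
  by case: (first_dart (b, _)); case: (first_dart (_, a)); rewrite //= ?addr0 ?add0r.
rewrite !big_split /= -(sum_dart_next G3).
have <- : \sum_(p | dart p) G2 p.1 p.2 = \sum_(p | dart p) G2 (third p.1 p.2) p.1.
  rewrite sum_dart_next (sum_dart_next (fun a b => G2 b (third a b))).
  by apply: eq_bigr => -[a b] d /=; rewrite third_next.
rewrite -!big_split [RHS](eq_bigl (fun p => dart p && first_dart p)) => [|p]; last first.
  by rewrite inE.
rewrite big_mkcondr /=; apply: eq_bigr => -[a b] d; rewrite /G1 /G2 /G3 /=.
by case: ifP; rewrite ?addr0.
Qed.

End DartSums.

Section Beta.
Variable K : comPzRingType.
Implicit Types x y : V -> V -> K.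

Definition beta x y : K :=
  \sum_(p | dart p) x p.1 p.2 * (y p.2 (third p.1 p.2) - y (third p.1 p.2) p.1).

(** Rotating the darts of each face by one position brings the second product into a shape in which
    exchanging [x] and [y] changes the sign of every summand. *)
Lemma betaE x y : beta x y = \sum_(p | dart p)
  (x p.1 p.2 * y p.2 (third p.1 p.2) - x p.2 (third p.1 p.2) * y p.1 p.2).
Proof.
rewrite /beta (eq_bigr (fun p : V * V => x p.1 p.2 * y p.2 (third p.1 p.2) -
  x p.1 p.2 * y (third p.1 p.2) p.1)) => [|p _]; last by rewrite mulrBr.
rewrite 2!sumrB; congr (_ - _).
rewrite (sum_dart_next (fun a b => x a b * y (third a b) a)).
by apply: eq_bigr => -[a b] d /=; rewrite third_next.
Qed.

Lemma beta_anti x y : beta x y = - beta y x.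
Proof.
rewrite !betaE -sumrN; apply: eq_bigr => p _; ring.
Qed.

Lemma eq_betal x x' y : (forall a b, dart (a, b) -> x a b = x' a b) ->
  beta x y = beta x' y.
Proof. by move=> e; apply: eq_bigr => -[a b] d /=; rewrite e. Qed.

Lemma eq_betar x y y' : (forall a b, dart (a, b) -> y a b = y' a b) ->
  beta x y = beta x y'.
Proof. by move=> e; rewrite beta_anti (eq_betal _ e) -beta_anti. Qed.

Definition dsum (u : V -> K) (a b : V) : K := u a + u b.

(** On a face (a, b, c) the difference y_bc - y_ca is u_b - u_a, so the two darts of each edge
    cancel. *)
Lemma beta_dsumr x u : (forall a b, x a b = x b a) -> beta x (dsum u) = 0.
Proof.
move=> xs; rewrite /beta /dsum (eq_bigr (fun p : V * V => x p.1 p.2 * u p.2 -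
  x p.1 p.2 * u p.1)) => [|p _]; last by ring.
rewrite sumrB (sum_dart_rev (fun a b => x a b * u b)).
by rewrite (eq_bigr (fun p => x p.1 p.2 * u p.1)) ?subrr // => p _; rewrite xs.
Qed.

Lemma betaDl x x' y : beta (fun a b => x a b + x' a b) y = beta x y + beta x' y.
Proof. by rewrite -big_split; apply: eq_bigr => p _; rewrite mulrDl. Qed.

Lemma betaDr x y y' : beta x (fun a b => y a b + y' a b) = beta x y + beta x y'.
Proof. by rewrite beta_anti betaDl opprD -!beta_anti. Qed.

Lemma beta_suml (I : finType) (c : I -> K) (x : I -> V -> V -> K) y :
  beta (fun a b => \sum_i c i * x i a b) y = \sum_i c i * beta (x i) y.
Proof.
rewrite /beta; under [RHS]eq_bigr => i _ do rewrite mulr_sumr.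
rewrite exchange_big; apply: eq_bigr => p _ /=; rewrite mulr_suml.
by apply: eq_bigr => i _; rewrite mulrA.
Qed.

Lemma beta_sumr (I : finType) (c : I -> K) x (y : I -> V -> V -> K) :
  beta x (fun a b => \sum_i c i * y i a b) = \sum_i c i * beta x (y i).
Proof.
rewrite beta_anti beta_suml -sumrN; apply: eq_bigr => i _.
by rewrite beta_anti mulrN opprK.
Qed.

Definition indE (e : V * V) (a b : V) : K := ([set a; b] == [set e.1; e.2])%:R.

Lemma indE_sym e a b : indE e a b = indE e b a.
Proof. by rewrite /indE finset.setUC. Qed.

Definition edge_op y a b : K := y b (third a b) - y (third a b) a.

Lemma sum_indE (e : V * V) (F : V -> V -> K) : dart e ->
  \sum_(p | dart p) indE e p.1 p.2 * F p.1 p.2 = F e.1 e.2 + F e.2 e.1.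
Proof.
case: e => a b d; rewrite -(sum_dart_edge F d) big_mkcondr; apply: eq_bigr => p _.
by rewrite /indE /=; case: eqP; rewrite ?mul1r ?mul0r.
Qed.

Lemma beta_indE e y : dart e ->
  beta (indE e) y = edge_op y e.1 e.2 + edge_op y e.2 e.1.
Proof. exact: (sum_indE (edge_op y)). Qed.

End Beta.
End Surface.

(** * Unimodularity of the Gram matrix *)

Lemma connect_const (T : finType) (X : Type) (e : rel T) (f : T -> X) :
  (forall x y, connect e x y) -> (forall x y, e x y -> f x = f y) ->
  forall x y, f x = f y.
Proof.
move=> con inv x y; have /connectP[p ep ->] := con x y.
by elim: p x ep {con} => //= z p IH x /andP[/inv-> /IH].
Qed.

Section OddCycle.
Variables (K : comNzRingType) (T : eqType) (e : rel T).

Lemma path_alternate (f : T -> K) (c : K) x p : path e x p ->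
  (forall x y, e x y -> f x + f y = c) ->
  f (last x p) = if odd (size p) then c - f x else f x.
Proof.
move=> + inv; elim: p x => //= y p IH x /andP[/inv exy /IH ->].
by rewrite -exy; case: (odd _) => /=; rewrite ?addrK // addrAC subrr add0r.
Qed.

(** Along a path [f] alternates between [f x] and [c - f x]; closing an odd cycle equates the two.
    The conclusion is not divided by 2, so it serves with [c = 0] in odd characteristic and with
    [c = 1], as a contradiction, modulo 2. *)
Lemma odd_cycle_alternate (f : T -> K) (c : K) p : cycle e p -> odd (size p) ->
  (forall x y, e x y -> f x + f y = c) -> exists x, f x + f x = c.
Proof.
case: p => // x p cp op inv; exists x.
have := path_alternate cp inv; rewrite last_rcons size_rcons op => {2}->.
by rewrite addrC subrK.
Qed.

End OddCycle.

Lemma sum_mem_pair (K : pzRingType) (V : finType) (u : V -> K) a b : a != b ->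
  \sum_v u v * (v \in [set a; b])%:R = u a + u b.
Proof.
move=> ab; rewrite (bigD1 a) //= (bigD1 b) 1?eq_sym //= !inE !eqxx orbT !mulr1.
rewrite big1 ?addr0 // => v /andP[/negbTE va /negbTE vb].
by rewrite !inE va vb mulr0.
Qed.

Lemma in_pairE (K : pzRingType) (V : finType) (v a b : V) : a != b ->
  (v \in [set a; b])%:R = (v == a)%:R + (v == b)%:R :> K.
Proof.
move=> ab; rewrite !inE; case: eqP => [->|_]; last by rewrite add0r.
by rewrite (negbTE ab) addr0.
Qed.

Lemma sum_option (M : nmodType) (T : finType) (F : option T -> M) :
  \sum_o F o = F None + \sum_t F (Some t).
Proof.
rewrite (bigD1 None) //=; congr (_ + _).
by rewrite (reindex_omap Some id) /=; [apply: eq_bigl => t; rewrite eqxx | case].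
Qed.

Lemma sum_set_sub (M : nmodType) (I : finType) (A : {set I}) (F : I -> M) :
  \sum_(i in A) F i = \sum_(x : {x in A}) F (val x).
Proof. exact: big_sub. Qed.

Definition lift_pair (K : nmodType) (V : finType) (x : V -> V -> K) (e : {set V}) : K :=
  if [pick p : V * V | e == [set p.1; p.2]] is Some p then x p.1 p.2 else 0.

Lemma lift_pairE (K : nmodType) (V : finType) (x : V -> V -> K) a b :
  (forall a b, x a b = x b a) -> lift_pair x [set a; b] = x a b.
Proof.
move=> xs; rewrite /lift_pair; case: pickP => [[p q] /= | /(_ (a, b))].
  by rewrite pair_set_eq => /orP[] /andP[/eqP-> /eqP->].
by rewrite eqxx.
Qed.

Section Surface.
Variables (n : nat) (P : 'I_n -> 'I_n -> 'I_n -> bool).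
Local Notation V := 'I_n.
Hypothesis surfP : closed_surface P.
Hypothesis connP : dual_connected P.
Local Notation third := (third P).
Local Notation dart := (dart P).

Variables (m : nat) (e0 : 'I_m -> V * V).
Hypothesis e0_dart : forall k, dart (e0 k).
Local Notation edge p := [set p.1; p.2].
Hypothesis e0_inj : injective (fun k => edge (e0 k)).

Definition edges : {set {set V}} := [set edge p | p in dart].
Let E0 := [set edge (e0 k) | k in 'I_m].
Let H := edges :\: E0.
Hypothesis H_conn : forall x y, connect (adjE H) x y.
Hypothesis H_card : #|H| = n.
Hypothesis euler : (m + 6 = n + n)%N.
Variable cyc : seq V.
Hypothesis cyc_cycle : cycle (adjE H) cyc.
Hypothesis cyc_odd : odd (size cyc).

Lemma mem_edges a b : a != b -> ([set a; b] \in edges) = dart (a, b).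
Proof.
move=> ab; apply/imsetP/idP => [[[p q] d /eqP] | d]; last by exists (a, b).
rewrite pair_set_eq => /orP[] /andP[/eqP-> /eqP->] //.
exact: (dart_rev surfP).
Qed.

Lemma edgesP e : reflect (exists a b, dart (a, b) /\ e = [set a; b]) (e \in edges).
Proof.
apply: (iffP imsetP) => [[[a b] d ->] | [a [b [d ->]]]]; last by exists (a, b).
by exists a, b.
Qed.

Lemma E0_sub : E0 \subset edges.
Proof. by apply/fintype.subsetP => _ /imsetP[k _ ->]; apply: imset_f; exact: e0_dart. Qed.

Lemma card_E0 : #|E0| = m.
Proof. by rewrite card_imset ?card_ord //; exact: e0_inj. Qed.

Lemma card_edges : #|edges| = (m + n)%N.
Proof.
by have := cardsID E0 edges; rewrite (finset.setIidPr E0_sub) card_E0 H_card.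
Qed.

Lemma adj_dart a b : adjE H a b -> dart (a, b).
Proof. by rewrite /adjE inE => /and3P[ab _]; rewrite mem_edges. Qed.

Lemma dart_cases a b : dart (a, b) ->
  adjE H a b \/ exists k, [set a; b] = edge (e0 k).
Proof.
move=> d; have ab : a != b by exact: (dart_neq surfP d).
case E: ([set a; b] \in E0); [right | left].
  by case/imsetP: E => k _ ->; exists k.
by rewrite /adjE inE E mem_edges // ab.
Qed.

Lemma adj_notE0 a b k : adjE H a b -> ([set a; b] == edge (e0 k)) = false.
Proof.
rewrite /adjE inE => /and3P[_ /negP nE _]; apply/eqP => e; apply: nE.
by rewrite e; apply: imset_f.
Qed.

Lemma sum_ind_adj (K : comPzRingType) (c : 'I_m -> K) a b : adjE H a b ->
  \sum_k c k * indE K (e0 k) a b = 0.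
Proof. by move=> ab; apply: big1 => k _; rewrite /indE adj_notE0 // mulr0. Qed.

Lemma sum_ind_e0 (K : comPzRingType) (c : 'I_m -> K) a b k :
  [set a; b] = edge (e0 k) -> \sum_k c k * indE K (e0 k) a b = c k.
Proof.
move=> abk; rewrite (bigD1 k) //= /indE abk eqxx mulr1 big1 ?addr0 // => j jk.
case: eqP => [/e0_inj kj | _]; last by rewrite mulr0.
by rewrite kj eqxx in jk.
Qed.

Section OddChar.
Variable K : fieldType.
Hypothesis K2 : 2%:R != 0 :> K.

(** The odd cycle gives 2 u = 0 at one vertex, and the relation spreads the zero along the connected
    graph [H]. *)
Lemma dsum_adj_eq0 (u : V -> K) :
  (forall a b, adjE H a b -> u a + u b = 0) -> u =1 (fun=> 0).
Proof.
move=> ue; have [x xx] := odd_cycle_alternate cyc_cycle cyc_odd ue.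
have x0 : u x = 0.
  by move/eqP: xx; rewrite -mulr2n -mulr_natr mulf_eq0 (negbTE K2) orbF => /eqP.
move=> y; apply/eqP; rewrite (connect_const (f := fun y => u y == 0) H_conn _ y x).
  by rewrite x0.
by move=> a b /ue/eqP; rewrite addr_eq0 => /eqP ->; rewrite oppr_eq0.
Qed.

(** [H] has as many edges as vertices, so the injectivity in [dsum_adj_eq0] makes it possible to
    choose [u] with [u_a + u_b = x a b] on [H]. The remainder lives on [E0]. *)
Lemma dsum_decomp (x : V -> V -> K) : (forall a b, x a b = x b a) ->
  exists u c, forall a b, dart (a, b) ->
    x a b = dsum u a b + \sum_k c k * indE K (e0 k) a b.
Proof.
move=> xs.
have [|u uP|u uE] := @fin_surj K V {e in H} (fun v e => (v \in val e)%:R) _ _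
  (fun e => lift_pair x (val e)).
- by rewrite card_sig card_ord -[LHS]H_card; apply: eq_card => e.
- apply: dsum_adj_eq0 => a b /andP[ab abH].
  by rewrite -[RHS](uP (exist _ [set a; b] abH)) sum_mem_pair.
pose y a b := x a b - dsum u a b.
have ys a b : y a b = y b a by rewrite /y xs /dsum addrC [u a + _]addrC addrC.
exists u, (fun k => lift_pair y (edge (e0 k))) => a b d.
case: (dart_cases d) => [abH | [k abk]].
  rewrite sum_ind_adj // addr0; case/andP: abH => ab abH.
  by have := uE (exist _ [set a; b] abH); rewrite /= lift_pairE // sum_mem_pair.
by rewrite (sum_ind_e0 _ abk) -abk lift_pairE // addrC subrK.
Qed.

End OddChar.
Lemma card_darts : #|dart| = (#|edges| * 2)%N.
Proof.
rewrite -[LHS]sum1_card (partition_big (fun p => edge p) (mem edges)) /=; last first.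
  by move=> p d; apply: imset_f.
rewrite -sum_nat_const; apply: eq_bigr => _ /edgesP[a [b [d ->]]].
exact: (sum_dart_edge (M := nat) surfP (fun _ _ => 1%N) d).
Qed.

Local Notation faces := (faces P).

(** Three darts per face and two per edge give 3F = 2E, where E = m + n and m + 6 = 2n. *)
Lemma card_faces : #|faces| = m.+2.
Proof.
have : #|dart| = (#|faces| * 3)%N.
  rewrite -[LHS]sum1_card -sum_nat_const.
  exact: (sum_faces (M := nat) surfP (fun _ _ => 1%N)).
rewrite card_darts card_edges; lia.
Qed.

Section FaceFunctions.
Variable K : comPzRingType.
Implicit Type s : {p in faces} -> K.

Definition face_ext s (p : V * V) : K := if insub p is Some f then s f else 0.

(** [face_ext] vanishes off first darts, so on a dart only one summand survives: the value of [s] at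
    the face to its left. *)
Definition dart_ext s a b : K :=
  face_ext s (a, b) + face_ext s (b, third a b) + face_ext s (third a b, a).

Lemma dart_ext_next s a b : dart (a, b) ->
  dart_ext s b (third a b) = dart_ext s a b.
Proof.
by move=> d; rewrite /dart_ext (third_next surfP d) addrC addrA.
Qed.

Lemma face_ext0 s p : first_dart P p = false -> face_ext s p = 0.
Proof. by move=> fp; rewrite /face_ext insubF // inE fp andbF. Qed.

Lemma dart_ext_val s (f : {p in faces}) : dart_ext s (val f).1 (val f).2 = s f.
Proof.
have [d fd] : dart (val f) /\ first_dart P (val f).
  by apply/andP; have := valP f; rewrite inE.
rewrite /dart_ext -surjective_pairing; move: d fd (valK f).
case: (val f) => a b d fd vK /=.
have [f1 f2] := first_dart_next surfP d fd.
by rewrite (face_ext0 _ f1) (face_ext0 _ f2) !addr0 /face_ext vK.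
Qed.

Definition incidence (e : {set V}) (p : V * V) : K :=
  (edge p == e)%:R + ([set p.2; third p.1 p.2] == e)%:R
  + ([set third p.1 p.2; p.1] == e)%:R.

Lemma sum_incidence s a b : dart (a, b) ->
  \sum_f s f * incidence [set a; b] (val f) = dart_ext s a b + dart_ext s b a.
Proof.
move=> d; rewrite -(sum_dart_edge surfP _ d) big_mkcondr /=.
rewrite (sum_faces surfP (fun p q =>
  if [set p; q] == [set a; b] then dart_ext s p q else 0)).
rewrite sum_set_sub /=; apply: eq_bigr => f _.
have df : dart ((val f).1, (val f).2).
  by rewrite -surjective_pairing; have := valP f; rewrite inE => /andP[].
have dn := dart_next surfP df.
have e2 : dart_ext s (third (val f).1 (val f).2) (val f).1 = s f.
  by have := dart_ext_next s dn; rewrite (third_next surfP df) => ->;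
    rewrite dart_ext_next ?dart_ext_val.
rewrite dart_ext_next // e2 dart_ext_val /incidence !mulrDr.
by congr (_ + _ + _); case: ifP; rewrite ?mulr1 ?mulr0.
Qed.

End FaceFunctions.

(** * Kernels of the Gram matrix modulo 2 and modulo odd primes *)

Section Char2.
Local Notation F2 := 'F_2.

Lemma F2_addrr (x : F2) : x + x = 0.
Proof. by apply: addrr_pchar2; exact: pchar_Fp. Qed.

Lemma F2_cases (x : F2) : x = 0 \/ x = 1.
Proof. by case: x => [[|[|//]] i]; [left | right]; apply: val_inj. Qed.

Lemma F2_addr_eq0 (x y : F2) : x + y = 0 -> x = y.
Proof. by move=> xy; rewrite -[x]addr0 -(F2_addrr y) addrA xy add0r. Qed.

Lemma sum_edges (K : comPzRingType) (g : {set V} -> K) a b : dart (a, b) ->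
  \sum_(e : {e in edges}) g (val e) * ([set a; b] == val e)%:R = g [set a; b].
Proof.
move=> d; rewrite -(sum_set_sub edges (fun e => g e * ([set a; b] == e)%:R)).
rewrite (bigD1 [set a; b]) /=; last by rewrite mem_edges ?(dart_neq surfP d).
rewrite eqxx mulr1 big1 ?addr0 // => e /andP[_ /negbTE].
by rewrite eq_sym => ->; rewrite mulr0.
Qed.

Lemma sum_edges_incidence (K : comPzRingType) (g : {set V} -> K) a b : dart (a, b) ->
  \sum_(e : {e in edges}) g (val e) * incidence K (val e) (a, b)
  = g [set a; b] + g [set b; third a b] + g [set third a b; a].
Proof.
move=> d; rewrite -(sum_edges g d) -(sum_edges g (dart_next surfP d)).
rewrite -(sum_edges g (dart_prev surfP d)) -!big_split /=.
by apply: eq_bigr => e _; rewrite !mulrDr.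
Qed.

(** The vanishing of the first cohomology of the sphere with coefficients in F_2, read off from
    [fin_exact]: connectedness of [H] controls the vertex functions, dual connectedness controls the
    face functions, and Euler's formula supplies the count. *)
Lemma cycle_is_cut (y : V -> V -> F2) : (forall a b, y a b = y b a) ->
  (forall a b c, P a b c -> y a b + y b c + y c a = 0) ->
  exists S : V -> F2, forall a b, dart (a, b) -> y a b = S a + S b.
Proof.
move=> ys yc.
have [|||||S SE] := @fin_exact F2 V {e in edges} {p in faces}
  (fun v e => (v \in val e)%:R) (fun e f => incidence F2 (val e) (val f))
  _ _ _ _ (fun e => lift_pair y (val e)).
- move=> v [[a b] ab] /=; have d : dart (a, b) by move: ab; rewrite inE => /andP[].
  rewrite (sum_edges_incidence (fun e => (v \in e)%:R) d).
  have [ac bc] := third_neq surfP d; have ab' := dart_neq surfP d.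
  rewrite !in_pairE // 1?eq_sym //.
  set x := _%:R; set y' := _%:R; set t := _%:R.
  have -> : x + y' + (y' + t) + (t + x) = (x + x) + (y' + y') + (t + t) by ring.
  by rewrite !F2_addrr.
- move=> u uE; apply: (connect_const H_conn) => a b /adj_dart d.
  apply: F2_addr_eq0.
  have abE : [set a; b] \in edges by rewrite mem_edges ?(dart_neq surfP d).
  by rewrite -[RHS](uE (exist _ [set a; b] abE)) sum_mem_pair ?(dart_neq surfP d).
- move=> s sE.
  have sym a b : dart (a, b) -> dart_ext s a b = dart_ext s b a.
    move=> d; apply: F2_addr_eq0; rewrite -sum_incidence //.
    have abE : [set a; b] \in edges by rewrite mem_edges ?(dart_neq surfP d).
    exact: (sE (exist _ [set a; b] abE)).
  have df (g : {p in faces}) : P (val g).1 (val g).2 (third (val g).1 (val g).2).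
    by have := valP g; rewrite inE => /andP[].
  move=> f f'; rewrite -(dart_ext_val s f) -(dart_ext_val s f').
  (* [connP] accepts boolean labels only; over F_2 a value is determined by whether it is 0. *)
  have : (dart_ext s (val f).1 (val f).2 == 0) = (dart_ext s (val f').1 (val f').2 == 0).
    apply: (connP (s := fun a b c => dart_ext s a b == 0) _ _ (df f) (df f')).
      by move=> a b c abc; rewrite -(thirdE surfP abc) dart_ext_next // (face_dart surfP abc).
    by move=> a b c d abc _; rewrite sym // (face_dart surfP abc).
  case: (F2_cases (dart_ext s (val f).1 (val f).2)) => ->;
    by case: (F2_cases (dart_ext s (val f').1 (val f').2)) => ->.
- rewrite !card_sig card_ord [X in (_ <= _ + X)%N](_ : _ = #|faces|); last exact: eq_card.
  rewrite [X in (X.+2 <= _)%N](_ : _ = #|edges|); last exact: eq_card.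
  rewrite card_faces card_edges; lia.
- move=> [[a b] ab] /=; have d : dart (a, b) by move: ab; rewrite inE => /andP[].
  by rewrite (sum_edges_incidence (lift_pair y) d) !lift_pairE // yc.
exists S => a b d.
have abE : [set a; b] \in edges by rewrite mem_edges ?(dart_neq surfP d).
by have := SE (exist _ [set a; b] abE); rewrite /= lift_pairE // sum_mem_pair ?(dart_neq surfP d).
Qed.

(** Carries a statement from the representatives in [faces] to all darts: a dart reaches the first
    dart of its face after at most two rotations. *)
Lemma face_rot_ind (Q : V -> V -> Prop) :
  (forall a b, dart (a, b) -> Q b (third a b) -> Q a b) ->
  (forall f : {p in faces}, Q (val f).1 (val f).2) ->
  forall a b, dart (a, b) -> Q a b.
Proof.
move=> rot Qf.
have Q1 a b : dart (a, b) -> first_dart P (a, b) -> Q a b.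
  move=> d fd; have abF : (a, b) \in faces by rewrite inE d.
  exact: (Qf (exist _ (a, b) abF)).
move=> a b d; case fd: (first_dart P (a, b)); first exact: Q1.
have := first_dart_exists surfP d fd.
case fd': (first_dart P (b, _)) => /=.
  by move=> _; apply: rot => //; apply: Q1 => //; exact: dart_next.
case fd'': (first_dart P (third a b, a)) => // _; apply: (rot) => //; have dn := dart_next surfP d.
apply: rot => //; rewrite (third_next surfP d); apply: Q1 => //.
exact: dart_prev.
Qed.

(* If the link of [a] were disconnected, the edges [a b] with [U a b] constant on one
   component would form a cut, and the faces meeting its side away from [a] would be
   closed under adjacency without exhausting all faces. *)
Lemma corner_const (X : eqType) (U : V -> V -> X) :
  (forall a b, dart (a, b) -> U a b = U a (third a b)) ->
  forall a b b', dart (a, b) -> dart (a, b') -> U a b = U a b'.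
Proof.
move=> Uth a b b0 d d0; apply/eqP.
pose C q := U a q == U a b0; rewrite -[_ == _]/(C b).
have Cth q r : P a q r -> C q = C r.
  by move=> aqr; rewrite /C Uth ?(face_dart surfP aqr) // (thirdE surfP aqr).
pose y p q : F2 := ((p == a) && C q)%:R + ((q == a) && C p)%:R.
have ys p q : y p q = y q p by rewrite /y addrC.
have [|S SE] := cycle_is_cut ys.
  move=> p q r pqr; rewrite /y.
  have -> : (p == a) && C q = (p == a) && C r.
    by case: eqP => //= pa; apply: Cth; rewrite -pa.
  have -> : (q == a) && C p = (q == a) && C r.
    by case: eqP => //= qa; apply/esym/Cth; rewrite -qa; exact: face_cyc pqr.
  have -> : (r == a) && C q = (r == a) && C p.
    by case: eqP => //= ra; apply/esym/Cth; rewrite -ra; exact/(face_cyc surfP)/face_cyc.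
  set u := _%:R; set v := _%:R; set w := _%:R.
  have -> : u + v + (v + w) + (w + u) = (u + u) + (v + v) + (w + w) by ring.
  by rewrite !F2_addrr.
pose S' v := S v + S a.
have S'E p q : dart (p, q) -> y p q = S' p + S' q.
  move=> /SE ->; rewrite /S'.
  by rewrite -[LHS]addr0 -[in LHS](F2_addrr (S a)); ring.
have S'a : S' a = 0 by exact: F2_addrr.
have y0 p q : p != a -> q != a -> y p q = 0.
  by rewrite /y => /negbTE-> /negbTE->; rewrite addr0.
(* An edge avoiding [a] joins equal values of [S'], and [S'] vanishes at [a]; so two zeros on a face
   force the third. Hence whether a face carries a nonzero value can be read off from any of its
   edges, which makes [s] invariant under adjacency. *)
have key p q r : P p q r -> S' p = 0 -> S' q = 0 -> S' r = 0.
  move=> pqr Sp Sq; have qr := face_cyc surfP pqr; have rp := face_cyc surfP qr.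
  have yqr := S'E _ _ (face_dart surfP qr); have yrp := S'E _ _ (face_dart surfP rp).
  case: (eqVneq r a) => [-> // | ra].
  case: (eqVneq q a) => [qa | qa]; last by move: yqr; rewrite y0 // Sq add0r.
  case: (eqVneq p a) => [pa | pa]; last by move: yrp; rewrite y0 // Sp addr0.
  by have := face_neq surfP pqr; rewrite pa qa eqxx.
pose s p q r := [|| S' p != 0, S' q != 0 | S' r != 0].
have sE p q r : P p q r -> s p q r = (S' p != 0) || (S' q != 0).
  move=> pqr; rewrite /s; case: (eqVneq (S' p) 0) => //= Sp.
  by case: (eqVneq (S' q) 0) => //= Sq; rewrite (key _ _ _ pqr Sp Sq) eqxx.
have sconst := connP (s := s) _ _ (a' := a) (b' := b0) _ d0.
have Cb0 q : dart (a, q) -> (S' q != 0) = C q.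
  move=> aq; have := S'E _ _ aq; rewrite S'a add0r => <-; rewrite /y eqxx /=.
  by rewrite [q == a]eq_sym (negbTE (dart_neq surfP aq)) addr0; case: (C q).
have := sconst _ _ a b (third a b) d; rewrite !sE // S'a eqxx /= (Cb0 b) // (Cb0 b0) //.
rewrite /C eqxx; apply.
  by move=> p q r _; rewrite /s orbC -orbA.
by move=> p q r t pqr qpt; rewrite (sE _ _ _ pqr) (sE _ _ _ qpt) orbC.
Qed.

(* The corner value at [a] in the face [(a, b, c)] is [(x a b + x c a - x b c) / 2];
   the hypothesis says that it agrees on adjacent faces. *)
Lemma edge_op_kernel (K : fieldType) (x : V -> V -> K) : 2%:R != 0 :> K ->
  (forall a b, x a b = x b a) ->
  (forall a b, dart (a, b) -> edge_op P x a b + edge_op P x b a = 0) ->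
  exists u, forall a b, dart (a, b) -> x a b = dsum u a b.
Proof.
move=> K2 xs xk.
pose U a b := (x a b + x (third a b) a - x b (third a b)) / 2%:R.
have Uc : forall a b b', dart (a, b) -> dart (a, b') -> U a b = U a b'.
  apply: corner_const => a b d; rewrite /U.
  (* The faces to the left of (a, b) and of (a, c), with c = [third a b], share the edge between [a]
     and [c]; the difference of their corner values at [a] is half the kernel condition at that
     edge. *)
  have dp := dart_prev surfP d; have := xk _ _ dp.
  rewrite /edge_op (third_prev surfP d) => xk0.
  congr (_ / _); rewrite (xs a (third a b)).
  set c := third a b in xk0 *; set e := third a c in xk0 *.
  apply/eqP; rewrite -subr_eq0; apply/eqP; rewrite -[RHS]xk0; ring.
(* The vertex function reads the corner value at an arbitrary dart leaving [v]; by [Uc] the choice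
   is immaterial. Two corner values of one face add up to [x] on the edge joining them. *)
exists (fun v => U v (odflt v [pick b | dart (v, b)])) => a b d; rewrite /dsum.
case: pickP => [b' d' | /(_ b)]; last by rewrite d.
case: pickP => [a' d'' | /(_ (third a b))]; last by rewrite (dart_next surfP d).
rewrite (Uc _ _ b d' d) /= (Uc _ _ _ d'' (dart_next surfP d)) /U (third_next surfP d).
by field.
Qed.

(** By [dsum_decomp], orthogonality to the indicators of [E0] is orthogonality to every edge
    indicator, so [x = dsum u] by [edge_op_kernel]. As [x] vanishes on [H], [dsum_adj_eq0] gives
    [u = 0]. *)
Lemma ind_kernel_odd (K : fieldType) (c : 'I_m -> K) : 2%:R != 0 :> K ->
  (forall l, beta P (fun a b => \sum_k c k * indE K (e0 k) a b) (indE K (e0 l)) = 0) ->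
  c =1 (fun=> 0).
Proof.
move=> K2; set x := fun a b : V => _ => xk.
have xs a b : x a b = x b a by apply: eq_bigr => k _; rewrite [indE _ _ a b]indE_sym.
have [|u xu] := edge_op_kernel K2 xs.
  move=> a b d; rewrite -(beta_indE surfP x (e := (a, b))) // (beta_anti surfP).
  have [u [c' wE]] := dsum_decomp K2 (indE_sym K (a, b)).
  rewrite (eq_betar surfP _ wE) betaDr // (beta_dsumr surfP) // beta_sumr //.
  by rewrite add0r big1 ?oppr0 // => k _; rewrite xk mulr0.
have u0 : u =1 (fun=> 0).
  apply: dsum_adj_eq0 => // a b ab; rewrite -[LHS](xu a b) ?adj_dart //.
  by rewrite /x sum_ind_adj.
move=> k; rewrite -(sum_ind_e0 c (a := (e0 k).1) (b := (e0 k).2) (k := k)) //.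
by rewrite -[LHS]/(x _ _) xu ?/dsum ?u0 ?addr0 // -surjective_pairing.
Qed.

Lemma F2_sqr (x : F2) : x * x = x.
Proof. by case: (F2_cases x) => ->; rewrite ?mulr0 ?mulr1. Qed.

Lemma dart_ext_rot (K : comPzRingType) (t : V -> V -> K) :
  (forall a b, dart (a, b) -> t b (third a b) = t a b) ->
  forall a b, dart (a, b) ->
  dart_ext (fun f : {p in faces} => t (val f).1 (val f).2) a b = t a b.
Proof.
move=> trot; apply: face_rot_ind => [a b d | f]; last by rewrite dart_ext_val.
by rewrite dart_ext_next // trot.
Qed.

Definition face_sum (K : nmodType) (x : V -> V -> K) a b :=
  x a b + x b (third a b) + x (third a b) a.

Lemma face_sum_rot (K : nmodType) (x : V -> V -> K) a b : dart (a, b) ->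
  face_sum x b (third a b) = face_sum x a b.
Proof. by move=> d; rewrite /face_sum (third_next surfP d) addrC addrA. Qed.

Lemma face_sum_ind (K : comPzRingType) (c : 'I_m -> K) a b :
  face_sum (fun a b => \sum_k c k * indE K (e0 k) a b) a b =
  \sum_k c k * incidence K (edge (e0 k)) (a, b).
Proof.
rewrite /face_sum -!big_split; apply: eq_bigr => k _ /=.
by rewrite -!mulrDr.
Qed.

(** Modulo 2 the three copies of [l] in a face sum add up to [l], so [y] has zero face sums and is a
    cut [S]. On [H] it equals [l]: the odd cycle excludes [l = 1], and for [l = 0] connectedness
    makes [S] constant. *)
Lemma incidence_free (c : 'I_m -> F2) (l : F2) :
  (forall f : {p in faces}, l + \sum_k c k * incidence F2 (edge (e0 k)) (val f) = 0) ->
  l = 0 /\ c =1 (fun=> 0).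
Proof.
move=> cl; pose y a b := l + \sum_k c k * indE F2 (e0 k) a b.
have ys a b : y a b = y b a.
  by congr (_ + _); apply: eq_bigr => k _; rewrite [indE _ _ a b]indE_sym.
have yf a b : dart (a, b) -> face_sum y a b = 0.
  move: a b; apply: face_rot_ind => [a b d | f]; first by rewrite face_sum_rot.
  rewrite -[RHS](cl f) [val f]surjective_pairing /= -face_sum_ind /face_sum /y.
  set u := \sum_k _; set v := \sum_k _; set w := \sum_k _.
  by rewrite -[RHS]addr0 -(F2_addrr l); ring.
have [|S SE] := cycle_is_cut ys.
  by move=> a b c' abc; rewrite -(thirdE surfP abc); apply: yf; exact: face_dart abc.
have l0 : l = 0.
  case: (F2_cases l) => // l1.
  have [|x] := odd_cycle_alternate cyc_cycle cyc_odd (f := S) (c := 1).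
    by move=> a b ab; rewrite -SE ?adj_dart // /y sum_ind_adj // addr0.
  by rewrite F2_addrr => /esym/eqP; rewrite oner_eq0.
split=> // k.
have y0 a b : dart (a, b) -> y a b = 0.
  move=> /SE ->; rewrite (connect_const (f := S) H_conn _ a b) ?F2_addrr // => p q pq.
  apply: F2_addr_eq0; rewrite -SE ?adj_dart // /y sum_ind_adj //.
  by rewrite l0 addr0.
rewrite -(sum_ind_e0 c (a := (e0 k).1) (b := (e0 k).2) (k := k)) //.
rewrite -[RHS](y0 (e0 k).1 (e0 k).2) -?surjective_pairing //.
by rewrite /y l0 add0r.
Qed.

(* The function [s] of face sums of [x] and the constant 1 both lie in the left kernel
   of the incidence vectors of [E0] and 1, which is a line; so [s] is constant, and
   [incidence_free] applies. *)
Lemma ind_kernel_2 (c : 'I_m -> F2) :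
  (forall l, beta P (fun a b => \sum_k c k * indE F2 (e0 k) a b) (indE F2 (e0 l)) = 0) ->
  c =1 (fun=> 0).
Proof.
set x := fun a b : V => _ => xk.
have xs a b : x a b = x b a by apply: eq_bigr => k _; rewrite [indE _ _ a b]indE_sym.
pose s (f : {p in faces}) := face_sum x (val f).1 (val f).2.
have sE f : s f = \sum_k c k * incidence F2 (edge (e0 k)) (val f).
  by rewrite /s face_sum_ind -surjective_pairing.
pose M (o : option 'I_m) (f : {p in faces}) : F2 :=
  if o is Some k then incidence F2 (edge (e0 k)) (val f) else 1.
have sM k : \sum_f s f * M (Some k) f = 0.
  (* Modulo 2 the value of [x] on an edge cancels from the sum of the two adjacent face sums, and
     what remains is [beta] of [x] with the indicator of that edge. *)
  rewrite /M sum_incidence -?surjective_pairing //.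
  rewrite !(dart_ext_rot (face_sum_rot x)); last first.
  - by rewrite -surjective_pairing.
  - by rewrite (dart_revE surfP) -surjective_pairing.
  have := xk k; rewrite (beta_anti surfP) beta_indE // /edge_op /face_sum (xs (e0 k).2 (e0 k).1).
  move: (x (e0 k).1 (e0 k).2) => u; set v := x _ _; set w := x _ _; set v' := x _ _; set w' := x _ _ => vw.
  have -> : u + v + w + (u + v' + w') = - - (v - w + (v' - w')) + (w + w) + (w' + w') + (u + u) by ring.
  by rewrite vw !F2_addrr oppr0 !addr0.
have [||[k|]|[k|]||l sl] := @fin_line F2 (option 'I_m) {p in faces} M s (fun=> 1).
- rewrite card_option card_ord card_sig -[RHS]card_faces; exact: eq_card.
- move=> u uM; have [|l0 c0] := @incidence_free (fun k => u (Some k)) (u None).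
    by move=> f; rewrite -[RHS](uM f) sum_option mulr1.
  by case=> [k|]; [exact: c0 | exact: l0].
- exact: sM.
(* Over F_2 the total of [s] is the sum of its squares; expanding one factor by [sE] reduces it to
   the sums that vanish by [sM]. *)
- rewrite /M; under eq_bigr => f _ do rewrite mulr1 -(F2_sqr (s f)) [X in _ * X]sE mulr_sumr.
  rewrite exchange_big big1 // => k _.
  under eq_bigr => f _ do rewrite mulrCA.
  by rewrite -mulr_sumr sM mulr0.
- rewrite /M (sum_incidence (fun=> 1)) -?surjective_pairing //.
  rewrite !(dart_ext_rot (t := fun _ _ => 1 : F2)) ?F2_addrr //.
    by rewrite (dart_revE surfP) -surjective_pairing.
  by rewrite -surjective_pairing.
(* The constant 1 is orthogonal to itself because the number of faces m + 2 is even, m being 2n -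
   6. *)
- rewrite /M mulr1 sumr_const card_sig.
  have -> : #|[pred p | p \in faces]| = (m./2.+1 * 2)%N.
    transitivity #|faces|; first exact: eq_card.
    by rewrite card_faces; lia.
  by rewrite mulrnA mulr2n F2_addrr.
- have : (0 < #|faces|)%N by rewrite card_faces.
  by move=> /card_gt0P[p pf]; exists (exist _ p pf); exact: oner_neq0.
apply: (proj2 (incidence_free (l := l) _)) => f.
by rewrite -sE sl mulr1 F2_addrr.
Qed.

Definition e0_gram (K : comNzRingType) : 'M[K]_m :=
  \matrix_(k, l) beta P (indE K (e0 k)) (indE K (e0 l)).

Lemma e0_gram_map (K L : comNzRingType) (f : {rmorphism K -> L}) :
  map_mx f (e0_gram K) = e0_gram L.
Proof.
apply/matrixP => k l; rewrite !mxE rmorph_sum; apply: eq_bigr => p _.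
by rewrite rmorphM rmorphB /indE !rmorph_nat.
Qed.

Lemma e0_gram_unit_Fp p : prime p -> \det (e0_gram 'F_p) != 0.
Proof.
move=> pp; rewrite -unitfE -unitmxE -row_free_unit -kermx_eq0.
apply/eqP/row_matrixP => i; rewrite row0.
set c := row i _; have : c *m e0_gram 'F_p = 0 by apply/eqP; rewrite -sub_kermx row_sub.
move: c => c /rowP c0.
have cW l : beta P (fun a b => \sum_k c 0 k * indE 'F_p (e0 k) a b) (indE 'F_p (e0 l)) = 0.
  rewrite beta_suml; have := c0 l; rewrite [RHS]mxE mxE => c0l; apply: etrans c0l.
  by apply: eq_bigr => k _; rewrite !mxE.
apply/rowP => k; rewrite [RHS]mxE.
have [p2 | p2] := eqVneq p 2%N; first by subst p; exact: ind_kernel_2.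
apply: (ind_kernel_odd (c := fun k => c 0 k)) => //.
rewrite -(dvdn_pcharf (pchar_Fp pp)); apply/negP => /dvdn_leq - /(_ isT).
by have := prime_gt1 pp; move/eqP: p2; lia.
Qed.

Lemma det_e0_gram_int : `|\det (e0_gram int)| = 1.
Proof.
have nd p : prime p -> ~~ (p %| `|\det (e0_gram int)|)%N.
  move=> pp; rewrite -[X in (X %| _)%N]/(`|p|%N) -dvdzE (dvdz_pcharf (pchar_Fp pp)).
  by rewrite -det_map_mx e0_gram_map e0_gram_unit_Fp.
rewrite -abszE; move: nd; case: `|_|%N => [|[|d]] nd //.
  by have := nd 2%N isT; rewrite dvdn0.
by have := nd _ (pdiv_prime (isT : 1 < d.+2)%N); rewrite pdiv_dvd.
Qed.

Lemma det_beta (K : numFieldType) (x : 'I_m -> V -> V -> K) :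
  (forall i a b, x i a b = x i b a) ->
  `|\det (\matrix_(i, k) beta P (indE K (e0 k)) (x i))| ^+ 2 =
  `|\det (\matrix_(i, j) beta P (x i) (x j))|.
Proof.
move=> xs; have K2 : 2%:R != 0 :> K by rewrite pnatr_eq0.
have [u /fin_all_exists[c xE]] := fin_all_exists (fun i => dsum_decomp K2 (xs i)).
have bE y i : (forall a b, y a b = y b a) ->
    beta P y (x i) = \sum_k c i k * beta P y (indE K (e0 k)).
  by move=> ys; rewrite (eq_betar surfP _ (xE i)) betaDr // beta_dsumr // add0r beta_sumr.
set W := e0_gram K; pose C := \matrix_(i, k) c i k.
have -> : \matrix_(i, k) beta P (indE K (e0 k)) (x i) = C *m W^T.
  apply/matrixP => i k; rewrite !mxE bE => [|a b]; last by rewrite indE_sym.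
  by apply: eq_bigr => l _; rewrite !mxE.
have -> : \matrix_(i, j) beta P (x i) (x j) = C *m W *m C^T.
  apply/matrixP => i j; rewrite !mxE bE //; apply: eq_bigr => l _.
  rewrite !mxE mulrC; congr (_ * _).
  rewrite (beta_anti surfP) bE => [|a b]; last by rewrite indE_sym.
  by rewrite -sumrN; apply: eq_bigr => k _; rewrite !mxE (beta_anti surfP) mulrN opprK.
have W1 : `|\det W| = 1.
  have := congr1 (fun d : int => d%:~R : K) det_e0_gram_int.
  by rewrite intr_norm -det_map_mx e0_gram_map.
by rewrite !det_mulmx !det_tr !normrM W1 !mulr1 expr2.
Qed.

End Char2.
End Surface.

(** * Planar triangulations *)

Section Geometry.
Variables (R : realType) (n : nat) (z : 'I_n -> R[i]).
Local Notation C := R[i].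
Local Notation V := 'I_n.
Local Notation X i := (complex.Re (z i)).
Local Notation Y i := (complex.Im (z i)).
Local Notation cross := (cross z).

Definition crossp (a b : V) (p : C) : R :=
  (X b - X a) * (complex.Im p - Y a) - (Y b - Y a) * (complex.Re p - X a).

Lemma crossE a b c : cross a b c = (X b - X a) * (Y c - Y a) - (Y b - Y a) * (X c - X a).
Proof. by rewrite /Defs.cross; case: (z a) (z b) (z c) => ? ? [? ?] [? ?]. Qed.

Lemma crossp_pt a b c : crossp a b (z c) = cross a b c.
Proof. by rewrite crossE. Qed.

Lemma cross_rot a b c : cross a b c = cross b c a.
Proof. by rewrite !crossE; ring. Qed.

Lemma cross_swap a b c : cross b a c = - cross a b c.
Proof. by rewrite !crossE; ring. Qed.

Lemma cross_aab a b : cross a a b = 0.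
Proof. by rewrite crossE; ring. Qed.

Lemma cross_aba a b : cross a b a = 0.
Proof. by rewrite crossE; ring. Qed.

Lemma cross_abb a b : cross a b b = 0.
Proof. by rewrite crossE; ring. Qed.

Lemma Re_comb (l : V -> R) : complex.Re (\sum_i cR (l i) * z i) = \sum_i l i * X i.
Proof.
rewrite (big_morph (@complex.Re R) (id1 := 0) (op1 := +%R)) //; last by case=> ? ? [? ?].
by apply: eq_bigr => i _; rewrite /cR; case: (z i) => a b /=; rewrite mul0r subr0.
Qed.

Lemma Im_comb (l : V -> R) : complex.Im (\sum_i cR (l i) * z i) = \sum_i l i * Y i.
Proof.
rewrite (big_morph (@complex.Im R) (id1 := 0) (op1 := +%R)) //; last by case=> ? ? [? ?].
by apply: eq_bigr => i _; rewrite /cR; case: (z i) => a b /=; rewrite mul0r addr0.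
Qed.

Lemma crossp_comb a b (l : V -> R) : \sum_i l i = 1 ->
  crossp a b (\sum_i cR (l i) * z i) = \sum_i l i * cross a b i.
Proof.
move=> l1; rewrite /crossp Re_comb Im_comb.
rewrite [RHS](eq_bigr (fun i => (X b - X a) * (l i * Y i) - (Y b - Y a) * (l i * X i)
  - l i * ((X b - X a) * Y a - (Y b - Y a) * X a))) => [|i _]; last by rewrite crossE; ring.
rewrite !sumrB -!mulr_sumr -mulr_suml l1; ring.
Qed.

Lemma crossp_ge0 (A : {set V}) a b p : conv z A p ->
  (forall i, i \in A -> 0 <= cross a b i) -> 0 <= crossp a b p.
Proof.
move=> [l [l0 [lA [l1 ->]]]] pos; rewrite crossp_comb //; apply: sumr_ge0 => i _.
by case iA: (i \in A); [rewrite mulr_ge0 // pos | rewrite lA ?mul0r // iA].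
Qed.

(** For the converse, the three half-plane values divided by the doubled area are the barycentric
    coordinates of [p]. *)
Lemma conv_triangle a b c p : 0 < cross a b c ->
  conv z [set a; b; c] p <->
  [/\ 0 <= crossp a b p, 0 <= crossp b c p & 0 <= crossp c a p].
Proof.
move=> D0; split=> [cp | [pc pa pb]].
  split; apply: (crossp_ge0 cp) => i; rewrite !inE => /orP[/orP[]|] /eqP->;
    rewrite ?cross_aba ?cross_abb //; first exact: ltW.
    by rewrite -cross_rot ltW.
  by rewrite cross_rot ltW.
have ab : a != b by apply: contraTneq D0 => ->; rewrite cross_aab ltxx.
have ac : a != c by apply: contraTneq D0 => ->; rewrite cross_aba ltxx.
have bc : b != c by apply: contraTneq D0 => ->; rewrite cross_abb ltxx.
pose D := cross a b c.
pose l i := if i == a then crossp b c p / D else if i == b then crossp c a p / D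
  else if i == c then crossp a b p / D else 0.
have sum3 (F : V -> R) : \sum_i l i * F i =
    l a * F a + l b * F b + l c * F c.
  rewrite (bigD1 a) //= (bigD1 b) 1?eq_sym //= (bigD1 c) /=; last first.
    by rewrite eq_sym ac eq_sym bc.
  rewrite big1 => [|i /andP[/andP[/negbTE ia /negbTE ib] /negbTE ic]]; first by ring.
  by rewrite /l ia ib ic mul0r.
have [la lb lc] : [/\ l a = crossp b c p / D, l b = crossp c a p / D
    & l c = crossp a b p / D].
  by rewrite /l !eqxx (eq_sym b a) (negbTE ab) (eq_sym c a) (negbTE ac)
    (eq_sym c b) (negbTE bc).
have Dn0 : D != 0 by rewrite gt_eqF.
have DE : D = (X b - X a) * (Y c - Y a) - (Y b - Y a) * (X c - X a) by exact: crossE.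
exists l; split; last split; last split.
- by move=> i; rewrite /l; do !case: ifP => _ //; apply: divr_ge0 => //; exact: ltW.
- move=> i; rewrite !inE !negb_or => /andP[/andP[/negbTE ia /negbTE ib] /negbTE ic].
  by rewrite /l ia ib ic.
- transitivity (\sum_i l i * 1); first by apply: eq_bigr => i _; rewrite mulr1.
  rewrite sum3 la lb lc !mulr1 -!mulrDl -[RHS](divff Dn0); congr (_ / _).
  by rewrite DE /crossp; ring.
have comb (u v w k1 k2 k3 : R) :
  k1 / D * u + k2 / D * v + k3 / D * w = (k1 * u + k2 * v + k3 * w) / D by ring.
apply/eqP; rewrite eq_complex Re_comb Im_comb !sum3 la lb lc !comb.
apply/andP; split; apply/eqP; apply: (mulIf Dn0); rewrite divfK //.
  by rewrite DE /crossp; ring.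
by rewrite DE /crossp; ring.
Qed.

Lemma tri_third a b (t : {set V}) : a != b -> a \in t -> b \in t ->
  (exists x y w, t = [set x; y; w] /\ cross x y w != 0) ->
  exists d, t = [set a; b; d] /\ cross a b d != 0.
Proof.
move=> ab at0 bt0 [x [y [w [tE D]]]]; move: at0 bt0; rewrite tE.
have xyw : [set x; y; w] = [set y; w; x] :> {set V} by apply/finset.setP => i; rewrite !inE; case: (i == x); case: (i == y); case: (i == w).
have ywx : [set x; y; w] = [set w; x; y] :> {set V} by apply/finset.setP => i; rewrite !inE; case: (i == x); case: (i == y); case: (i == w).
have D1 : cross y w x != 0 by rewrite -cross_rot.
have D2 : cross w x y != 0 by rewrite cross_rot.
have sw (p q r : V) : cross p q r != 0 -> exists d, [set p; q; r] = [set q; p; d] :> {set V} /\ cross q p d != 0.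
  by move=> Dpqr; exists r; rewrite (finset.setUC [set q]) cross_swap oppr_eq0.
have sw0 (p q r : V) : cross p q r != 0 -> exists d, [set p; q; r] = [set p; q; d] :> {set V} /\ cross p q d != 0.
  by exists r.
rewrite !inE => /orP[/orP[]|] /eqP ? /orP[/orP[]|] /eqP ?; subst;
  first [by rewrite eqxx in ab | exact: sw0 | exact: sw | rewrite xyw; exact: sw0
    | rewrite xyw; exact: sw | rewrite ywx; exact: sw0 | rewrite ywx; exact: sw ].
Qed.

Lemma triangle_ccw (t : {set V}) : (exists a b c, t = [set a; b; c] /\ cross a b c != 0) ->
  exists a b c, t = [set a; b; c] /\ 0 < cross a b c.
Proof.
move=> [a [b [c [tE D]]]]; case: (ltgtP 0 (cross a b c)) D => // D _.
  by exists a, b, c.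
by exists b, a, c; rewrite (finset.setUC [set b]) cross_swap oppr_gt0.
Qed.

Definition midp a b : C := Complex ((X a + X b) / 2%:R) ((Y a + Y b) / 2%:R).

Hypothesis z_inj : injective z.

Lemma sum_pair (F : V -> R) a b : a != b ->
  (forall i, i != a -> i != b -> F i = 0) -> \sum_i F i = F a + F b.
Proof.
move=> ab F0; rewrite (bigD1 a) //= (bigD1 b) 1?eq_sym //= big1 ?addr0 //.
by move=> i /andP[]; exact: F0.
Qed.

(** The affine function [crossp a b] vanishes at the midpoint, while every other point of [A] lies
    strictly on one side, so all weight sits on [a] and [b]. If one of them were absent, the
    midpoint would be an endpoint, contrary to injectivity. *)
Lemma midp_mem (A : {set V}) a b (s : R) : a != b ->
  (forall i, i \in A -> i != a -> i != b -> 0 < s * cross a b i) ->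
  conv z A (midp a b) -> a \in A /\ b \in A.
Proof.
move=> ab pos [l [l0 [lA [l1 mE]]]].
have l00 i : i != a -> i != b -> l i = 0.
  have c0 : \sum_i s * (l i * cross a b i) = 0.
    by rewrite -mulr_sumr -crossp_comb // -mE /crossp /=; field.
  have t0 j : true -> 0 <= s * (l j * cross a b j).
    move=> _; case jA: (j \in A); last by rewrite lA ?jA // mul0r mulr0.
    rewrite mulrCA; apply: mulr_ge0 => //.
    have [->|ja] := eqVneq j a; first by rewrite cross_aba mulr0.
    have [->|jb] := eqVneq j b; first by rewrite cross_abb mulr0.
    exact/ltW/pos.
  move=> ia ib; case iA: (i \in A); last by rewrite lA ?iA.
  have /eqP := psumr_eq0P t0 c0 isT (i := i).
  by rewrite mulrCA mulf_eq0 (gt_eqF (pos _ iA ia ib)) orbF => /eqP.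
have lab : l a + l b = 1 by rewrite -l1 (sum_pair ab).
have [Xm Ym] : X a + X b = 2%:R * (l a * X a + l b * X b) /\
    Y a + Y b = 2%:R * (l a * Y a + l b * Y b).
  split.
    have := congr1 (@complex.Re R) mE; rewrite Re_comb (sum_pair ab) => [/= <-|i ia ib].
      by field.
    by rewrite l00 ?mul0r.
  have := congr1 (@complex.Im R) mE; rewrite Im_comb (sum_pair ab) => [/= <-|i ia ib].
    by field.
  by rewrite l00 ?mul0r.
have zab : ~ (X a = X b /\ Y a = Y b).
  move=> [Xe Ye]; move/eqP: ab; apply; apply: z_inj.
  by apply/eqP; rewrite eq_complex Xe Ye !eqxx.
split; apply/negPn/negP => /lA le0; apply: zab; move: lab Xm Ym; rewrite le0.
  by rewrite add0r => ->; split; lra.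
by rewrite addr0 => ->; split; lra.
Qed.

(** Serves as the closedness of a triangle along a segment: each side condition is affine in the
    parameter, and holding at arbitrarily small positive parameters it holds at 0. *)
Lemma affine_closed (A B : R) :
  (forall d, 0 < d -> exists e, [/\ 0 < e, e < d & 0 <= A + B * e]) -> 0 <= A.
Proof.
move=> H; rewrite leNgt; apply/negP => A0.
have B1 : 0 < `|B| + 1 by rewrite ltr_wpDl.
have [|e [e0 ed]] := H (- A / (`|B| + 1)); first by rewrite divr_gt0 // oppr_gt0.
rewrite ltr_pdivlMr // in ed.
have : B * e <= `|B| * e by rewrite ler_wpM2r ?ler_norm // ltW.
nra.
Qed.

End Geometry.

Lemma fin_pos_lower (R : realType) (I : finType) (d : I -> R) :
  (forall i, 0 < d i) -> exists e, 0 < e /\ forall i, e <= d i.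
Proof.
move=> d0; exists (\big[Num.min/1]_i d i); split.
  by apply: lt_bigmin => // i _; exact: d0.
by move=> i; exact: bigmin_le.
Qed.

(** * Faces of a planar triangulation and their adjacency *)

Section Triangulation.
Variables (R : realType) (n : nat) (z : 'I_n -> R[i]) (T : {set {set 'I_n}}).
Variables (v1 v2 v3 : 'I_n).
Local Notation C := R[i].
Local Notation V := 'I_n.
Local Notation X i := (complex.Re (z i)).
Local Notation Y i := (complex.Im (z i)).
Local Notation cross := (cross z).
Local Notation crp := (crossp z).
Local Notation f0 := (f0 v1 v2 v3).
Local Notation P := (pos_face v1 v2 v3 z T).
Hypothesis z_inj : injective z.
Hypothesis tri : is_triangulation z T.
Hypothesis v_cross : cross v1 v2 v3 != 0.
Hypothesis interior : forall i, i \notin f0 -> exists l1 l2 l3 : R,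
  [/\ 0 < l1, 0 < l2, 0 < l3, l1 + l2 + l3 = 1 &
      z i = cR l1 * z v1 + cR l2 * z v2 + cR l3 * z v3].

Lemma T_triangle t : t \in T -> exists a b c, t = [set a; b; c] /\ cross a b c != 0.
Proof. by case: tri => + _ _ _; apply. Qed.

Lemma f0_triangle : exists a b c, f0 = [set a; b; c] /\ cross a b c != 0.
Proof. by exists v1, v2, v3. Qed.

Lemma cross_hull a b i : i \notin f0 -> exists l1 l2 l3 : R,
  [/\ 0 < l1, 0 < l2, 0 < l3 &
      cross a b i = l1 * cross a b v1 + l2 * cross a b v2 + l3 * cross a b v3].
Proof.
move=> /interior[l1 [l2 [l3 [l10 l20 l30 l1s zi]]]]; exists l1, l2, l3; split=> //.
have [Xi Yi] : X i = l1 * X v1 + l2 * X v2 + l3 * X v3 /\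
    Y i = l1 * Y v1 + l2 * Y v2 + l3 * Y v3.
  rewrite zi /cR; case: (z v1) (z v2) (z v3) => ? ? [? ?] [? ?] /=.
  by split; ring.
have l1E : l1 = 1 - l2 - l3 by lra.
by rewrite !crossE Xi Yi l1E; ring.
Qed.

Lemma cross_hull_le a b : (forall k, k \in f0 -> cross a b k <= 0) ->
  forall i, cross a b i <= 0.
Proof.
move=> H i; case iF: (i \in f0); first exact: H.
have [l1 [l2 [l3 [l10 l20 l30 ->]]]] := cross_hull a b (negbT iF).
have := H v1; have := H v2; have := H v3; rewrite !inE !eqxx !orbT /=.
by move=> /(_ isT) ? /(_ isT) ? /(_ isT) ?; nra.
Qed.

Lemma cross_hull_lt a b k : (forall k, k \in f0 -> cross a b k <= 0) ->
  k \in f0 -> cross a b k < 0 -> forall i, i \notin f0 -> cross a b i < 0.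
Proof.
move=> H kf k0 i iF.
have [l1 [l2 [l3 [l10 l20 l30 ->]]]] := cross_hull a b iF.
have := H v1; have := H v2; have := H v3; rewrite !inE !eqxx !orbT /=.
move: kf k0; rewrite !inE => /orP[/orP[]|] /eqP-> k0;
by move=> /(_ isT) ? /(_ isT) ? /(_ isT) ?; nra.
Qed.

Lemma pos_face_neq a b c : P a b c -> a != b.
Proof.
by apply: contraTneq => ->; rewrite /pos_face cross_aab !ltxx !andbF orbb.
Qed.

Lemma pos_face_cyc a b c : P a b c -> P b c a.
Proof.
rewrite /pos_face -(cross_rot z a b c); suff -> : [set b; c; a] = [set a; b; c] :> {set V} by [].
by apply/finset.setP => i; rewrite !inE; case: (i == a); case: (i == b); case: (i == c).
Qed.

Lemma f0_le a b c : [set a; b; c] = f0 -> cross a b c < 0 -> forall i, cross a b i <= 0.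
Proof.
move=> fE D; apply: cross_hull_le => k; rewrite -fE !inE => /orP[/orP[]|] /eqP->.
- by rewrite cross_aba.
- by rewrite cross_abb.
exact: ltW.
Qed.

(** Two triangles on the same side of [a b] overlap in points off that line near its midpoint,
    whereas distinct ones may only share the segment. *)
Lemma ccw_triangle_uniq a b c c' : [set a; b; c] \in T -> 0 < cross a b c ->
  [set a; b; c'] \in T -> 0 < cross a b c' -> c = c'.
Proof.
move=> cT D cT' D'.
apply/eqP; apply: contraT => cc'.
have inter : [set a; b; c] :&: [set a; b; c'] = [set a; b] :> {set V}.
  apply/finset.setP => i; rewrite !inE.
  have [->|ic] := eqVneq i c; last by case: (i == a); case: (i == b).
  by rewrite (negbTE cc') orbF; case: (c == a); case: (c == b).
(* The point [p] lies a fraction [e] of the way from the midpoint of [a b] to [c']. With this [e]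
   the term [(1 - e) / 2 * cross a b c] equals [e * K], which compensates either of the possibly
   negative terms [e * cross b c c'] and [e * cross c a c']. *)
pose K := `|cross b c c'| + `|cross c a c'|.
have K0 : 0 <= K by rewrite addr_ge0.
pose e := cross a b c / (cross a b c + 2%:R * K).
have den : 0 < cross a b c + 2%:R * K by lra.
have e0 : 0 < e by rewrite divr_gt0.
have eE : e * (cross a b c + 2%:R * K) = cross a b c by rewrite divfK // gt_eqF.
have e1 : e <= 1 by rewrite ler_pdivrMr // mul1r; lra.
pose p := Complex ((1 - e) / 2%:R * (X a + X b) + e * X c')
                  ((1 - e) / 2%:R * (Y a + Y b) + e * Y c').
have pc : crp a b p = e * cross a b c'.
  by rewrite /crossp /= crossE; field.
have p1 : crp b c p = (1 - e) / 2%:R * cross a b c + e * cross b c c'.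
  by rewrite /crossp /= !crossE; field.
have p2 : crp c a p = (1 - e) / 2%:R * cross a b c + e * cross c a c'.
  by rewrite /crossp /= !crossE; field.
have p3 : crp b c' p = (1 - e) / 2%:R * cross a b c'.
  by rewrite /crossp /= !crossE; field.
have p4 : crp c' a p = (1 - e) / 2%:R * cross a b c'.
  by rewrite /crossp /= !crossE; field.
have n1 : - K <= cross b c c' by rewrite /K; have := ler_norm (- cross b c c'); rewrite normrN; have := normr_ge0 (cross c a c'); lra.
have n2 : - K <= cross c a c' by rewrite /K; have := ler_norm (- cross c a c'); rewrite normrN; have := normr_ge0 (cross b c c'); lra.
have cp : conv z [set a; b; c] p.
  by apply/conv_triangle => //; rewrite pc p1 p2; split; nra.
have cp' : conv z [set a; b; c'] p.
  by apply/conv_triangle => //; rewrite pc p3 p4; split; nra.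
have [_ /(_ _ _ cT cT') + _ _] := tri.
rewrite inter => I2; have : conv z [set a; b] p by rewrite -I2; split.
move=> [l [_ [lA [l1 pE]]]].
have : crp a b p = 0.
  rewrite pE crossp_comb //; apply: big1 => i _.
  have [->|ia] := eqVneq i a; first by rewrite cross_aba mulr0.
  have [->|ib] := eqVneq i b; first by rewrite cross_abb mulr0.
  by rewrite lA ?mul0r // !inE negb_or ia.
by rewrite pc => /eqP; rewrite mulf_eq0 !gt_eqF.
Qed.

(** The only case beyond [ccw_triangle_uniq] with content is a clash between a triangle and the
    exterior face: all points lie weakly to the right of a clockwise edge of [f0], leaving no place
    for a counterclockwise apex. *)
Lemma pos_face_uniq a b c c' : P a b c -> P a b c' -> c = c'.
Proof.
have mixed d d' : [set a; b; d] \in T -> 0 < cross a b d ->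
    [set a; b; d'] == f0 -> cross a b d' < 0 -> d = d'.
  by move=> _ D /eqP fE D'; have := f0_le fE D' d; rewrite leNgt D.
move=> Pc Pc'; have ab := pos_face_neq Pc.
have bc := pos_face_neq (pos_face_cyc Pc); have bc' := pos_face_neq (pos_face_cyc Pc').
have ca := pos_face_neq (pos_face_cyc (pos_face_cyc Pc)).
have ca' := pos_face_neq (pos_face_cyc (pos_face_cyc Pc')).
case/orP: Pc => /andP[cT D]; case/orP: Pc' => /andP[cT' D'].
- exact: (ccw_triangle_uniq cT D cT' D').
- exact: (mixed _ _ cT D cT' D').
- by rewrite (mixed _ _ cT' D' cT D).
move/eqP: cT' => fE; move/eqP: cT; rewrite -fE => /finset.setP/(_ c).
by rewrite !inE eqxx orbT (negbTE ca) (eq_sym c b) (negbTE bc) => /esym/eqP.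
Qed.

Lemma hull_midp a b : a != b -> conv z [set: V]%SET (midp z a b).
Proof.
move=> ab; pose l i : R := if (i == a) || (i == b) then 2%:R^-1 else 0.
have lE F : \sum_i l i * F i = 2%:R^-1 * (F a + F b).
  rewrite (sum_pair ab) => [|i /negbTE ia /negbTE ib]; last by rewrite /l ia ib mul0r.
  by rewrite /l !eqxx orbT mulrDr.
exists l; split; last split; last split.
- by move=> i; rewrite /l; case: ifP => // _; rewrite invr_ge0.
- by move=> i; rewrite inE.
- transitivity (\sum_i l i * 1); first by apply: eq_bigr => i _; rewrite mulr1.
  by rewrite lE; field.
by apply/eqP; rewrite eq_complex Re_comb Im_comb !lE /=; apply/andP; split; apply/eqP; field.
Qed.

Lemma hull_segment a b k (e : R) : 0 <= e <= 1 -> a != b ->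
  conv z [set: V]%SET (Complex ((1 - e) / 2%:R * (X a + X b) + e * X k)
                  ((1 - e) / 2%:R * (Y a + Y b) + e * Y k)).
Proof.
move=> /andP[e0 e1] ab.
pose l i : R := (1 - e) / 2%:R * (i == a)%:R + (1 - e) / 2%:R * (i == b)%:R + e * (i == k)%:R.
have d1 (j : V) (F : V -> R) : \sum_i (i == j)%:R * F i = F j :> R.
  rewrite (bigD1 j) //= eqxx mul1r big1 ?addr0 // => i /negbTE ->; exact: mul0r.
have lE F : \sum_i l i * F i = (1 - e) / 2%:R * (F a + F b) + e * F k.
  rewrite -(d1 a) -(d1 b) -(d1 k) mulrDr !mulr_sumr -!big_split; apply: eq_bigr => i _.
  by rewrite /l /=; ring.
exists l; split; last split; last split.
- by move=> i; rewrite /l !addr_ge0 // ?mulr_ge0 // ?divr_ge0 ?subr_ge0.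
- by move=> i; rewrite inE.
- transitivity (\sum_i l i * 1); first by apply: eq_bigr => i _; rewrite mulr1.
  by rewrite lE; field.
by apply/eqP; rewrite eq_complex Re_comb Im_comb !lE /= !eqxx.
Qed.

End Triangulation.

Section Triangulation.
Variables (R : realType) (n : nat) (z : 'I_n -> R[i]) (T : {set {set 'I_n}}).
Variables (v1 v2 v3 : 'I_n).
Local Notation C := R[i].
Local Notation V := 'I_n.
Local Notation X i := (complex.Re (z i)).
Local Notation Y i := (complex.Im (z i)).
Local Notation cross := (cross z).
Local Notation crp := (crossp z).
Local Notation f0 := (f0 v1 v2 v3).
Local Notation P := (pos_face v1 v2 v3 z T).
Hypothesis z_inj : injective z.
Hypothesis tri : is_triangulation z T.
Hypothesis v_cross : cross v1 v2 v3 != 0.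
Hypothesis interior : forall i, i \notin f0 -> exists l1 l2 l3 : R,
  [/\ 0 < l1, 0 < l2, 0 < l3, l1 + l2 + l3 = 1 &
      z i = cR l1 * z v1 + cR l2 * z v2 + cR l3 * z v3].

Lemma pos_face_T a b c : [set a; b; c] \in T -> 0 < cross a b c -> P a b c.
Proof. by move=> cT D; rewrite /pos_face cT D. Qed.

Lemma pos_face_f0 a b c : [set a; b; c] = f0 -> cross a b c < 0 -> P a b c.
Proof. by move=> cT D; rewrite /pos_face cT eqxx D orbT. Qed.

Lemma set3_swap (a b c : V) : [set b; a; c] = [set a; b; c] :> {set V}.
Proof. by apply/finset.setP => i; rewrite !inE; case: (i == a); case: (i == b). Qed.

(* Follow the segment from the midpoint of [a b] towards a vertex to its right: by
   finiteness one triangle contains points of it arbitrarily close to the midpoint. *)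
Lemma hull_vertex_exists a b t : a != b -> t \in T -> a \in t -> b \in t ->
  (exists k, cross a b k < 0) -> exists2 t', t' \in T &
  conv z t' (midp z a b) /\ exists2 i, i \in t' & cross a b i < 0.
Proof.
move=> ab tT at0 bt0 [k k0].
pose q (e : R) : C := Complex ((1 - e) / 2%:R * (X a + X b) + e * X k)
                  ((1 - e) / 2%:R * (Y a + Y b) + e * Y k).
have good : exists2 t', t' \in T &
    forall d, 0 < d -> exists e, [/\ 0 < e, e < d & conv z t' (q e)].
  apply: contrapT => bad.
  have H (t' : {set V}) : exists d : R, 0 < d /\ (t' \in T -> forall e, 0 < e -> e < d -> ~ conv z t' (q e)).
    case t'T: (t' \in T); last by exists 1.
    apply: contrapT => nd; apply: bad; exists t' => // d d0.
    apply: contrapT => ne; apply: nd; exists d; split=> // _ e e0 ed ce.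
    by apply: ne; exists e.
  have /fin_all_exists[d dP] := H.
  have [e [e0 ed]] := fin_pos_lower (fun t' => (dP t').1).
  have e10 : 0 < Num.min e 1 by rewrite lt_min e0 ltr01.
  pose e' := Num.min e 1 / 2%:R.
  have e'0 : 0 < e' by rewrite divr_gt0.
  have e'e : e' < e.
    by apply: (@lt_le_trans _ _ (Num.min e 1)); rewrite ?ge_min ?lexx // /e'; lra.
  have e'1 : e' <= 1.
    by apply: (@le_trans _ _ (Num.min e 1)); rewrite ?ge_min ?lexx ?orbT // /e'; lra.
  have /(hull_segment z k)/(_ ab) : 0 <= e' <= 1 by rewrite e'1 ltW.
  case: tri => _ _ cover _ /cover[t' t'T].
  exact: ((dP t').2 t'T e' e'0 (lt_le_trans e'e (ed t'))).
case: good => t' t'T good; exists t' => //.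
have [x [y [w [tE D]]]] := triangle_ccw (T_triangle tri t'T).
have aff (p r : V) (e : R) : crp p r (q e) = crp p r (midp z a b)
    + (crp p r (z k) - crp p r (midp z a b)) * e.
  by rewrite /crossp /q /midp /=; field.
have clos p r : (forall d, 0 < d -> exists e, [/\ 0 < e, e < d & 0 <= crp p r (q e)]) ->
    0 <= crp p r (midp z a b).
  move=> H; apply: (affine_closed (B := crp p r (z k) - crp p r (midp z a b))) => d d0.
  by have [eps [? ? ?]] := H d d0; exists eps; rewrite -aff.
split.
  rewrite tE; apply/conv_triangle => //; split;
    apply: clos => d d0; have [eps [eps0 epsd ceps]] := good d d0;
    move: ceps; rewrite tE => /(conv_triangle _ D)[h1 h2 h3]; by exists eps.
(* If no vertex of the triangle were to the right of [a b], neither would be its point [q e], which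
   lies strictly on the side of [k]. *)
apply: contrapT => nlt; have [e [e0 _ ce]] := good 1 ltr01.
have : 0 <= crp a b (q e).
  apply: (crossp_ge0 ce) => i it; rewrite leNgt; apply/negP => lt0.
  by apply: nlt; exists i.
rewrite aff crossp_pt (_ : crp a b (midp z a b) = 0); last first.
  by rewrite /crossp /midp /=; field.
by rewrite add0r subr0 leNgt pmulr_llt0 // k0.
Qed.

(** Three cases. Across an edge of [f0], a triangle covering the midpoint must contain both
    endpoints. If some point lies to the right of a triangle edge, the triangle from
    [hull_vertex_exists] meets the given one in the midpoint, hence in the whole edge. Otherwise the
    edge lies on the boundary of the hull, and the neighbour is [f0]. *)
Lemma pos_face_rev a b c : P a b c -> exists d, P b a d.
Proof.
move=> Pc; have ab := pos_face_neq Pc; have [_ inter cover _] := tri.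
case/orP: Pc => /andP[cT D]; last first.
  move/eqP: cT => fE.
  have [t tT ct] := (cover _).1 (hull_midp z ab).
  have ca : c != a by apply: contraTneq D => ->; rewrite cross_aba ltxx.
  have cb : c != b by apply: contraTneq D => ->; rewrite cross_abb ltxx.
  have lt0 i : i != a -> i != b -> cross a b i < 0.
    move=> ia ib; case iF: (i \in f0).
      by move: iF; rewrite -fE !inE (negbTE ia) (negbTE ib) => /eqP ->.
    apply: (cross_hull_lt interior (k := c)); rewrite ?iF // -?fE ?inE ?eqxx ?orbT //.
    by move=> k _; exact: (f0_le interior fE D).
  have [at0 bt0] : a \in t /\ b \in t.
    apply: (midp_mem z_inj (s := -1)) ct => // i _ ia ib.
    by rewrite mulN1r oppr_gt0 lt0.
  have [d [tE Dd]] := tri_third ab at0 bt0 (T_triangle tri tT).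
  exists d; apply: pos_face_T; first by rewrite set3_swap -tE.
  by rewrite cross_swap oppr_gt0 lt_neqAle Dd (f0_le interior fE D).
have at1 : a \in [set a; b; c] by rewrite !inE eqxx.
have bt1 : b \in [set a; b; c] by rewrite !inE eqxx orbT.
have [neg | nneg] := pselect (exists k, cross a b k < 0).
  have [t tT [mt [k kt k0]]] := hull_vertex_exists ab cT at1 bt1 neg.
  have mabc : conv z [set a; b; c] (midp z a b).
    apply/conv_triangle => //; rewrite /crossp /midp /=; move: D; rewrite crossE => D.
    by split; lra.
  have [] : a \in t :&: [set a; b; c] /\ b \in t :&: [set a; b; c].
    apply: (midp_mem z_inj (s := 1)) => // [i|].
      rewrite mul1r !inE => /andP[_] + /negbTE ia /negbTE ib.
      by rewrite ia ib => /eqP ->.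
    by rewrite -inter.
  rewrite !finset.in_setI => /andP[at2 _] /andP[bt2 _].
  have [d [tE Dd]] := tri_third ab at2 bt2 (T_triangle tri tT).
  exists d; apply: pos_face_T; first by rewrite set3_swap -tE.
  rewrite cross_swap oppr_gt0.
  by move: kt k0; rewrite tE !inE => /orP[/orP[]|] /eqP ->; rewrite ?cross_aba ?cross_abb ?ltxx.
have ge0 k : 0 <= cross a b k by rewrite leNgt; apply/negP => k0; apply: nneg; exists k.
(* At a point with strictly positive barycentric coordinates the nonnegative function [cross a b]
   vanishes only if it vanishes at all three hull vertices, hence is nowhere positive; but it is
   positive at [c]. *)
have inF i : cross a b i = 0 -> i \in f0.
  move=> i0; apply: contraT => iF.
  have [l1 [l2 [l3 [l10 l20 l30 cE]]]] := cross_hull interior a b iF.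
  have h1 := ge0 v1; have h2 := ge0 v2; have h3 := ge0 v3.
  have [k1 k2 k3] : [/\ cross a b v1 = 0, cross a b v2 = 0 & cross a b v3 = 0].
    by split; nra.
  have : cross a b c <= 0; last by rewrite leNgt D.
  apply: (cross_hull_le interior) => k.
  by rewrite !inE => /orP[/orP[]|] /eqP ->; rewrite ?k1 ?k2 ?k3.
have [d [fE Dd]] := tri_third ab (inF a (cross_aba z a b)) (inF b (cross_abb z a b)) (f0_triangle v_cross).
exists d; apply: pos_face_f0; first by rewrite set3_swap.
by rewrite cross_swap oppr_lt0 lt_neqAle eq_sym Dd ge0.
Qed.

Lemma surface_T : closed_surface P.
Proof.
split.
- exact: pos_face_cyc.
- exact: pos_face_neq.
- exact: (pos_face_uniq tri interior).
- exact: pos_face_rev.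
Qed.

Lemma f0_rot a0 b0 c0 a b c : [set a0; b0; c0] = f0 -> cross a0 b0 c0 < 0 ->
  [set a; b; c] = f0 -> cross a b c < 0 ->
  [\/ [/\ a = a0, b = b0 & c = c0], [/\ a = b0, b = c0 & c = a0]
    | [/\ a = c0, b = a0 & c = b0]].
Proof.
move=> E0 D0 E D.
have ma : a \in [set a0; b0; c0] by rewrite E0 -E !inE eqxx.
have mb : b \in [set a0; b0; c0] by rewrite E0 -E !inE eqxx orbT.
have mc : c \in [set a0; b0; c0] by rewrite E0 -E !inE eqxx orbT.
move: ma mb mc D; rewrite !inE.
move=> /orP[/orP[]|] /eqP -> /orP[/orP[]|] /eqP -> /orP[/orP[]|] /eqP ->;
  rewrite ?cross_aab ?cross_aba ?cross_abb ?ltxx // => D;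
  try (by [constructor 1 | constructor 2 | constructor 3]);
  move: D0 D; rewrite !crossE; lra.
Qed.

(* The areas of the counterclockwise faces in a set closed under adjacency telescope
   to 0, so such a set must contain the only clockwise face [f0]. *)
Lemma dual_connected_T : dual_connected P.
Proof.
move=> s srot sadj.
have [a0 [b0 [c0 [E0 D0]]]] : exists a0 b0 c0, [set a0; b0; c0] = f0 /\ cross a0 b0 c0 < 0.
  case: (ltgtP (cross v1 v2 v3) 0) v_cross => // D _; first by exists v1, v2, v3.
  by exists v2, v1, v3; rewrite set3_swap cross_swap oppr_lt0.
have P0 := pos_face_f0 E0 D0.
suff all0 a b c : P a b c -> s a b c = s a0 b0 c0.
  by move=> a b c a' b' c' /all0-> /all0->.
move=> Pabc; apply/eqP; apply: contraT => nabc.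
have surf := surface_T.
(* [S] marks the faces whose label differs from that of [f0]. They avoid [f0], so they are all
   counterclockwise. *)
pose S a b := s a b (third P a b) != s a0 b0 c0.
have sE p q r : P p q r -> third P p q = r by exact: (thirdE surf).
have S_next p q : dart P (p, q) -> S q (third P p q) = S p q.
  move=> d; rewrite /S (third_next surf d) -srot //.
have S_rev p q : dart P (p, q) -> S q p = S p q.
  by move=> d; rewrite /S (sadj p q _ _ d (dart_rev surf d)).
have S_pos p q : dart P (p, q) -> S p q -> 0 < cross p q (third P p q).
  move=> d; case/orP: (d) => /andP[//] /eqP E D.
  rewrite /S; case: (f0_rot E0 D0 E D) => -[/= pe qe te]; rewrite te pe qe.
  - by rewrite eqxx.
  - by rewrite -(srot _ _ _ P0) eqxx.
  - by rewrite (srot _ _ _ (pos_face_cyc (pos_face_cyc P0))) eqxx.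
(* Shoelace terms: [cross] is the sum of [w] over the three darts of a face, and [w] changes sign
   under reversal, so the marked areas cancel in total. *)
pose w p q := X p * Y q - X q * Y p.
pose G p q : R := if S p q then w p q else 0.
have G0 : \sum_(p | dart P p) G p.1 p.2 = 0.
  have : \sum_(p | dart P p) G p.1 p.2 = - \sum_(p | dart P p) G p.1 p.2.
    rewrite {1}(sum_dart_rev surf) -sumrN; apply: eq_bigr => -[p q] d /=.
    by rewrite /G S_rev //; case: ifP; rewrite ?oppr0 // /w => _; ring.
  by move=> h; lra.
have GN F : (forall p q, dart P (p, q) -> F p q = G q (third P p q)) ->
    \sum_(p | dart P p) F p.1 p.2 = 0.
  move=> FE; rewrite -[RHS]G0 [RHS](sum_dart_next surf); apply: eq_bigr => -[p q] d; exact: FE.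
have sum0 : \sum_(p | dart P p) (if S p.1 p.2 then cross p.1 p.2 (third P p.1 p.2) else 0) = 0.
  transitivity (\sum_(p | dart P p) (G p.1 p.2 + G p.2 (third P p.1 p.2)
    + G (third P p.1 p.2) p.1)).
    apply: eq_bigr => -[p q] d /=; have dn := dart_next surf d.
    have := S_next _ _ dn; rewrite /G (third_next surf d) S_next // => ->.
    by case: ifP; rewrite ?addr0 // crossE /w => _; ring.
  rewrite !big_split /= G0 (GN (fun p q => G q (third P p q))) // !add0r.
  transitivity (\sum_(p | dart P p) G p.2 (third P p.1 p.2)); last exact: (GN (fun p q => G q (third P p q))).
  rewrite (sum_dart_next surf (fun p q => G q (third P p q))).
  by apply: eq_bigr => -[p q] d /=; rewrite (third_next surf d).
have dab := face_dart surf Pabc.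
have Sab : S a b by rewrite /S (sE _ _ _ Pabc).
have := S_pos _ _ dab Sab; have : (if S a b then cross a b (third P a b) else 0) = 0.
  apply: (psumr_eq0P _ sum0 (i := (a, b))) => // -[p q] d /=.
  by case: ifP => // /(S_pos _ _ d)/ltW.
by rewrite Sab => ->; rewrite ltxx.
Qed.

Lemma edgesT_edges : edgesT v1 v2 v3 T = [set [set p.1; p.2] | p in dart P].
Proof.
have surf := surface_T.
have tri_dart (a b : V) (t : {set V}) : a != b -> a \in t -> b \in t -> t \in T \/ t = f0 -> dart P (a, b).
  move=> ab at0 bt0 tTF.
  have tt : exists x y w, t = [set x; y; w] /\ cross x y w != 0.
    by case: tTF => [/(T_triangle tri) // | ->]; exists v1, v2, v3.
  have [d [tE D]] := tri_third ab at0 bt0 tt.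
  case: tTF => tTF.
    case: (ltgtP (cross a b d) 0) D => // D _; last by apply: (face_dart surf (c := d)); apply: pos_face_T; rewrite // -tE.
    apply: (dart_rev surf); apply: (face_dart surf (c := d)); apply: pos_face_T.
      by rewrite set3_swap -tE.
    by rewrite cross_swap oppr_gt0.
  case: (ltgtP (cross a b d) 0) D => // D _; first by apply: (face_dart surf (c := d)); apply: pos_face_f0; rewrite // -tE.
  apply: (dart_rev surf); apply: (face_dart surf (c := d)); apply: pos_face_f0.
    by rewrite set3_swap -tE.
  by rewrite cross_swap oppr_lt0.
apply/finset.setP => e; apply/idP/imsetP.
  rewrite inE => /andP[/cards2P[a [b [ab ->]]] et]; exists (a, b) => //.
  case/orP: et => [/exists_inP[t tT] | ]; rewrite finset.subUset !finset.sub1set => /andP[at0 bt0].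
    by apply: (tri_dart a b t) => //; left.
  by apply: (tri_dart a b f0) => //; right.
move=> [[a b] d ->]; rewrite inE cards2 (dart_neq surf d) /=.
case/orP: d => /andP[/= tT _]; apply/orP; [left | right].
  by apply/exists_inP; exists [set a; b; third P a b] => //; rewrite finset.subsetUl.
by rewrite -(eqP tT) finset.subsetUl.
Qed.

End Triangulation.

(** * Derivative of the Bloch-Wigner function *)

Section RealDerivatives.
Local Open Scope classical_set_scope.
Local Open Scope ring_scope.
Variable R : realType.
Implicit Types (x y : R -> R) (t : R).

Lemma is_derive_continuous x t (x' : R) : is_derive t 1 x x' -> {for t, continuous x}.
Proof. by case=> dx _; apply/differentiable_continuous/derivable1_diffP. Qed.

Lemma near_gt0 x t (x' : R) : is_derive t 1 x x' -> 0 < x t -> \forall s \near t, 0 < x s.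
Proof. by move=> /is_derive_continuous xc x0; apply: (cvgr_gt _ xc). Qed.

Lemma near_lt0 x t (x' : R) : is_derive t 1 x x' -> x t < 0 -> \forall s \near t, x s < 0.
Proof. by move=> /is_derive_continuous xc x0; apply: (cvgr_lt _ xc). Qed.

Lemma is_derive_div x y t (x' y' : R) : is_derive t 1 x x' -> is_derive t 1 y y' -> y t != 0 ->
  is_derive t 1 (fun s => x s / y s) ((x' * y t - x t * y') / y t ^+ 2).
Proof.
move=> dx dy y0; have dV := is_deriveV y0 dy.
apply: is_derive_eq.
rewrite -![_ *: _]/(_ * _); by field.
Qed.

Lemma is_derive_atan_div x y t (x' y' : R) : is_derive t 1 x x' -> is_derive t 1 y y' ->
  y t != 0 -> is_derive t 1 (fun s => atan (x s / y s))
    ((x' * y t - x t * y') / (x t ^+ 2 + y t ^+ 2)).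
Proof.
move=> dx dy y0; have dd := is_derive_div dx dy y0.
have da := @is_derive1_comp _ atan (fun s => x s / y s) _ _ _ (is_derive1_atan _) dd.
apply: (is_derive_eq da).
have q0 : x t ^+ 2 + y t ^+ 2 != 0.
  by rewrite gt_eqF // ltr_wpDl ?sqr_ge0 // exprn_even_gt0.
by field; rewrite q0 y0.
Qed.

Lemma atan_inv (u : R) : 0 < u -> atan u^-1 = pi / 2 - atan u.
Proof.
move=> u0; have a0 : 0 < atan u by rewrite -atan0 lt_atan.
have ap := atan_ltpi2 u.
rewrite -[RHS]tanK; last by rewrite in_itv /=; apply/andP; split; lra.
congr atan; rewrite -{1}[u]atanK /tan -opprB.
rewrite cosN sinN cosBpihalf sinBpihalf opprK invf_div //.
Qed.

(** One smooth formula on the whole upper half-plane, including the imaginary axis where the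
    definition of [Arg] switches branches. *)
Lemma Arg_gt0 (a b : R) : 0 < b -> Arg (Complex a b) = pi / 2 - atan (a / b).
Proof.
move=> b0; rewrite /Arg /=; case: (ltgtP a 0) => [a0|a0|->].
- rewrite (ltW b0).
  have na0 : 0 < - a / b by rewrite divr_gt0 // oppr_gt0.
  have := atan_inv na0; rewrite invf_div mulNr atanN.
  rewrite (_ : b / - a = - (b / a)) ?atanN; last by rewrite invrN mulrN.
  have : (pi : R) = pi / 2 + pi / 2 by lra.
  lra.
- by rewrite -[b / a]invf_div atan_inv // divr_gt0.
by rewrite b0 mul0r atan0 subr0.
Qed.

Lemma Arg_lt0 (a b : R) : b < 0 -> Arg (Complex a b) = - (pi / 2) - atan (a / b).
Proof.
move=> b0; have nb0 : 0 < - b by rewrite oppr_gt0.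
have b0F : (0 <= b) = false by rewrite leNgt b0.
have := Arg_gt0 a nb0; rewrite /Arg /= b0 b0F nb0 (ltW nb0) (lt_gtF b0).
rewrite mulNr invrN mulrN !atanN; case: (ltgtP a 0) => a0; lra.
Qed.

Lemma is_derive_Arg x y t (x' y' : R) : is_derive t 1 x x' -> is_derive t 1 y y' ->
  0 < x t \/ y t != 0 -> is_derive t 1 (fun s => Arg (Complex (x s) (y s)))
    ((x t * y' - x' * y t) / (x t ^+ 2 + y t ^+ 2)).
Proof.
move=> dx dy; have [x0 _|x0] := ltP 0 (x t).
  apply: (@near_eq_is_derive _ _ _ (fun s => atan (y s / x s))).
    near=> s; rewrite /Arg /=; have -> // : 0 < x s.
    by near: s; exact: near_gt0 dx x0.
  by apply: (is_derive_eq (is_derive_atan_div dy dx (lt0r_neq0 x0))); congr (_ / _); ring.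
case=> [//|y0].
have [yn|yp|] := ltgtP (y t) 0; last by move/eqP: y0.
- apply: (@near_eq_is_derive _ _ _ (fun s => - (pi / 2) - atan (x s / y s))).
    by near=> s; rewrite Arg_lt0 //; near: s; exact: near_lt0 dy yn.
  have da := is_deriveB (is_derive_cst (- (pi / 2)) t 1) (is_derive_atan_div dx dy y0).
  by apply: (is_derive_eq da); rewrite sub0r -mulNr opprB.
- apply: (@near_eq_is_derive _ _ _ (fun s => pi / 2 - atan (x s / y s))).
    by near=> s; rewrite Arg_gt0 //; near: s; exact: near_gt0 dy yp.
  have da := is_deriveB (is_derive_cst (pi / 2) t 1) (is_derive_atan_div dx dy y0).
  by apply: (is_derive_eq da); rewrite sub0r -mulNr opprB.
Unshelve. all: by end_near. Qed.

Lemma is_derive_lnmod x y t (x' y' : R) : is_derive t 1 x x' -> is_derive t 1 y y' ->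
  x t != 0 \/ y t != 0 -> is_derive t 1 (fun s => ln (modC (Complex (x s) (y s))))
    ((x t * x' + y t * y') / (x t ^+ 2 + y t ^+ 2)).
Proof.
move=> dx dy xy0.
have q0 : 0 < x t ^+ 2 + y t ^+ 2.
  case: xy0 => h; first by rewrite ltr_pwDl ?sqr_ge0 // exprn_even_gt0.
  by rewrite ltr_wpDl ?sqr_ge0 // exprn_even_gt0.
have dq : is_derive t 1 (fun s => x s ^+ 2 + y s ^+ 2) (2%:R * (x t * x' + y t * y')).
  by apply: is_derive_eq; rewrite -![_ *: _]/(_ * _) /=; ring.
have ds := @is_derive1_comp _ Num.sqrt (fun s => x s ^+ 2 + y s ^+ 2) _ _ _ (is_derive1_sqrt q0) dq.
have sq0 : 0 < Num.sqrt (x t ^+ 2 + y t ^+ 2) by rewrite sqrtr_gt0.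
have dl := @is_derive1_comp _ (@ln R) (Num.sqrt \o (fun s => x s ^+ 2 + y s ^+ 2)) _ _ _
  (is_derive1_ln sq0) ds.
apply: (is_derive_eq dl).
rewrite /=; have := sqr_sqrtr (ltW q0); move: (Num.sqrt _) => r rq.
rewrite -rq; have r0 : r != 0 by apply: contraTneq q0 => r0; rewrite -rq r0 expr0n ltxx.
by field.
Qed.

End RealDerivatives.

(** * Differentiating the dilogarithm integral *)

Section BlochWigner.
Local Open Scope classical_set_scope.
Local Open Scope ring_scope.
Variable R : realType.
Local Notation mu := (@lebesgue_measure R).

(* The integrand of [ImLi2], with its limit value at [s = 0]. *)
Definition li_kernel (a b s : R) : R :=
  if s == 0 then - b else Arg (Complex (1 - s * a) (- (s * b))) / s.

Lemma is_derive_Arg_ray (a b s : R) : b != 0 ->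
  is_derive s 1 (fun s => Arg (Complex (1 - s * a) (- (s * b))))
    (- b / ((1 - s * a) ^+ 2 + (s * b) ^+ 2)).
Proof.
move=> b0.
have dx : is_derive s 1 (fun s => 1 - s * a) (- a).
  by apply: is_derive_eq; rewrite -![_ *: _]/(_ * _) /=; ring.
have dy : is_derive s 1 (fun s => - (s * b)) (- b).
  by apply: is_derive_eq; rewrite -![_ *: _]/(_ * _) /=; ring.
have pos : 0 < 1 - s * a \/ - (s * b) != 0.
  have [->|s0] := eqVneq s 0; first by left; rewrite mul0r subr0.
  by right; rewrite oppr_eq0 mulf_neq0.
apply: (is_derive_eq (is_derive_Arg dx dy pos)); rewrite sqrrN; congr (_ / _); ring.
Qed.

Lemma Arg1 : Arg (Complex (1 : R) 0) = 0.
Proof. by rewrite /Arg /= ltr01 mul0r atan0. Qed.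

(** At 0 the kernel is the difference quotient of [Arg] along the ray 1 - s w, whose derivative
    there is [- b]. *)
Lemma li_kernel_continuous (a b : R) : b != 0 -> continuous (li_kernel a b).
Proof.
move=> b0 s; have [->|s0] := eqVneq s 0.
  apply/continuous_withinNx; rewrite /li_kernel eqxx.
  have [dv de] := is_derive_Arg_ray a 0 b0.
  rewrite !mul0r subr0 expr1n expr0n addr0 divr1 in de; rewrite -de.
  apply: cvg_trans dv; apply: near_eq_cvg; near=> h.
  have h0 : h != 0 by near: h; exact: nbhs_dnbhs_neq.
  rewrite /= (negbTE h0) addr0 !mul0r subr0 oppr0 Arg1 subr0.
  by rewrite -[_ *: _]/(_ * _) mulrC -[h%:A]/(h * 1) mulr1.
have dq := is_derive_div (is_derive_Arg_ray a s b0) (is_derive_id s 1) s0.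
apply: is_derive_continuous; apply: near_eq_is_derive dq.
near=> t; rewrite /li_kernel; have /negbTE-> // : t != 0.
by near: t; exact: open_neq.
Unshelve. all: by end_near. Qed.

Lemma is_derive_li_kernel (x y : R -> R) (s t x' y' : R) :
  is_derive t 1 x x' -> is_derive t 1 y y' -> y t != 0 ->
  is_derive t 1 (fun t => li_kernel (x t) (y t) s)
    (- ((x' * (s * y t) + y' * (1 - s * x t)) / ((1 - s * x t) ^+ 2 + (s * y t) ^+ 2))).
Proof.
move=> dx dy y0; have [->|s0] := eqVneq s 0.
  rewrite /li_kernel eqxx; apply: is_derive_eq.
  by rewrite !mul0r mulr0 add0r subr0 expr1n expr0n addr0 divr1 mulr1.
rewrite /li_kernel (negbTE s0).
have dx1 : is_derive t 1 (fun t => 1 - s * x t) (- (s * x')).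
  by apply: is_derive_eq; rewrite -![_ *: _]/(_ * _) /=; ring.
have dy1 : is_derive t 1 (fun t => - (s * y t)) (- (s * y')).
  by apply: is_derive_eq; rewrite -![_ *: _]/(_ * _) /=; ring.
have y1 : 0 < 1 - s * x t \/ - (s * y t) != 0.
  by right; rewrite oppr_eq0 mulf_neq0.
have dA := is_derive_Arg dx1 dy1 y1.
have q0 : (1 - s * x t) ^+ 2 + (s * y t) ^+ 2 != 0.
  by rewrite gt_eqF // ltr_wpDl ?sqr_ge0 // exprn_even_gt0 //= mulf_neq0.
apply: is_derive_eq; rewrite -![_ *: _]/(_ * _) /= sqrrN.
by field; rewrite q0 s0.
Qed.

(* Cauchy-Schwarz, and [|1 - s w| |w| >= |Im w|] with [w = a + i b]. *)
Lemma sqr_bound (p q a b s : R) : b != 0 ->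
  ((p * (s * b) + q * (1 - s * a)) / ((1 - s * a) ^+ 2 + (s * b) ^+ 2)) ^+ 2
  <= (p ^+ 2 + q ^+ 2) * (a ^+ 2 + b ^+ 2) / b ^+ 2.
Proof.
move=> b0; set D := (1 - s * a) ^+ 2 + (s * b) ^+ 2.
have b2 : 0 < b ^+ 2 by rewrite exprn_even_gt0.
have DN : b ^+ 2 <= D * (a ^+ 2 + b ^+ 2).
  rewrite -subr_ge0 (_ : _ - _ = (s * (a ^+ 2 + b ^+ 2) - a) ^+ 2) ?sqr_ge0 //.
  by rewrite /D; ring.
have D0 : 0 < D by have := sqr_ge0 a; nra.
have CS : (p * (s * b) + q * (1 - s * a)) ^+ 2 <= (p ^+ 2 + q ^+ 2) * D.
  rewrite -subr_ge0 (_ : _ - _ = (p * (1 - s * a) - q * (s * b)) ^+ 2) ?sqr_ge0 //.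
  by rewrite /D; ring.
rewrite expr_div_n ler_pdivlMr // mulrAC ler_pdivrMr ?exprn_gt0 //.
set N := (_ + _) ^+ 2 in CS *; set E := p ^+ 2 + q ^+ 2 in CS *.
have E0 : 0 <= E by rewrite addr_ge0 ?sqr_ge0.
have -> : E * (a ^+ 2 + b ^+ 2) * D ^+ 2 = E * D * (D * (a ^+ 2 + b ^+ 2)) by ring.
apply: ler_pM => //; [exact: sqr_ge0 | exact: ltW].
Qed.

Lemma li_kernel_integrable (a b : R) : b != 0 ->
  mu.-integrable `[0%R, 1%R] (EFin \o li_kernel a b).
Proof.
move=> b0; apply: continuous_compact_integrable; first exact: segment_compact.
by apply: continuous_subspaceT => s; exact: li_kernel_continuous.
Qed.

(** The two integrands differ at most at 0, which is removed by passing to the half-open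
    interval. *)
Lemma ImLi2E (a b : R) : b != 0 ->
  ImLi2 (Complex a b) = - Rintegral mu `[0%R, 1%R] (li_kernel a b).
Proof.
move=> b0; rewrite /ImLi2; congr (- _).
have intK := li_kernel_integrable a b0.
have sub : (`]0%R, 1%R]%classic : set R) `<=` `[0%R, 1%R]%classic by apply: subset_itv; rewrite bnd_simp.
have intK' : mu.-integrable `]0%R, 1%R] (EFin \o li_kernel a b).
  by apply: (@integrableS _ _ _ mu `[0%R, 1%R]%classic) => //.
have eqK s : s \in `]0%R, 1%R]%classic ->
    li_kernel a b s = Arg (1 - cR s * Complex a b) / s.
  rewrite inE /= in_itv /= => /andP[s0 _]; rewrite /li_kernel gt_eqF //.
  congr (Arg _ / _); apply/eqP; rewrite eq_complex /=.
  by rewrite !mul0r subr0 addr0 sub0r !eqxx.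
rewrite -[RHS]Rintegral_itv_obnd_cbnd // -[LHS]Rintegral_itv_obnd_cbnd.
  by apply: eq_Rintegral => s sI; exact/esym/eqK.
by apply: eq_integrable intK' => // s sI; rewrite /= eqK.
Qed.

(** With w = a + i b and w' = p + i q, the primitive [G s] is the imaginary part of (w'/w) Log(1 - s
    w), which vanishes at 0. *)
Lemma Rintegral_li_kernel_der (p q a b : R) : b != 0 ->
  Rintegral mu `[0%R, 1%R]
    (fun s => - ((p * (s * b) + q * (1 - s * a)) / ((1 - s * a) ^+ 2 + (s * b) ^+ 2)))
  = ((p * a + q * b) * Arg (Complex (1 - a) (- b))
     + (q * a - p * b) * ln (modC (Complex (1 - a) (- b)))) / (a ^+ 2 + b ^+ 2).
Proof.
move=> b0.
pose m := a ^+ 2 + b ^+ 2.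
have m0 : m != 0 by rewrite gt_eqF // ltr_wpDl ?sqr_ge0 // exprn_even_gt0.
have D0 s : (1 - s * a) ^+ 2 + (s * b) ^+ 2 != 0.
  have [->|s0] := eqVneq s 0; first by rewrite !mul0r subr0 expr1n expr0n addr0 oner_neq0.
  by rewrite gt_eqF // ltr_wpDl ?sqr_ge0 // exprn_even_gt0 //= mulf_neq0.
pose G s := ((p * a + q * b) * Arg (Complex (1 - s * a) (- (s * b)))
     + (q * a - p * b) * ln (modC (Complex (1 - s * a) (- (s * b))))) / m.
pose g s := - ((p * (s * b) + q * (1 - s * a)) / ((1 - s * a) ^+ 2 + (s * b) ^+ 2)).
have dx (s : R) : is_derive s 1 (fun s => 1 - s * a) (- a).
  by apply: is_derive_eq; rewrite -![_ *: _]/(_ * _) /=; ring.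
have dy (s : R) : is_derive s 1 (fun s => - (s * b)) (- b).
  by apply: is_derive_eq; rewrite -![_ *: _]/(_ * _) /=; ring.
have dG (s : R) : is_derive s 1 G (g s).
  have dA := is_derive_Arg_ray a s b0.
  have nz : 1 - s * a != 0 \/ - (s * b) != 0.
    have [->|s0] := eqVneq s 0; first by left; rewrite mul0r subr0 oner_neq0.
    by right; rewrite oppr_eq0 mulf_neq0.
  have dL := is_derive_lnmod (dx s) (dy s) nz.
  apply: is_derive_eq; rewrite -![_ *: _]/(_ * _) /= sqrrN /g /m.
  by field; rewrite D0 m0.
have gc : continuous g.
  move=> s; have -> : g = fun s => - (p * (s * b) + q * (1 - s * a)) /
      ((1 - s * a) ^+ 2 + (s * b) ^+ 2) by apply/funext => r; rewrite /g mulNr.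
  have dn : is_derive s 1 (fun s => - (p * (s * b) + q * (1 - s * a))) (- (p * b - q * a)).
    by apply: is_derive_eq; rewrite -![_ *: _]/(_ * _) /=; ring.
  have dd : is_derive s 1 (fun s => (1 - s * a) ^+ 2 + (s * b) ^+ 2)
      (2%:R * ((1 - s * a) * - a) + 2%:R * (s * b * b)).
    by apply: is_derive_eq; rewrite -![_ *: _]/(_ * _) /=; ring.
  exact: is_derive_continuous (is_derive_div dn dd (D0 s)).
have Gc : continuous G by move=> s; exact: is_derive_continuous (dG s).
rewrite /Rintegral (@continuous_FTC2 R g G 0 1) ?ltr01 //.
- have l0 : ln (modC (Complex (1 : R) 0)) = 0.
    by rewrite /modC /= expr1n expr0n /= addr0 sqrtr1 ln1.
  by rewrite /= /G !mul1r !mul0r subr0 oppr0 Arg1 l0 !mulr0 addr0 mul0r subr0.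
- exact: continuous_subspaceT.
- split.
  + by move=> s _; have [] := dG s.
  + exact/cvg_at_right_filter/Gc.
  + exact/cvg_at_left_filter/Gc.
- by move=> s _; rewrite derive1E; have [_ ->] := dG s.
Qed.

Lemma near_open_itv (t : R) (Q : R -> Prop) : (\forall s \near t, Q s) ->
  exists u v, u < t < v /\ forall s, s \in `]u, v[ -> Q s.
Proof.
move=> /nbhs_ballP[e /= e0 H]; exists (t - e), (t + e); split.
  by rewrite ltrBlDr !ltrDl e0.
move=> s; rewrite in_itv /= => /andP[s1 s2]; apply: H.
by rewrite /ball /= ltr_norml; apply/andP; split; lra.
Qed.

Lemma is_derive_ImLi2 (x y x' y' : R -> R) (t : R) :
  (\forall s \near t, is_derive (s : R) 1 x (x' s)) ->
  (\forall s \near t, is_derive (s : R) 1 y (y' s)) ->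
  {for t, continuous x'} -> {for t, continuous y'} -> y t != 0 ->
  is_derive t 1 (fun s => ImLi2 (Complex (x s) (y s)))
   (- (((x' t * x t + y' t * y t) * Arg (Complex (1 - x t) (- y t))
     + (y' t * x t - x' t * y t) * ln (modC (Complex (1 - x t) (- y t)))) / (x t ^+ 2 + y t ^+ 2))).
Proof.
move=> dx dy x'c y'c y0.
have xc := is_derive_continuous (nbhs_singleton dx).
have yc := is_derive_continuous (nbhs_singleton dy).
(* Near [t], [A] and [B] bound the squared moduli of w' and w, and [c] bounds the squared imaginary
   part of w from below. By [sqr_bound] the squared derivative of the kernel is then at most A B /
   c, and the dominating constant [M], equal to 1 + A B / c, has a larger square. *)
pose A := x' t ^+ 2 + y' t ^+ 2 + 1; pose B := x t ^+ 2 + y t ^+ 2 + 1.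
pose c := y t ^+ 2 / 2%:R.
have y2 : 0 < y t ^+ 2 by rewrite exprn_even_gt0.
have c0 : 0 < c by rewrite divr_gt0.
have sqc (f : R -> R) : {for t, continuous f} -> {for t, continuous (fun s => f s ^+ 2)}.
  by move=> fc; exact: (cvgM fc fc).
have [u [v [/andP[ut tv] uvP]]] : exists u v, u < t < v /\ forall s, s \in `]u, v[ ->
  [/\ is_derive s 1 x (x' s), is_derive s 1 y (y' s),
      x' s ^+ 2 + y' s ^+ 2 < A, x s ^+ 2 + y s ^+ 2 < B & c < y s ^+ 2].
  apply: near_open_itv; near=> s; split.
  - by near: s; exact: dx.
  - by near: s; exact: dy.
  - near: s; apply: (@cvgr_lt _ _ _ _ (fun s => x' s ^+ 2 + y' s ^+ 2)).
      exact: (cvgD (sqc _ x'c) (sqc _ y'c)).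
    by rewrite /A ltrDl.
  - near: s; apply: (@cvgr_lt _ _ _ _ (fun s => x s ^+ 2 + y s ^+ 2)).
      exact: (cvgD (sqc _ xc) (sqc _ yc)).
    by rewrite /B ltrDl.
  - near: s; apply: (@cvgr_gt _ _ _ _ (fun s => y s ^+ 2)); first exact: sqc.
    by rewrite /c; lra.
have ys s : s \in `]u, v[ -> y s != 0.
  by case/uvP => _ _ _ _ cy; rewrite -sqrf_eq0 gt_eqF // (lt_trans c0).
have A0 : 0 < A by rewrite /A; have := sqr_ge0 (x' t); have := sqr_ge0 (y' t); lra.
have B0 : 0 < B by rewrite /B; have := sqr_ge0 (x t); have := sqr_ge0 (y t); lra.
pose M := 1 + A * B / c.
have K0 : 0 <= A * B / c by rewrite ltW // divr_gt0 // mulr_gt0.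
have M0 : 0 <= M by rewrite /M; lra.
pose f s r := li_kernel (x s) (y s) r.
have df s r : s \in `]u, v[ -> is_derive s 1 (f ^~ r)
    (- ((x' s * (r * y s) + y' s * (1 - r * x s)) / ((1 - r * x s) ^+ 2 + (r * y s) ^+ 2))).
  by move=> suv; have [dxs dys _ _ _] := uvP s suv; apply: is_derive_li_kernel => //; exact: ys.
have tuv : t \in `]u, v[ by rewrite in_itv /= ut tv.
have d1f s r : s \in `]u, v[ -> partial1of2 f s r =
    - ((x' s * (r * y s) + y' s * (1 - r * x s)) / ((1 - r * x s) ^+ 2 + (r * y s) ^+ 2)).
  by move=> suv; rewrite partial1of2E; have [_ ->] := df s r suv.
have mI : measurable (`[0%R, 1%R]%classic : set R) by exact: measurable_itv.
have Itv : `]u, v[%classic t by [].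
have intf s : `]u, v[%classic s -> mu.-integrable `[0%R, 1%R] (EFin \o f s).
  by move=> suv; apply: li_kernel_integrable; exact: ys.
have derf s r : `]u, v[%classic s -> `[0%R, 1%R]%classic r -> derivable (f ^~ r) s 1.
  by move=> suv _; have [] := df s r suv.
have intM : mu.-integrable `[0%R, 1%R] (EFin \o (fun=> M)).
  apply: continuous_compact_integrable; first exact: segment_compact.
  by apply: continuous_subspaceT => s; exact: cvg_cst.
have ubM s r : `]u, v[%classic s -> `[0%R, 1%R]%classic r -> `|partial1of2 f s r| <= M.
  move=> suv _; rewrite d1f // normrN.
  have [_ _ xA xB yC] := uvP s suv.
  rewrite -ler_sqr ?nnegrE // real_normK ?num_real //.
  apply: le_trans (sqr_bound _ _ _ _ (ys s suv)) _.
  apply: (@le_trans _ _ (A * B / c)).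
    rewrite ler_pM ?mulr_ge0 ?addr_ge0 ?sqr_ge0 ?invr_ge0 ?sqr_ge0 //.
      by rewrite ler_pM ?addr_ge0 ?sqr_ge0 // ltW.
    by rewrite lef_pV2 ?posrE ?ltW // (lt_trans c0).
  by rewrite /M; nra.
have dF := @derivable_under_integral R _ _ mu f _ mI t u v Itv intf derf _ (fun=> M0) intM ubM.
have dFE := @differentiation_under_integral R _ _ mu f _ mI t u v Itv intf derf _ (fun=> M0) intM ubM.
have isF : is_derive t 1 (fun s => Rintegral mu `[0%R, 1%R] (f s))
   (((x' t * x t + y' t * y t) * Arg (Complex (1 - x t) (- y t))
     + (y' t * x t - x' t * y t) * ln (modC (Complex (1 - x t) (- y t)))) / (x t ^+ 2 + y t ^+ 2)).
  apply: DeriveDef => //; rewrite -derive1E dFE -Rintegral_li_kernel_der //.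
  by apply: eq_Rintegral => r _; rewrite d1f.
apply: (@near_eq_is_derive _ _ _ (fun s => - Rintegral mu `[0%R, 1%R] (f s))).
  near=> s; rewrite ImLi2E //; apply: ys; near: s; exact: near_in_itvoo.
Unshelve. all: by end_near. Qed.

(** The differential ln|w| d arg(1 - w) - ln|1 - w| d arg w at w = a + i b in the direction p + i q.
    The terms of the derivative containing [Arg] cancel between the two summands of
    [BlochWigner]. *)
Definition BW_der (p q a b : R) : R :=
  - (ln (modC (Complex a b)) * (((1 - a) * q + p * b) / ((1 - a) ^+ 2 + b ^+ 2))
     + ln (modC (Complex (1 - a) (- b))) * ((a * q - p * b) / (a ^+ 2 + b ^+ 2))).

Lemma is_derive_BlochWigner (x y x' y' : R -> R) (t : R) :
  (\forall s \near t, is_derive (s : R) 1 x (x' s)) ->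
  (\forall s \near t, is_derive (s : R) 1 y (y' s)) ->
  {for t, continuous x'} -> {for t, continuous y'} -> y t != 0 ->
  is_derive t 1 (fun s => BlochWigner (Complex (x s) (y s)))
    (BW_der (x' t) (y' t) (x t) (y t)).
Proof.
move=> dx dy x'c y'c y0.
have dxt := nbhs_singleton dx; have dyt := nbhs_singleton dy.
have dI := is_derive_ImLi2 dx dy x'c y'c y0.
have dl := is_derive_lnmod dxt dyt (or_intror y0).
have dx1 : is_derive t 1 (fun s => 1 - x s) (- x' t).
  by have := is_deriveB (is_derive_cst (1 : R) t 1) dxt; rewrite sub0r.
have dy1 : is_derive t 1 (fun s => - y s) (- y' t) by exact: is_deriveN.
have ny0 : - y t != 0 by rewrite oppr_eq0.
have dA := is_derive_Arg dx1 dy1 (or_intror ny0).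
have E s : 1 - Complex (x s) (y s) = Complex (1 - x s) (- y s).
  by apply/eqP; rewrite eq_complex /= sub0r !eqxx.
rewrite /BlochWigner; under eq_fun do rewrite E.
have q1 : x t ^+ 2 + y t ^+ 2 != 0 by rewrite gt_eqF // ltr_wpDl ?sqr_ge0 // exprn_even_gt0.
have q2 : (1 - x t) ^+ 2 + y t ^+ 2 != 0 by rewrite gt_eqF // ltr_wpDl ?sqr_ge0 // exprn_even_gt0.
apply: is_derive_eq; rewrite /BW_der -![_ *: _]/(_ * _) /= sqrrN.
set L := ln _; set L' := ln _; set Ag := Arg _.
by field; rewrite q1 q2.
Qed.

End BlochWigner.

(** * Wirtinger derivatives of angles and volumes *)

Section ComplexParts.
Variable R : realType.
Local Notation C := R[i].
Local Notation Re := (@complex.Re R).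
Local Notation Im := (@complex.Im R).
Implicit Types a b : C.

Lemma cReD a b : Re (a + b) = Re a + Re b. Proof. by case: a b => ? ? [? ?]. Qed.
Lemma cImD a b : Im (a + b) = Im a + Im b. Proof. by case: a b => ? ? [? ?]. Qed.
Lemma cReN a : Re (- a) = - Re a. Proof. by case: a. Qed.
Lemma cImN a : Im (- a) = - Im a. Proof. by case: a. Qed.
Lemma cReB a b : Re (a - b) = Re a - Re b. Proof. by rewrite cReD cReN. Qed.
Lemma cImB a b : Im (a - b) = Im a - Im b. Proof. by rewrite cImD cImN. Qed.
Lemma cReM a b : Re (a * b) = Re a * Re b - Im a * Im b. Proof. by case: a b => ? ? [? ?]. Qed.
Lemma cImM a b : Im (a * b) = Re a * Im b + Im a * Re b. Proof. by case: a b => ? ? [? ?]. Qed.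
Lemma cReV a : Re a^-1 = Re a / (Re a ^+ 2 + Im a ^+ 2). Proof. by case: a. Qed.
Lemma cImV a : Im a^-1 = - (Im a / (Re a ^+ 2 + Im a ^+ 2)). Proof. by case: a. Qed.
Lemma cRe_conj a : Re (conjc a) = Re a. Proof. by case: a. Qed.
Lemma cIm_conj a : Im (conjc a) = - Im a. Proof. by case: a. Qed.

Lemma conjc_add a b : conjc (a + b) = conjc a + conjc b. Proof. exact: rmorphD. Qed.
Lemma conjc_opp a : conjc (- a) = - conjc a. Proof. exact: rmorphN. Qed.
Lemma conjc_mul a b : conjc (a * b) = conjc a * conjc b. Proof. exact: rmorphM. Qed.

Lemma complex_ext a b : Re a = Re b -> Im a = Im b -> a = b.
Proof. by case: a b => ? ? [? ?] /= -> ->. Qed.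

Lemma complex_eta a : Complex (Re a) (Im a) = a. Proof. by case: a. Qed.

Lemma sqr_Re_Im_neq0 a : a != 0 -> Re a ^+ 2 + Im a ^+ 2 != 0.
Proof.
case: a => x y; rewrite eq_complex /= negb_and => /orP[] h; rewrite gt_eqF //.
  by rewrite ltr_pwDl ?sqr_ge0 // exprn_even_gt0.
by rewrite ltr_wpDl ?sqr_ge0 // exprn_even_gt0.
Qed.

Lemma Re_or_Im_neq0 a : a != 0 -> Re a != 0 \/ Im a != 0.
Proof. by case: a => x y; rewrite eq_complex /= negb_and => /orP. Qed.

Lemma cIm_div a b : b != 0 -> Im (a / b) = (Re b * Im a - Re a * Im b) / (Re b ^+ 2 + Im b ^+ 2).
Proof.
move=> /sqr_Re_Im_neq0 q0; rewrite cImM cReV cImV; by field.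
Qed.

Lemma cRe_div a b : b != 0 -> Re (a / b) = (Re b * Re a + Im b * Im a) / (Re b ^+ 2 + Im b ^+ 2).
Proof.
move=> /sqr_Re_Im_neq0 q0; rewrite cReM cReV cImV; by field.
Qed.

Lemma ln_modC_div a b : a != 0 -> b != 0 ->
  ln (modC (a / b)) = ln (modC a) - ln (modC b).
Proof.
have E (w : C) : modC w = ComplexField.Normc.normc w by case: w.
move=> a0 b0; rewrite !E ComplexField.Normc.normcM ComplexField.Normc.normcV.
have pos (w : C) : w != 0 -> 0 < ComplexField.Normc.normc w.
  move=> w0; rewrite lt_def; apply/andP; split; last by case: (w) => ? ?; exact: sqrtr_ge0.
  by apply: contra w0 => /eqP/ComplexField.Normc.eq0_normc ->.
by rewrite ln_div ?posrE ?pos.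
Qed.

End ComplexParts.

(** * Calculus of complex-valued curves *)

Section ComplexCurves.
Local Open Scope classical_set_scope.
Local Open Scope ring_scope.
Variable R : realType.
Local Notation C := R[i].
Local Notation Re := (@complex.Re R).
Local Notation Im := (@complex.Im R).
Implicit Types (f g : R -> C) (t : R) (d e : C).

(** Taken componentwise in a real parameter; for perturbations of one point in every complex
    direction such derivatives determine both Wirtinger derivatives, by [dz_cderiv] and
    [dzb_cderiv]. *)
Definition cderiv f t d : Prop :=
  is_derive t 1 (fun s => Re (f s)) (Re d) /\ is_derive t 1 (fun s => Im (f s)) (Im d).

Lemma cderiv_eq f t d d' : cderiv f t d -> d = d' -> cderiv f t d'.
Proof. by move=> ? <-. Qed.

Lemma near_cderiv f g t d : (\forall s \near t, f s = g s) -> cderiv f t d -> cderiv g t d.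
Proof.
move=> fg [dr di]; split.
  by apply: near_eq_is_derive dr; near=> s; congr Re; near: s.
by apply: near_eq_is_derive di; near=> s; congr Im; near: s.
Unshelve. all: by end_near. Qed.

Lemma cderiv_cst (c : C) t : cderiv (fun=> c) t 0.
Proof. by split; exact: is_derive_cst. Qed.

Lemma cderivD f g t d e : cderiv f t d -> cderiv g t e -> cderiv (fun s => f s + g s) t (d + e).
Proof.
move=> [fr fi] [gr gi]; split.
  by rewrite cReD; under eq_fun do rewrite cReD; exact: is_deriveD.
by rewrite cImD; under eq_fun do rewrite cImD; exact: is_deriveD.
Qed.

Lemma cderivN f t d : cderiv f t d -> cderiv (fun s => - f s) t (- d).
Proof.
move=> [fr fi]; split.
  by rewrite cReN; under eq_fun do rewrite cReN; exact: is_deriveN.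
by rewrite cImN; under eq_fun do rewrite cImN; exact: is_deriveN.
Qed.

Lemma cderivB f g t d e : cderiv f t d -> cderiv g t e -> cderiv (fun s => f s - g s) t (d - e).
Proof. by move=> df /cderivN; exact: cderivD. Qed.

Lemma cderivM f g t d e : cderiv f t d -> cderiv g t e ->
  cderiv (fun s => f s * g s) t (d * g t + f t * e).
Proof.
move=> [fr fi] [gr gi]; split.
  rewrite cReD !cReM; under eq_fun do rewrite cReM.
  by apply: is_derive_eq; rewrite -![_ *: _]/(_ * _); ring.
rewrite cImD !cImM; under eq_fun do rewrite cImM.
by apply: is_derive_eq; rewrite -![_ *: _]/(_ * _); ring.
Qed.

Lemma cderiv_conj f t d : cderiv f t d -> cderiv (fun s => conjc (f s)) t (conjc d).
Proof.
move=> [fr fi]; split.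
  by rewrite cRe_conj; under eq_fun do rewrite cRe_conj.
by rewrite cIm_conj; under eq_fun do rewrite cIm_conj; exact: is_deriveN.
Qed.

Lemma cderiv_real (h : R -> R) t (h' : R) : is_derive t 1 h h' -> cderiv (fun s => cR (h s)) t (cR h').
Proof. by move=> dh; split => //; exact: is_derive_cst. Qed.

Lemma cderivV f t d : cderiv f t d -> f t != 0 -> cderiv (fun s => (f s)^-1) t (- (d / (f t * f t))).
Proof.
move=> [fr fi] f0; have q0 := sqr_Re_Im_neq0 f0.
have dq : is_derive t 1 (fun s => Re (f s) ^+ 2 + Im (f s) ^+ 2)
    (2%:R * (Re (f t) * Re d + Im (f t) * Im d)).
  by apply: is_derive_eq; rewrite -![_ *: _]/(_ * _) /=; ring.
have ff0 : f t * f t != 0 by rewrite mulf_neq0.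
split.
  under eq_fun do rewrite cReV; apply: (is_derive_eq (is_derive_div fr dq q0)).
  rewrite cReN cRe_div // cReM cImM.
  have -> : (Re (f t) * Re (f t) - Im (f t) * Im (f t)) ^+ 2 +
    (Re (f t) * Im (f t) + Im (f t) * Re (f t)) ^+ 2 =
    (Re (f t) ^+ 2 + Im (f t) ^+ 2) ^+ 2 by ring.
  by rewrite -[RHS]mulNr; congr (_ / _); ring.
under eq_fun do rewrite cImV; apply: (is_derive_eq (is_deriveN (is_derive_div fi dq q0))).
rewrite cImN cIm_div // cReM cImM.
have -> : (Re (f t) * Re (f t) - Im (f t) * Im (f t)) ^+ 2 +
  (Re (f t) * Im (f t) + Im (f t) * Re (f t)) ^+ 2 =
  (Re (f t) ^+ 2 + Im (f t) ^+ 2) ^+ 2 by ring.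
by congr (- (_ / _)); ring.
Qed.

Lemma cderiv_div f g t d e : cderiv f t d -> cderiv g t e -> g t != 0 ->
  cderiv (fun s => f s / g s) t ((d * g t - f t * e) / (g t * g t)).
Proof.
move=> df dg g0; apply: (cderiv_eq (cderivM df (cderivV dg g0))).
by field.
Qed.

Lemma cderiv_sum (I : Type) (r : seq I) (Q : pred I) (F : I -> R -> C) t (D : I -> C) :
  (forall i, Q i -> cderiv (F i) t (D i)) ->
  cderiv (fun s => \sum_(i <- r | Q i) F i s) t (\sum_(i <- r | Q i) D i).
Proof.
move=> H; elim: r => [|i r IH].
  by rewrite big_nil; under [X in cderiv X]funext do rewrite big_nil; exact: cderiv_cst.
rewrite big_cons; under [X in cderiv X]funext do rewrite big_cons.
by case: ifP => // Qi; apply: cderivD => //; exact: H.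
Qed.

Lemma cderiv_continuous f t d : cderiv f t d ->
  {for t, continuous (fun s => Re (f s))} /\ {for t, continuous (fun s => Im (f s))}.
Proof. by case=> fr fi; split; exact: is_derive_continuous. Qed.

Lemma near_neq0 f t d : cderiv f t d -> f t != 0 -> \forall s \near t, f s != 0.
Proof.
move=> [fr fi] /Re_or_Im_neq0 ft0.
have aux (h : R -> R) (h' : R) : is_derive t 1 h h' -> h t != 0 -> \forall s \near t, h s != 0.
  move=> dh h0; have [hn|hp|] := ltgtP (h t) 0; last by move/eqP: h0.
    by near=> s; rewrite lt_eqF //; near: s; exact: near_lt0 dh hn.
  by near=> s; rewrite gt_eqF //; near: s; exact: near_gt0 dh hp.
case: ft0 => h0; near=> s; rewrite eq_complex negb_and; apply/orP.
  by left; near: s; exact: aux fr h0.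
by right; near: s; exact: aux fi h0.
Unshelve. all: by end_near. Qed.

Lemma is_derive_Arg_cderiv f t d : cderiv f t d -> Im (f t) != 0 ->
  is_derive t 1 (fun s => Arg (f s)) (Im (d / f t)).
Proof.
move=> [fr fi] i0.
have f0 : f t != 0 by rewrite eq_complex negb_and i0 orbT.
rewrite cIm_div //; under eq_fun do rewrite -[f _]complex_eta.
exact: is_derive_Arg fr fi (or_intror i0).
Qed.

Lemma is_derive_ln_modC_cderiv f t d : cderiv f t d -> f t != 0 ->
  is_derive t 1 (fun s => ln (modC (f s))) (Re (d / f t)).
Proof.
move=> [fr fi] f0; rewrite cRe_div //; under eq_fun do rewrite -[f _]complex_eta.
exact: is_derive_lnmod fr fi (Re_or_Im_neq0 f0).
Qed.

Lemma is_derive_BW_cderiv f (f' : R -> C) t d :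
  (\forall s \near t, cderiv f s (f' s)) -> cderiv f' t d -> Im (f t) != 0 ->
  is_derive t 1 (fun s => BlochWigner (f s))
    (- (ln (modC (f t)) * Im (f' t / (1 - f t)) + ln (modC (1 - f t)) * Im (f' t / f t))).
Proof.
move=> df df' i0; have [c1 c2] := cderiv_continuous df'.
have f0 : f t != 0 by rewrite eq_complex negb_and i0 orbT.
have f1 : 1 - f t != 0 by rewrite eq_complex negb_and cImB sub0r oppr_eq0 i0 orbT.
under eq_fun do rewrite -[f _]complex_eta.
have dr : \forall s \near t, is_derive (s : R) 1 (fun s => Re (f s)) (Re (f' s)).
  by near=> s; have [] : cderiv f s (f' s) by near: s.
have di : \forall s \near t, is_derive (s : R) 1 (fun s => Im (f s)) (Im (f' s)).
  by near=> s; have [] : cderiv f s (f' s) by near: s.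
apply: (is_derive_eq (is_derive_BlochWigner dr di c1 c2 i0)).
rewrite /BW_der !cIm_div // cReB cImB sub0r sqrrN complex_eta mulrN opprK.
have -> : 1 - f t = Complex (1 - Re (f t)) (- Im (f t)).
  by apply: complex_ext; rewrite ?cReB ?cImB //= sub0r.
congr (- (_ * (_ / _) + _ * (_ / _))); rewrite /=; ring.
Unshelve. all: by end_near. Qed.

End ComplexCurves.

Lemma is_derive_derive1 (R : realType) (f : R -> R) (t d : R) :
  is_derive t 1 f d -> derive1 f t = d.
Proof. by rewrite derive1E; case. Qed.

(** * Wirtinger derivatives under the motion of one point *)

Section Wirtinger.
Local Open Scope classical_set_scope.
Local Open Scope ring_scope.
Variables (R : realType) (n : nat).
Local Notation C := R[i].
Local Notation Re := (@complex.Re R).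
Local Notation Im := (@complex.Im R).
Local Notation config := ('I_n -> C).
Implicit Types (w : config) (v : 'I_n).

Lemma bump_cR0 w v (d : C) : bump w v (cR 0 * d) = w.
Proof.
apply/funext => i; rewrite /bump; have -> : cR 0 = 0 :> C by [].
by rewrite mul0r addr0; case: ifP.
Qed.

Lemma cderiv_bump w v (d : C) p t :
  cderiv (fun t => bump w v (cR t * d) p) t ((p == v)%:R * d).
Proof.
rewrite /bump; case: (p == v); last by rewrite mul0r; exact: cderiv_cst.
have dr : cderiv (fun s : R => cR s) t (cR 1) by exact: cderiv_real (is_derive_id t 1).
have dt := cderivM dr (cderiv_cst d t).
apply: (cderiv_eq (cderivD (cderiv_cst (w p) t) dt)).
by rewrite mulr0 addr0 add0r.
Qed.

Lemma pdxE (F : config -> R) v w :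
  pdx F v w = derive1 (fun t : R => F (bump w v (cR t * 1))) 0.
Proof. by rewrite /pdx; congr (derive1 _ 0); apply/funext => t; rewrite mulr1. Qed.

Lemma dz_cderiv (G : config -> C) v w (X : C -> C) :
  (forall d, cderiv (fun t => G (bump w v (cR t * d))) 0 (X d)) ->
  dz G v w = (X 1 - cI R * X (cI R)) / 2%:R.
Proof.
move=> H; rewrite /dz; congr ((_ - _ * _) / _).
  have [hr hi] := H 1; rewrite /pdxC !pdxE.
  rewrite (is_derive_derive1 hr) (is_derive_derive1 hi) /cI /cR -[RHS]complex_eta.
  by apply: complex_ext; rewrite /=; ring.
have [hr hi] := H (cI R); rewrite /pdyC /pdy.
rewrite (is_derive_derive1 hr) (is_derive_derive1 hi) /cI /cR -[RHS]complex_eta.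
by apply: complex_ext; rewrite /=; ring.
Qed.

Lemma dzb_cderiv (G : config -> C) v w (X : C -> C) :
  (forall d, cderiv (fun t => G (bump w v (cR t * d))) 0 (X d)) ->
  dzb G v w = (X 1 + cI R * X (cI R)) / 2%:R.
Proof.
move=> H; rewrite /dzb; congr ((_ + _ * _) / _).
  have [hr hi] := H 1; rewrite /pdxC !pdxE.
  rewrite (is_derive_derive1 hr) (is_derive_derive1 hi) /cI /cR -[RHS]complex_eta.
  by apply: complex_ext; rewrite /=; ring.
have [hr hi] := H (cI R); rewrite /pdyC /pdy.
rewrite (is_derive_derive1 hr) (is_derive_derive1 hi) /cI /cR -[RHS]complex_eta.
by apply: complex_ext; rewrite /=; ring.
Qed.

(** Writing Im(d Q) as (d Q - conj(d Q)) / (2i), the coefficient of [d] is Q / (2i). *)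
Lemma dz_real (F : config -> R) v w (Q : C) :
  (forall d : C, is_derive (0 : R) 1 (fun t : R => F (bump w v (cR t * d))) (Im (d * Q))) ->
  dz (liftR F) v w = - (cI R / 2%:R * Q).
Proof.
move=> H; rewrite (dz_cderiv (X := fun d => cR (Im (d * Q)))) => [|d]; last exact: cderiv_real.
have -> : - (cI R / 2%:R * Q) = - (cI R * Q) / 2%:R by ring.
congr (_ / _).
by rewrite mul1r cImM /cI /cR; apply: complex_ext; rewrite ?(cReB, cImB, cReM, cImM, cReN, cImN) /=; ring.
Qed.

Lemma dzb_real (F : config -> R) v w (Q : C) :
  (forall d : C, is_derive (0 : R) 1 (fun t : R => F (bump w v (cR t * d))) (Im (d * Q))) ->
  dzb (liftR F) v w = cI R / 2%:R * conjc Q.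
Proof.
move=> H; rewrite (dzb_cderiv (X := fun d => cR (Im (d * Q)))) => [|d]; last exact: cderiv_real.
have -> : cI R / 2%:R * conjc Q = (cI R * conjc Q) / 2%:R by ring.
congr (_ / _).
by rewrite mul1r cImM /cI /cR; apply: complex_ext; rewrite ?(cReD, cImD, cReM, cImM, cReN, cImN, cRe_conj, cIm_conj) /=; ring.
Qed.

(* [dlog w p q v] is the logarithmic derivative of [w p - w q] in [w v]. *)
Definition dlog w p q v : C := ((p == v)%:R - (q == v)%:R) / (w p - w q).

Lemma dlogC w p q v : dlog w p q v = dlog w q p v.
Proof. by rewrite /dlog -[w p - _]opprB invrN mulrN -mulNr opprB. Qed.

Definition llen w p q : R := ln (modC (w p - w q)).

Lemma modCN (a : C) : modC (- a) = modC a.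
Proof. by rewrite /modC cReN cImN !sqrrN. Qed.

Lemma llenC w p q : llen w p q = llen w q p.
Proof. by rewrite /llen -opprB modCN. Qed.

Section Curve.
Variables (w : config) (v : 'I_n) (d : C).
Local Notation wt t := (bump w v (cR t * d)).
Local Notation k p q := (((p == v)%:R - (q == v)%:R) * d : C).

Lemma cderiv_diff p q (t : R) : cderiv (fun t => wt t p - wt t q) t (k p q).
Proof. by rewrite mulrBl; apply: cderivB; exact: cderiv_bump. Qed.

Lemma is_derive_Arg_ratio a b c : w b != w c -> w a != w c ->
  Im ((w b - w c) / (w a - w c)) != 0 ->
  is_derive (0 : R) 1 (fun t : R => Arg ((wt t b - wt t c) / (wt t a - wt t c)))
    (Im (d * (dlog w b c v - dlog w a c v))).
Proof.
move=> bc ac i0; have bc0 : w b - w c != 0 by rewrite subr_eq0.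
have ac0 : w a - w c != 0 by rewrite subr_eq0.
have dr := cderiv_div (cderiv_diff b c 0) (cderiv_diff a c 0).
rewrite !bump_cR0 in dr; have {}dr := dr ac0.
have := is_derive_Arg_cderiv dr; rewrite !bump_cR0 => /(_ i0) h.
apply: (is_derive_eq h); congr Im; rewrite /dlog.
by field; rewrite ac0 bc0.
Qed.

Lemma is_derive_llen p q : w p != w q ->
  is_derive (0 : R) 1 (fun t : R => llen (wt t) p q) (Re (d * dlog w p q v)).
Proof.
move=> pq; have pq0 : w p - w q != 0 by rewrite subr_eq0.
have := is_derive_ln_modC_cderiv (cderiv_diff p q 0); rewrite !bump_cR0 => /(_ pq0) h.
by apply: (is_derive_eq h); congr Re; rewrite /dlog mulrAC mulrC.
Qed.

(** [dlog] is holomorphic in the moving point: its derivative is complex linear in the direction.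
    The value of [h] does not matter later, because [dz] annihilates the conjugate of such a
    function. *)
Lemma cderiv_dlog p q u : w p != w q -> exists h : C,
  forall d', cderiv (fun t : R => dlog (bump w v (cR t * d')) p q u) 0 (d' * h).
Proof.
move=> pq; have pq0 : w p - w q != 0 by rewrite subr_eq0.
exists (- (((p == u)%:R - (q == u)%:R) * ((p == v)%:R - (q == v)%:R) / ((w p - w q) * (w p - w q)))) => d'.
have dpq : cderiv (fun t => bump w v (cR t * d') p - bump w v (cR t * d') q) 0
    (((p == v)%:R - (q == v)%:R) * d').
  by rewrite mulrBl; apply: cderivB; exact: cderiv_bump.
have := cderiv_div (cderiv_cst ((p == u)%:R - (q == u)%:R) 0) dpq.
rewrite !bump_cR0 => /(_ pq0) h; apply: (cderiv_eq h).
by field.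
Qed.

(** Schlaefli's formula in complex form: for a counterclockwise triangle, the imaginary part of [d]
    times each difference of [dlog] is minus the derivative of the angle opposite the edge whose
    length multiplies it. *)
Definition vol_form (a b c : 'I_n) : C :=
  cR (llen w c a) * (dlog w b c v - dlog w a b v)
  + cR (llen w a b) * (dlog w c a v - dlog w b c v)
  + cR (llen w b c) * (dlog w a b v - dlog w c a v).

(** For the ratio r = (c - a)/(b - a) also 1 - r = (b - c)/(b - a) is a ratio of edges, so the
    logarithms in the derivative of [BlochWigner] split into contributions of single edges. *)
Lemma is_derive_Vol a b c : w a != w b -> w b != w c -> w c != w a ->
  Im ((w c - w a) / (w b - w a)) != 0 ->
  is_derive (0 : R) 1 (fun t : R => Vol (wt t a) (wt t b) (wt t c)) (Im (d * vol_form a b c)).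
Proof.
move=> ab bc ca i0.
have ba0 : w b - w a != 0 by rewrite subr_eq0 eq_sym.
have ca0 : w c - w a != 0 by rewrite subr_eq0.
have bc0 : w b - w c != 0 by rewrite subr_eq0.
have cb0 : w c - w b != 0 by rewrite subr_eq0 eq_sym.
have ab0 : w a - w b != 0 by rewrite subr_eq0.
pose A (t : R) := wt t c - wt t a; pose B (t : R) := wt t b - wt t a.
have dA t : cderiv A t (k c a) by exact: cderiv_diff.
have dB t : cderiv B t (k b a) by exact: cderiv_diff.
have A0 : A 0 = w c - w a by rewrite /A !bump_cR0.
have B0 : B 0 = w b - w a by rewrite /B !bump_cR0.
have B00 : B 0 != 0 by rewrite B0.
have BB0 : B 0 * B 0 != 0 by rewrite mulf_neq0.
pose r' t := (k c a * B t - A t * k b a) / (B t * B t).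
have dr : \forall t \near (0 : R), cderiv (fun t => A t / B t) t (r' t).
  by near=> t; apply: cderiv_div => //; near: t; exact: near_neq0 (dB 0) B00.
have [e dr'] : exists e, cderiv r' 0 e.
  eexists; apply: cderiv_div => //.
    apply: cderivB; [apply: cderivM; [exact: cderiv_cst | exact: dB]
      | apply: cderivM; [exact: dA | exact: cderiv_cst]].
  by apply: cderivM; exact: dB.
have i0' : Im (A 0 / B 0) != 0 by rewrite A0 B0.
apply: (is_derive_eq (is_derive_BW_cderiv dr dr' i0')).
have r0 : A 0 / B 0 = (w c - w a) / (w b - w a) by rewrite A0 B0.
have r1 : 1 - A 0 / B 0 = (w b - w c) / (w b - w a) by rewrite A0 B0; field.
rewrite r1 r0 !ln_modC_div //.
have -> : ln (modC (w c - w a)) = llen w c a by [].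
have -> : ln (modC (w b - w a)) = llen w a b by rewrite llenC.
have -> : ln (modC (w b - w c)) = llen w b c by [].
have -> : r' 0 / ((w b - w c) / (w b - w a)) = d * (dlog w a b v - dlog w b c v).
  by rewrite /r' A0 B0 /dlog; field; rewrite ba0 bc0 ab0.
have -> : r' 0 / ((w c - w a) / (w b - w a)) = d * (dlog w c a v - dlog w a b v).
  by rewrite /r' A0 B0 /dlog; field; rewrite ba0 ca0 ab0.
rewrite /vol_form; move: (dlog w a b v) (dlog w b c v) (dlog w c a v) => x y z.
rewrite ?(cReD, cImD, cReB, cImB, cReM, cImM) /cR /=; ring.
Unshelve. all: by end_near. Qed.

End Curve.
End Wirtinger.

Lemma is_derive_sum_seq (R : realType) (I : Type) (r : seq I) (Q : pred I)
    (F : I -> R -> R) (t : R) (D : I -> R) :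
  (forall i, Q i -> is_derive t 1 (F i) (D i)) ->
  is_derive t 1 (fun s => \sum_(i <- r | Q i) F i s) (\sum_(i <- r | Q i) D i).
Proof.
move=> H; elim: r => [|i r IH].
  rewrite big_nil (_ : (fun s => _) = cst 0) ?funeqE => [|s]; last by rewrite big_nil.
  exact: is_derive_cst.
rewrite big_cons; case: ifP => Qi.
  rewrite (_ : (fun s => _) = (fun s => F i s + \sum_(j <- r | Q j) F j s)) ?funeqE => [|s].
    by apply: is_deriveD => //; exact: H.
  by rewrite big_cons Qi.
by rewrite (_ : (fun s => _) = (fun s => \sum_(j <- r | Q j) F j s)) ?funeqE // => s; rewrite big_cons Qi.
Qed.

Section Config.
Variables (R : realType) (n : nat).
Local Notation C := R[i].
Local Notation Re := (@complex.Re R).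
Local Notation Im := (@complex.Im R).
Local Notation config := ('I_n -> C).
Implicit Types (w : config) (v : 'I_n).

Lemma cross_Im w a b c : cross w a b c = Im (conjc (w b - w a) * (w c - w a)).
Proof. by rewrite /cross cImM cRe_conj cIm_conj mulNr. Qed.

Lemma cross_neq w a b c : cross w a b c != 0 -> [/\ w a != w b, w b != w c & w c != w a].
Proof.
rewrite cross_Im => D; split; apply: contraNneq D => ->; rewrite ?subrr ?rmorph0 ?mul0r ?mulr0 //.
by rewrite cImM cRe_conj cIm_conj; apply/eqP; ring.
Qed.

Lemma Im_ratio_neq0 w a b c : cross w a b c != 0 -> Im ((w c - w a) / (w b - w a)) != 0.
Proof.
move=> D; have [ab _ _] := cross_neq D; have ba : w b - w a != 0 by rewrite subr_eq0 eq_sym.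
rewrite cIm_div //; apply: mulf_neq0; last by rewrite invr_eq0 sqr_Re_Im_neq0.
by rewrite [X in _ - X]mulrC.
Qed.

Lemma near_cross_gt0 w u (d : C) a b c : 0 < cross w a b c ->
  \forall t \near (0 : R), 0 < cross (bump w u (cR t * d)) a b c.
Proof.
move=> D.
have [_ h] := cderivM (cderiv_conj (cderiv_diff w u d b a 0)) (cderiv_diff w u d c a 0).
have := near_gt0 h; rewrite !bump_cR0 -cross_Im => /(_ D).
by apply: filterS => t; rewrite -cross_Im.
Qed.

(** What remains of [vol_form] after conjugation and [dz]: only the logarithms of lengths
    contribute, each with half of [dlog], since the conjugates of the other factors are
    antiholomorphic. *)
Definition herm_form w a b c u v : C :=
  dlog w c a u * conjc (dlog w b c v - dlog w a b v)
  + dlog w a b u * conjc (dlog w c a v - dlog w b c v)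
  + dlog w b c u * conjc (dlog w a b v - dlog w c a v).

Lemma cderiv_vol_form w a b c u v : 0 < cross w a b c -> exists h : C, forall d : C,
  cderiv (fun t : R => vol_form (bump w u (cR t * d)) v a b c) 0
    (cR (Re (d * dlog w c a u)) * (dlog w b c v - dlog w a b v)
    + cR (Re (d * dlog w a b u)) * (dlog w c a v - dlog w b c v)
    + cR (Re (d * dlog w b c u)) * (dlog w a b v - dlog w c a v) + d * h).
Proof.
move=> D; have [ab bc ca] := cross_neq (lt0r_neq0 D).
have [h1 H1] := cderiv_dlog u v ab; have [h2 H2] := cderiv_dlog u v bc.
have [h3 H3] := cderiv_dlog u v ca.
exists (cR (llen w c a) * (h2 - h1) + cR (llen w a b) * (h3 - h2) + cR (llen w b c) * (h1 - h3)) => d.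
have L p q : w p != w q -> cderiv (fun t : R => cR (llen (bump w u (cR t * d)) p q)) 0 (cR (Re (d * dlog w p q u))).
  by move=> pq; apply: cderiv_real; exact: is_derive_llen.
have := cderivD (cderivD (cderivM (L _ _ ca) (cderivB (H2 d) (H1 d)))
  (cderivM (L _ _ ab) (cderivB (H3 d) (H2 d)))) (cderivM (L _ _ bc) (cderivB (H1 d) (H3 d))).
rewrite !bump_cR0 => H; apply: (cderiv_eq H); ring.
Qed.

End Config.

(** * Second derivatives of the volume functional *)

Section AT.
Variables (R : realType) (n : nat) (z : 'I_n -> R[i]) (T : {set {set 'I_n}}).
Variables (v1 v2 v3 : 'I_n).
Local Notation C := R[i].
Local Notation Re := (@complex.Re R).
Local Notation Im := (@complex.Im R).
Local Notation V := 'I_n.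
Local Notation f0 := (f0 v1 v2 v3).
Hypothesis tri : is_triangulation z T.
Hypothesis v_cross : cross z v1 v2 v3 != 0.
Local Notation ccw t := (ccw_list v1 z t).

Lemma ccw_listP (t : {set V}) : (exists a b c, t = [set a; b; c] /\ cross z a b c != 0) ->
  [set (ccw t).1.1; (ccw t).1.2; (ccw t).2] = t /\ 0 < cross z (ccw t).1.1 (ccw t).1.2 (ccw t).2.
Proof.
move=> /triangle_ccw[a [b [c [tE D]]]]; rewrite /ccw_list.
case: pickP => [p /andP[/eqP ? ?] // | /(_ (a, b, c))] /=.
by rewrite tE eqxx D.
Qed.

Definition faces_ccw (w : V -> C) : Prop :=
  forall t, t \in T -> 0 < cross w (ccw t).1.1 (ccw t).1.2 (ccw t).2.

(** A second derivative needs the first one at all nearby configurations, where the listings fixed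
    at [z] must remain counterclockwise. *)
Lemma near_faces_ccw u (d : C) : \forall t \near (0 : R), faces_ccw (bump z u (cR t * d)).
Proof.
have H (t : {set V}) : \forall s \near (0 : R), t \in T ->
    0 < cross (bump z u (cR s * d)) (ccw t).1.1 (ccw t).1.2 (ccw t).2.
  case tT: (t \in T); last by apply: (@filterE _ (nbhs (0 : R))) => s.
  have [_ D] := ccw_listP (T_triangle tri tT).
  by apply: filterS (near_cross_gt0 u d D) => s h _.
exact: filter_forall H.
Qed.

Definition vol_sum (w : V -> C) v : C :=
  \sum_(t in T) vol_form w v (ccw t).1.1 (ccw t).1.2 (ccw t).2.

(** The exterior volume is constant when an interior point moves, so only the triangles of [T]
    contribute. *)
Lemma dzb_A_T w v : v \notin f0 -> faces_ccw w ->
  dzb (liftR (A_T v1 v2 v3 z T)) v w = cI R / 2%:R * conjc (- vol_sum w v).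
Proof.
move=> vf gw; apply: dzb_real => d; rewrite /A_T.
have d0 : is_derive (0 : R) 1 (fun t : R => VolFace v1 z f0 (bump w v (cR t * d))) 0.
  rewrite (_ : (fun t => _) = cst (VolFace v1 z f0 w)); first exact: is_derive_cst.
  have [fE _] := ccw_listP (f0_triangle v_cross).
  have nv p : p \in f0 -> p == v = false by move=> pf; apply: contraNF vf => /eqP <-.
  have [m1 m2 m3] : [/\ (ccw f0).1.1 \in f0, (ccw f0).1.2 \in f0 & (ccw f0).2 \in f0].
    by rewrite -{2 4 6}fE !inE !eqxx !orbT.
  by apply/funext => t; rewrite /VolFace /bump /= !nv.
have dT : is_derive (0 : R) 1 (fun s : R => \sum_(t in T) VolFace v1 z t (bump w v (cR s * d)))
    (\sum_(t in T) Im (d * vol_form w v (ccw t).1.1 (ccw t).1.2 (ccw t).2)).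
  apply: is_derive_sum_seq => f fT.
  have D := lt0r_neq0 (gw f fT); have [ab bc ca] := cross_neq D.
  by apply: is_derive_Vol => //; exact: Im_ratio_neq0.
apply: (is_derive_eq (is_deriveD (is_deriveN dT) d0)).
rewrite addr0 mulrN cImN /vol_sum mulr_sumr; congr (- _).
by rewrite (big_morph Im (@cImD R) (id1 := 0)).
Qed.

Lemma D_entry u v : v \notin f0 ->
  dz (dzb (liftR (A_T v1 v2 v3 z T)) v) u z =
  - (cI R / 4%:R) * \sum_(t in T) herm_form z (ccw t).1.1 (ccw t).1.2 (ccw t).2 u v.
Proof.
move=> vf.
pose a t := (ccw t).1.1; pose b t := (ccw t).1.2; pose c t := (ccw t).2.
pose S t (d : C) := cR (Re (d * dlog z (c t) (a t) u)) * (dlog z (b t) (c t) v - dlog z (a t) (b t) v)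
    + cR (Re (d * dlog z (a t) (b t) u)) * (dlog z (c t) (a t) v - dlog z (b t) (c t) v)
    + cR (Re (d * dlog z (b t) (c t) u)) * (dlog z (a t) (b t) v - dlog z (c t) (a t) v).
have H (t : {set V}) : exists h : C, t \in T -> forall d : C,
    cderiv (fun s : R => vol_form (bump z u (cR s * d)) v (a t) (b t) (c t)) 0 (S t d + d * h).
  case tT: (t \in T); last by exists 0.
  have [_ D] := ccw_listP (T_triangle tri tT).
  by have [h hP] := cderiv_vol_form u v D; exists h.
have /fin_all_exists[h hP] := H.
rewrite (dz_cderiv (X := fun d => cI R / 2%:R * conjc (- \sum_(t in T) (S t d + d * h t)))); last first.
  move=> d; apply: (near_cderiv (f := fun s => cI R / 2%:R * conjc (- vol_sum (bump z u (cR s * d)) v))).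
    near=> s; rewrite dzb_A_T //; near: s; exact: near_faces_ccw.
  have dS : cderiv (fun s : R => vol_sum (bump z u (cR s * d)) v) 0 (\sum_(t in T) (S t d + d * h t)).
    by apply: cderiv_sum => t tT; exact: hP.
  apply: (cderiv_eq (cderivM (cderiv_cst (cI R / 2%:R) 0) (cderiv_conj (cderivN dS)))).
  by rewrite mul0r add0r.
have two : (2%:R : C) != 0 by rewrite pnatr_eq0.
rewrite -!sumrN !rmorph_sum !mulr_sumr -sumrB mulr_suml; apply: eq_bigr => t _ /=.
rewrite /S /herm_form !mul1r -/(a t) -/(b t) -/(c t).
move: (dlog z (c t) (a t) u) (dlog z (a t) (b t) u) (dlog z (b t) (c t) u) => p q r.
move: (dlog z (c t) (a t) v) (dlog z (a t) (b t) v) (dlog z (b t) (c t) v) => x y w.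
move: (h t) => e.
rewrite !(conjc_opp, conjc_add, conjc_mul).
have conjcR (k : R) : conjc (cR k) = cR k :> C by rewrite /cR /= oppr0.
have conjI : conjc (cI R) = - cI R by apply: complex_ext; rewrite ?cReN ?cImN /= ?oppr0.
rewrite !conjcR conjI.
have reI (k : C) : cR (Re k) - cI R * cR (Re (cI R * k)) = k.
  by rewrite /cI /cR; apply: complex_ext; rewrite ?(cReB, cImB, cReM, cImM) /=; ring.
have I2 : cI R * cI R = -1.
  by rewrite /cI; apply: complex_ext; rewrite ?(cReM, cImM, cReN, cImN) /=; ring.
rewrite -[in RHS](reI p) -[in RHS](reI q) -[in RHS](reI r).
move: (cR _) (cR _) (cR _) (cR _) (cR _) (cR _) => p1 p2 q1 q2 r1 r2.
move: I2 two; move: (cI R) (conjc x) (conjc y) (conjc w) (conjc e) => i X Y W E I2 two.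
have -> : 4%:R = 2%:R * 2%:R :> C by rewrite -natrM.
(* The holomorphic remainder [E] drops out: its direction i contributes conj(i e) = - i conj(e),
   which i times cancels against direction 1. *)
apply: (mulfI two); apply: (mulfI two); field: I2.
Unshelve. all: by end_near. Qed.

End AT.

(** * Proof of the theorem *)

(* [A], [B], [C] are the vertices of a triangle similar to [a], [b], [c], and the
   right-hand side is a positive multiple of its area. *)
Lemma herm_ge0 (R : realType) (x1 x2 x3 a b c A B C : R[i]) :
  a != b -> b != c -> c != a ->
  0 <= complex.Im (conjc (b - a) * (c - a)) ->
  A = (x1 - x2) / (a - b) -> B = (x2 - x3) / (b - c) -> C = (x3 - x1) / (c - a) ->
  0 <= - (cI R / 4%:R) * (C * conjc (B - A) + A * conjc (C - B) + B * conjc (A - C)).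
Proof.
move=> ab bc ca D AE BE CE; rewrite -subr_eq0 in ab; rewrite -subr_eq0 in bc; rewrite -subr_eq0 in ca.
pose r := (a - b) / (b - c).
(* Both the edges and their increments close up: a - b, b - c, c - a sum to 0, and so do A (a - b),
   B (b - c), C (c - a). Subtracting C times the first relation leaves this proportionality. *)
have BC : B - C = - ((A - C) * r) by rewrite AE BE CE /r; field; rewrite ab bc ca.
have rI : complex.Im r <= 0.
  rewrite /r cIm_div // pmulr_lle0; last first.
    by rewrite invr_gt0 lt_def sqr_Re_Im_neq0 //= addr_ge0 ?sqr_ge0.
  rewrite -oppr_ge0; apply: le_trans D _; rewrite cImM cRe_conj cIm_conj !cReB !cImB.
  by rewrite le_eqVlt; apply/orP; left; apply/eqP; ring.
have rr : conjc r - r = - (2%:R * cI R * cR (complex.Im r)).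
  rewrite /cI /cR; case: (r) => p q; apply: complex_ext.
    by rewrite !(cReB, cReN, cReM, cImM) /= ?cReM /=; ring.
  by rewrite !(cImB, cImN, cReM, cImM) /= ?cReM /=; ring.
have S : C * conjc (B - A) + A * conjc (C - B) + B * conjc (A - C) =
    (A - C) * conjc (A - C) * (conjc r - r).
  have -> : conjc (C - B) = conjc ((A - C) * r) by congr conjc; rewrite -[RHS]opprK -BC opprB.
  have -> : B - A = - ((A - C) * r) - (A - C) by rewrite -BC; ring.
  have -> : B = C - (A - C) * r by rewrite -[RHS]addrC -BC; ring.
  by rewrite !(conjc_opp, conjc_add, conjc_mul); ring.
rewrite S rr.
have I2 : cI R * cI R = -1.
  by rewrite /cI; apply: complex_ext; rewrite ?(cReM, cImM, cReN, cImN) /=; ring.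
have four : (4%:R : R[i]) != 0 by rewrite pnatr_eq0.
have -> : - (cI R / 4%:R) * ((A - C) * conjc (A - C) * - (2%:R * cI R * cR (complex.Im r)))
  = (A - C) * conjc (A - C) * (- (cR (complex.Im r)) / 2%:R).
  by field: I2.
apply: mulr_ge0; first exact: mul_conjC_ge0.
apply: divr_ge0; last exact: ler0n.
by rewrite oppr_ge0 lecE /= eqxx.
Qed.

(** * From darts to the triangles of T *)

Section SumFaces.
Variables (R : realType) (n : nat) (z : 'I_n -> R[i]) (T : {set {set 'I_n}}).
Variables (v1 v2 v3 : 'I_n).
Local Notation C := R[i].
Local Notation V := 'I_n.
Local Notation f0 := (f0 v1 v2 v3).
Local Notation P := (pos_face v1 v2 v3 z T).
Hypothesis z_inj : injective z.
Hypothesis tri : is_triangulation z T.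
Hypothesis v_cross : cross z v1 v2 v3 != 0.
Hypothesis interior : forall i, i \notin f0 -> exists l1 l2 l3 : R,
  [/\ 0 < l1, 0 < l2, 0 < l3, l1 + l2 + l3 = 1 &
      z i = cR l1 * z v1 + cR l2 * z v2 + cR l3 * z v3].
Local Notation ccw t := (ccw_list v1 z t).
Let surf := surface_T z_inj tri v_cross interior.

Lemma ccw_rot a0 b0 c0 a b c : 0 < cross z a0 b0 c0 ->
  [set a; b; c] = [set a0; b0; c0] -> 0 < cross z a b c ->
  [\/ [/\ a = a0, b = b0 & c = c0], [/\ a = b0, b = c0 & c = a0]
    | [/\ a = c0, b = a0 & c = b0]].
Proof.
move=> D0 E D.
have ma : a \in [set a0; b0; c0] by rewrite -E !inE eqxx.
have mb : b \in [set a0; b0; c0] by rewrite -E !inE eqxx orbT.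
have mc : c \in [set a0; b0; c0] by rewrite -E !inE eqxx orbT.
move: ma mb mc D; rewrite !inE.
move=> /orP[/orP[]|] /eqP -> /orP[/orP[]|] /eqP -> /orP[/orP[]|] /eqP ->;
  rewrite ?cross_aab ?cross_aba ?cross_abb ?ltxx // => D;
  try (by [constructor 1 | constructor 2 | constructor 3]);
  move: D0 D; rewrite !crossE; lra.
Qed.

(** Matches the two encodings of a face: each triangle of [T] accounts for the three rotations of
    its chosen listing, and the darts of [f0] are silenced by the hypothesis on [F]. *)
Lemma sum_darts_T (M : nmodType) (F : V -> V -> V -> M) :
  (forall a b c, [set a; b; c] = f0 -> F a b c = 0) ->
  \sum_(p | dart P p) F p.1 p.2 (third P p.1 p.2) =
  \sum_(t in T) (F (ccw t).1.1 (ccw t).1.2 (ccw t).2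
    + F (ccw t).1.2 (ccw t).2 (ccw t).1.1 + F (ccw t).2 (ccw t).1.1 (ccw t).1.2).
Proof.
move=> F0.
pose inT (p : V * V) := ([set p.1; p.2; third P p.1 p.2] \in T) && (0 < cross z p.1 p.2 (third P p.1 p.2)).
transitivity (\sum_(p | dart P p && inT p) F p.1 p.2 (third P p.1 p.2)).
  rewrite [RHS]big_mkcondr; apply: eq_bigr => p d.
  case: ifP => // nT; apply: F0; move: d.
  by rewrite /dart /pos_face; rewrite /inT in nT; rewrite nT => /andP[/eqP].
rewrite (partition_big (fun p : V * V => [set p.1; p.2; third P p.1 p.2]) (mem T)) /=; last first.
  by move=> p /andP[_ /andP[]].
apply: eq_bigr => t tT.
have [tE D] := ccw_listP v1 (T_triangle tri tT).
move: (ccw t).1.1 (ccw t).1.2 (ccw t).2 tE D => a b c tE D.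
have Pabc : P a b c by apply: pos_face_T; rewrite ?tE.
have d1 := face_dart surf Pabc; have d2 := face_dart surf (face_cyc surf Pabc).
have d3 := face_dart surf (face_cyc surf (face_cyc surf Pabc)).
have ab := face_neq surf Pabc; have bc := face_neq surf (face_cyc surf Pabc).
have ca := face_neq surf (face_cyc surf (face_cyc surf Pabc)).
have t1 := thirdE surf Pabc; have t2 := thirdE surf (face_cyc surf Pabc).
have t3 := thirdE surf (face_cyc surf (face_cyc surf Pabc)).
have s2 : [set b; c; a] = t.
  by rewrite -tE; apply/finset.setP => i; rewrite !inE; case: (i == a); case: (i == b); case: (i == c).
have s3 : [set c; a; b] = t.
  by rewrite -tE; apply/finset.setP => i; rewrite !inE; case: (i == a); case: (i == b); case: (i == c).
have D2 : 0 < cross z b c a by rewrite -cross_rot.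
have D3 : 0 < cross z c a b by rewrite cross_rot.
rewrite (bigD1 (a, b)) /=; last by rewrite d1 /inT /= t1 tE tT D eqxx.
rewrite (bigD1 (b, c)) /=; last by rewrite d2 /inT /= t2 s2 tT D2 eqxx xpair_eqE eq_sym (negbTE ab).
rewrite (bigD1 (c, a)) /=; last first.
  by rewrite d3 /inT /= t3 s3 tT D3 eqxx !xpair_eqE (negbTE ca) [c == b]eq_sym (negbTE bc).
rewrite t1 t2 t3 big1 ?addr0 ?addrA // => -[p q] /=.
rewrite /inT /= => /andP[/andP[/andP[/andP[/andP[dpq /andP[_ Dpq]] /eqP sE] n1] n2] n3].
by rewrite -tE in sE; case: (ccw_rot D sE Dpq) => -[pe qe _]; subst; rewrite eqxx in n1 n2 n3.
Qed.

End SumFaces.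

Lemma beta_map n (P : 'I_n -> 'I_n -> 'I_n -> bool) (K L : comPzRingType)
    (f : {rmorphism K -> L}) (x y : 'I_n -> 'I_n -> K) :
  beta P (fun a b => f (x a b)) (fun a b => f (y a b)) = f (beta P x y).
Proof. by rewrite rmorph_sum; apply: eq_bigr => p _; rewrite rmorphM rmorphB. Qed.

Lemma beta_scale n (P : 'I_n -> 'I_n -> 'I_n -> bool) (K : comPzRingType) (k l : K)
    (x y : 'I_n -> 'I_n -> K) :
  beta P (fun a b => k * x a b) (fun a b => l * y a b) = k * l * beta P x y.
Proof. by rewrite mulr_sumr; apply: eq_bigr => p _; ring. Qed.

(** * Matrix entries as values of [beta] *)

Section Entries.
Variables (R : realType) (n : nat) (z : 'I_n -> R[i]) (T : {set {set 'I_n}}).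
Variables (v1 v2 v3 : 'I_n).
Local Notation C := R[i].
Local Notation V := 'I_n.
Local Notation f0 := (f0 v1 v2 v3).
Local Notation P := (pos_face v1 v2 v3 z T).
Hypothesis z_inj : injective z.
Hypothesis tri : is_triangulation z T.
Hypothesis v_cross : cross z v1 v2 v3 != 0.
Hypothesis interior : forall i, i \notin f0 -> exists l1 l2 l3 : R,
  [/\ 0 < l1, 0 < l2, 0 < l3, l1 + l2 + l3 = 1 &
      z i = cR l1 * z v1 + cR l2 * z v2 + cR l3 * z v3].
Let surf := surface_T z_inj tri v_cross interior.

Lemma conjc_cI : conjc (cI R) = - cI R.
Proof. by apply: complex_ext; rewrite ?cReN ?cImN /= ?oppr0. Qed.

Lemma cI2 : cI R * cI R = -1.
Proof. by rewrite /cI; apply: complex_ext; rewrite ?(cReM, cImM, cReN, cImN) /=; ring. Qed.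

Lemma pos_face_cross a b c : P a b c -> cross z a b c != 0.
Proof. by case/orP => /andP[_ D]; rewrite ?(gt_eqF D) ?(lt_eqF D). Qed.

(** The factor i/2 absorbs the constant of [dz_real], so that the entries of the angle matrix are
    values of [beta] without a coefficient. *)
Definition half_dlog v (p q : V) : C := cI R / 2%:R * dlog z p q v.

Lemma half_dlogC v p q : half_dlog v p q = half_dlog v q p.
Proof. by rewrite /half_dlog dlogC. Qed.

Lemma is_derive_theta v a b : dart P (a, b) ->
  let c := third P a b in let e := third P b a in
  forall d : C, is_derive (0 : R) 1 (fun t : R => theta v1 v2 v3 z T a b (bump z v (cR t * d)))
    (complex.Im (d * - (dlog z b c v - dlog z a c v + (dlog z a e v - dlog z b e v)))).
Proof.
move=> ab c e d.
have D1 : cross z c a b != 0 by rewrite cross_rot; exact: pos_face_cross ab.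
have D2 : cross z e b a != 0 by rewrite cross_rot; exact: pos_face_cross (dart_rev surf ab).
have [ca _ bc] := cross_neq D1; have [eb _ ae] := cross_neq D2.
have h1 := is_derive_Arg_ratio v d bc (_ : z a != z c) (Im_ratio_neq0 D1).
have h2 := is_derive_Arg_ratio v d ae (_ : z b != z e) (Im_ratio_neq0 D2).
rewrite eq_sym in h1; rewrite eq_sym in h2.
apply: (is_derive_eq (is_deriveB (is_deriveB (is_derive_cst (pi : R) (0 : R) 1) (h1 ca)) (h2 eb))).
by rewrite mulrN cImN [in RHS]mulrDr [in RHS]cImD; ring.
Qed.

Lemma theta_dz v e : dart P e ->
  dz (liftR (theta v1 v2 v3 z T e.1 e.2)) v z = beta P (indE C e) (half_dlog v).
Proof.
case: e => a b ab; rewrite (dz_real (is_derive_theta v ab)) (beta_indE surf) //.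
rewrite /edge_op /half_dlog /= (dlogC z (third P a b) a) (dlogC z (third P b a) b); ring.
Qed.

Lemma theta_dzb v e : dart P e ->
  dzb (liftR (theta v1 v2 v3 z T e.1 e.2)) v z
  = beta P (indE C e) (fun p q => conjc (half_dlog v p q)).
Proof.
case: e => a b ab; rewrite (dzb_real (is_derive_theta v ab)) (beta_indE surf) //.
rewrite /edge_op /half_dlog /= (dlogC z (third P a b) a) (dlogC z (third P b a) b).
rewrite !(conjc_opp, conjc_add, conjc_mul) conjc_cI.
have -> : conjc (2%:R^-1 : C) = 2%:R^-1 by rewrite conjc_inv conjc_nat.
ring.
Qed.

(* Arnold's relation, face by face. *)
Lemma beta_dlog u v : beta P (fun p q => dlog z p q u) (fun p q => dlog z p q v) = 0.
Proof.
rewrite (betaE surf) (sum_faces surf (fun a b => dlog z a b u * dlog z b (third P a b) v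
  - dlog z b (third P a b) u * dlog z a b v)); apply: big1 => -[a b] /=.
rewrite inE => /andP[d _].
rewrite (third_next surf d) (third_prev surf d).
have D : cross z a b (third P a b) != 0 by exact: pos_face_cross d.
have [] := cross_neq D; rewrite -subr_eq0 => ab; rewrite -subr_eq0 => bc; rewrite -subr_eq0 => ca.
by rewrite /dlog; field; rewrite ab bc ca.
Qed.

(** On each triangle [herm_form] is minus the summand of [beta] on [dlog], and (i/2) conj(i/2) = 1/4
    turns the coefficient - i/4 into i. The exterior face contributes 0 because [dlog] in [u]
    vanishes on its edges. *)
Lemma D_beta u v : u \notin f0 -> v \notin f0 ->
  dz (dzb (liftR (A_T v1 v2 v3 z T)) v) u z =
  cI R * beta P (half_dlog u) (fun p q => conjc (half_dlog v p q)).
Proof.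
move=> uf vf; rewrite (D_entry tri v_cross) //.
pose F a b c := half_dlog u a b * (conjc (half_dlog v b c) - conjc (half_dlog v c a)).
have E : beta P (half_dlog u) (fun p q => conjc (half_dlog v p q)) =
    \sum_(p | dart P p) F p.1 p.2 (third P p.1 p.2) by [].
rewrite E (sum_darts_T z_inj tri v_cross interior) => [|a b c fE]; last first.
  have ne p : p \in f0 -> (p == u) = false by move=> pf; apply: contraNF uf => /eqP <-.
  have [au bu] : (a == u) = false /\ (b == u) = false.
    by split; apply: ne; rewrite -fE !inE eqxx ?orbT.
  by rewrite /F /half_dlog /dlog au bu subrr mul0r mulr0 mul0r.
rewrite !mulr_sumr; apply: eq_bigr => t _; rewrite /herm_form /F /half_dlog.
move: (ccw_list v1 z t).1.1 (ccw_list v1 z t).1.2 (ccw_list v1 z t).2 => a b c.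
move: (dlog z a b u) (dlog z b c u) (dlog z c a u) => p q r.
move: (dlog z a b v) (dlog z b c v) (dlog z c a v) => x y w.
rewrite !(conjc_opp, conjc_add, conjc_mul) conjc_cI.
have -> : conjc (2%:R^-1 : C) = 2%:R^-1 by rewrite conjc_inv conjc_nat.
have -> : 4%:R = 2%:R * 2%:R :> C by rewrite -natrM.
move: (conjc x) (conjc y) (conjc w) => X Y W.
have two : (2%:R : C) != 0 by rewrite pnatr_eq0.
by field: cI2.
Qed.

(** The vector [x] is a velocity of the points, extended to [X] by 0 off the range of [iv], and
    [g p q] is the resulting logarithmic derivative of [z p - z q]. By sesquilinearity the form
    splits into one term per triangle, each nonnegative by [herm_ge0]. *)
Lemma D_form_ge0 N (iv : 'I_N -> V) (x : 'rV[C]_N) :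
  (forall j, iv j \notin f0) ->
  0 <= \sum_i \sum_j x 0 i * dz (dzb (liftR (A_T v1 v2 v3 z T)) (iv j)) (iv i) z * (x 0 j)^*.
Proof.
move=> ivf.
pose X p := \sum_i x 0 i * (p == iv i)%:R.
pose g p q := (X p - X q) / (z p - z q).
have gE p q : \sum_i x 0 i * dlog z p q (iv i) = g p q.
  rewrite /g /X -sumrB mulr_suml; apply: eq_bigr => i _.
  by rewrite /dlog; ring.
have gcE p q : \sum_j conjc (dlog z p q (iv j)) * conjc (x 0 j) = conjc (g p q).
  rewrite -gE; rewrite (rmorph_sum (conjc : {rmorphism C -> C})); apply: eq_bigr => j _.
  by rewrite /= -[LHS]mulrC -conjc_mul.
have split (p q r s p' q' : V) :
    \sum_i \sum_j x 0 i * (dlog z p q (iv i) * conjc (dlog z r s (iv j) - dlog z p' q' (iv j))) * conjc (x 0 j)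
    = g p q * conjc (g r s - g p' q').
  rewrite conjc_add conjc_opp -!gcE -sumrB -gE mulr_suml; apply: eq_bigr => i _.
  rewrite mulr_sumr; apply: eq_bigr => j _; rewrite conjc_add conjc_opp; ring.
have face a b c : \sum_i \sum_j x 0 i * (- (cI R / 4%:R) * herm_form z a b c (iv i) (iv j))
    * conjc (x 0 j) = - (cI R / 4%:R) *
    (g c a * conjc (g b c - g a b) + g a b * conjc (g c a - g b c) + g b c * conjc (g a b - g c a)).
  rewrite -!split -!big_split mulr_sumr; apply: eq_bigr => i _ /=.
  rewrite -!big_split mulr_sumr; apply: eq_bigr => j _ /=.
  rewrite /herm_form; ring.
have -> : \sum_i \sum_j x 0 i * dz (dzb (liftR (A_T v1 v2 v3 z T)) (iv j)) (iv i) z * (x 0 j)^*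
  = \sum_(t in T) \sum_i \sum_j x 0 i * (- (cI R / 4%:R) *
      herm_form z (ccw_list v1 z t).1.1 (ccw_list v1 z t).1.2 (ccw_list v1 z t).2 (iv i) (iv j))
    * conjc (x 0 j).
  rewrite [RHS]exchange_big; apply: eq_bigr => i _; rewrite [RHS]exchange_big; apply: eq_bigr => j _ /=.
  by rewrite (D_entry tri v_cross) // !mulr_sumr mulr_suml.
apply: sumr_ge0 => t tT.
have [_ D] := ccw_listP v1 (T_triangle tri tT).
have [ab bc ca] := cross_neq (lt0r_neq0 D).
by rewrite face; apply: (herm_ge0 ab bc ca); rewrite // -cross_Im ltW.
Qed.

End Entries.

Theorem theorem6 (R : realType) (N : nat) (z : 'I_(3 + N) -> R[i])
    (T : {set {set 'I_(3 + N)}}) (e0 : 'I_(N + N) -> 'I_(3 + N) * 'I_(3 + N)) :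
  let v1 : 'I_(3 + N) := lshift N (inord 0 : 'I_3) in
  let v2 : 'I_(3 + N) := lshift N (inord 1 : 'I_3) in
  let v3 : 'I_(3 + N) := lshift N (inord 2 : 'I_3) in
  let iv (j : 'I_N) : 'I_(3 + N) := rshift 3 j in
  let E0 := [set [set (e0 k).1; (e0 k).2] | k in 'I_(N + N)] in
  (* z1, z2, z3 not collinear *)
  cross z v1 v2 v3 != 0 ->
  (* z4, ..., z_{N+3} lie in the open triangle z1 z2 z3 *)
  (forall j : 'I_N, exists l1 l2 l3 : R, [/\ 0 < l1, 0 < l2, 0 < l3,
      l1 + l2 + l3 = 1 &
      z (iv j) = cR l1 * z v1 + cR l2 * z v2 + cR l3 * z v3]) ->
  (* all points pairwise distinct *)
  injective z ->
  (* T is the unique Delaunay triangulation *)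
  is_Delaunay_triangulation z T ->
  (forall T', is_Delaunay_triangulation z T' -> T' = T) ->
  (* E0 is a set of 2N edges of T (enumerated by e0) whose complement is a
     cycle-rooted spanning tree with odd cycle *)
  (forall k, [set (e0 k).1; (e0 k).2] \in edgesT v1 v2 v3 T) ->
  injective (fun k => [set (e0 k).1; (e0 k).2]) ->
  is_CRST (edgesT v1 v2 v3 T :\: E0) ->
  has_odd_cycle (edgesT v1 v2 v3 T :\: E0) ->
  let J : 'M[R[i]]_(N + N) := \matrix_(i < N + N, k < N + N)
      match fintype.split i with
      | inl j => dz (liftR (theta v1 v2 v3 z T (e0 k).1 (e0 k).2)) (iv j) z
      | inr j => dzb (liftR (theta v1 v2 v3 z T (e0 k).1 (e0 k).2)) (iv j) z
      end in
  let D : 'M[R[i]]_N := \matrix_(u < N, v < N)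
      dz (dzb (liftR (A_T v1 v2 v3 z T)) (iv v)) (iv u) z in
  `| (2%:R / cI R) ^+ N * \det J | = 2%:R ^+ N * \det D.
Proof.
move=> v1 v2 v3 iv E0 v_cross inside z_inj [tri _] _ e0_edge e0_inj.
move=> [_ [H_conn H_card]] [cyc [_ _ cyc_odd cyc_cycle]] J D.
have iv_f0 j : iv j \notin f0 v1 v2 v3.
  by rewrite !inE !negb_or -!val_eqE /= !inordK.
have interior i : i \notin f0 v1 v2 v3 -> exists l1 l2 l3 : R,
    [/\ 0 < l1, 0 < l2, 0 < l3, l1 + l2 + l3 = 1 &
      z i = cR l1 * z v1 + cR l2 * z v2 + cR l3 * z v3].
  rewrite -(splitK i); case: (fintype.split i) => [k | j _]; last exact: inside.
  move=> kf; exfalso; move: kf; rewrite !inE /= -!val_eqE /= !inordK //.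
  by case: k => [[|[|[|]]]].
have surf := surface_T z_inj tri v_cross interior.
have conn := dual_connected_T z_inj tri v_cross interior.
have edgesE := edgesT_edges z_inj tri v_cross interior.
have e0_dart k : dart (pos_face v1 v2 v3 z T) (e0 k).
  have := e0_edge k; have : #|[set (e0 k).1; (e0 k).2]| = 2.
    by have := e0_edge k; rewrite inE => /andP[/eqP].
  rewrite edgesE; case: (e0 k) => a b /=.
  rewrite cards2; case: eqP => // /eqP ab _.
  by rewrite (mem_edges surf).
rewrite edgesE in H_conn H_card cyc_cycle.
have euler : (N + N + 6 = (3 + N) + (3 + N))%N by lia.
pose x (i : 'I_(N + N)) (p q : 'I_(3 + N)) : R[i] :=
  match fintype.split i with
  | inl j => half_dlog z (iv j) p q
  | inr j => conjc (half_dlog z (iv j) p q)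
  end.
have xs i p q : x i p q = x i q p.
  by rewrite /x; case: (fintype.split i) => j; rewrite half_dlogC.
have := det_beta surf conn e0_dart e0_inj H_conn H_card euler cyc_cycle cyc_odd xs.
set P := pos_face v1 v2 v3 z T in surf conn e0_dart *.
have -> : \matrix_(i, k) beta P (indE R[i] (e0 k)) (x i) = J.
  apply/matrixP => i k; rewrite !mxE /x; case: (fintype.split i) => j.
    by rewrite (theta_dz z_inj tri v_cross interior).
  by rewrite (theta_dzb z_inj tri v_cross interior).
pose M : 'M[R[i]]_N := \matrix_(u, v)
  beta P (half_dlog z (iv u)) (fun p q => conjc (half_dlog z (iv v) p q)).
have h0 u v : beta P (half_dlog z u) (half_dlog z v) = 0.
  by rewrite beta_scale (beta_dlog z_inj tri v_cross interior) mulr0.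
(* The diagonal blocks vanish by Arnold's relation and its complex conjugate; the lower left block
   comes from antisymmetry. *)
have -> : \matrix_(i, j) beta P (x i) (x j) = block_mx 0 M (- M^T) 0.
  apply/matrixP => i j; rewrite -(splitK i) -(splitK j) mxE /x !unsplitK.
  case: (fintype.split i) => u; case: (fintype.split j) => v /=.
  - by rewrite block_mxEul h0 mxE.
  - by rewrite block_mxEur mxE.
  - by rewrite block_mxEdl !mxE (beta_anti surf).
  - by rewrite block_mxEdr (beta_map _ (conjc : {rmorphism R[i] -> R[i]})) h0 mxE rmorph0.
rewrite norm_det_antiblock -scaleN1r detZ det_tr normrM normrX normrN1 expr1n mul1r -expr2.
move=> /eqP; rewrite eqrXn2 // => /eqP JM.
have DM : D = cI R *: M.
  by apply/matrixP => u v; rewrite !mxE (D_beta z_inj tri v_cross interior).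
have nI : `|cI R| = 1.
  by apply/eqP; rewrite -(@eqrXn2 _ 2) // -normrX expr2 cI2 normrN1 expr1n.
have nD : `|\det D| = `|\det M| by rewrite DM detZ normrM normrX nI expr1n mul1r.
have D0 : 0 <= \det D.
  apply: det_ge0_form => y; rewrite (eq_bigr (fun u => \sum_v y 0 u *
      dz (dzb (liftR (A_T v1 v2 v3 z T)) (iv v)) (iv u) z * (y 0 v)^*)).
    exact: (D_form_ge0 tri v_cross y iv_f0).
  by move=> u _; apply: eq_bigr => v _; rewrite mxE.
by rewrite normrM normrX normf_div nI divr1 normr_nat JM -nD ger0_norm.
Qed.
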